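(* Let $\beta\in(0,1/2]$. Consider $(\xi_{\mathbf i},\mathbf i\in\mathbb U)$ such that $\xi_\varnothing$ is a $(\beta,\beta)$-string of beads, independent of independent $\beta$-mixed strings of beads $\xi_{\mathbf i}$, $\mathbf i\in\mathbb U\setminus\{\varnothing\}$. For $\mathbf i\in\mathbb U\setminus\{\varnothing\}$ let $\mathcal T^*_{\mathbf i}$ be the a.s. Gromov-Hausdorff limit tree recursively constructed from $(\xi_{\mathbf i\mathbf j},\mathbf j\in\mathbb U)$, and let $\mathcal T^*:=\mathcal T^*_\varnothing:=\phi_\beta(\xi_\varnothing,\mathcal T^*_j,j\ge1)$. Then, almost surely, $$\mathcal T^*_{\mathbf i}=\phi_\beta(\xi_{\mathbf i},\mathcal T^*_{\mathbf ij},j\ge1)\qquad\text{for all }\mathbf i\in\mathbb U.$$ Furthermore, $\mathcal T^*$ can be equipped with a mass measure $\mu^*$: the $l^1(\mathbb U)$-embedded weighted trees $(\check{\mathcal T}^{\rm emb}_n,\check\mu^{\rm emb}_n)$ built from $(\xi_{\mathbf i},\mathbf i\in\mathbb U)$ converge a.s. with respect to $\delta_{\rm HP}$ to a random weighted compact $\mathbb R$-tree $(\check{\mathcal T}^{\rm emb},\check\mu^{\rm emb})$, where $\check\mu^{\rm emb}$ is a probability measure on $\check{\mathcal T}^{\rm emb}$ and $\check{\mathcal T}^{\rm emb}$ is a representative of $\mathcal T^*$; $(\mathcal T^*,\mu^* )$ is the class of $(\check{\mathcal T}^{\rm emb},\check\mu^{\rm emb})$, and it is the a.s. Gromov-Hausdorff-Prokhorov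 limit of the classes of $(\check{\mathcal T}^{\rm emb}_n,\check\mu^{\rm emb}_n)$.
   Context: Trees. An $\mathbb R$-tree is a separable metric space in which any two points are joined by a unique injective path, isometric to an interval of length their distance; all trees are rooted. $\mathbb T$ is the set of root-preserving isometry classes of compact rooted $\mathbb R$-trees with the pointed Gromov-Hausdorff metric; weighted trees carry a Borel probability measure and their root- and measure-preserving isometry classes are compared by the Gromov-Hausdorff-Prokhorov metric (infimum over isometric embeddings into a common metric space of the maximum of the distance of root images, the Hausdorff distance of images and the Prokhorov distance of push-forward measures). Grafting map. For $\ell>0$, $x_i\in[0,\ell]$, $p_i\ge0$ and compact rooted $\mathbb R$-trees $\tau_i$, attach to $[0,\ell]$ (rooted at $0$), for each $i\ge 1$, the tree $\tau_i$ with distances multiplied by $p_i^\beta$, identifying its root with $x_i$. If the result is compact, $\phi_\beta(([0,\ell],(x_i),(p_i)),\tau_i,i\ge1)$ is its class in $\mathbb T$; otherwise it is the class of the one-point tree. Strings of beads. A string of beads is an interval $[0,\ell]$ with a discrete probability measure $\sum_ip_i\delta_{x_i}$, $x_i$ distinct, $p_1\ge p_2\ge\cdots$; it is identified with $([0,\ell],(x_i)_{i\ge1},(p_i)_{i\ge1})$. For $\alpha\in(0,1)$, $\vartheta>0$, an $(\alpha,\vartheta)$-string of beads is defined as follows: let $(S_t)_{t\ge0}$ be a subordinator with Laplace exponent $\Phi(s)=s\Gamma(s+\vartheta)\Gamma(1-\alpha)/\Gamma(s+\vartheta+1-\alpha)$ (no drift), let $\ell_t=\Gamma(1-\alpha)\int_0^te^{-\alpha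 S_s}ds$, $0\le t\le\infty$; the string is $[0,\ell_\infty]$ with an atom at $\ell_t$ of mass $e^{-S_{t-}}-e^{-S_t}$ for each jump time $t$ of $S$. (Its ranked masses are ${\rm PD}(\alpha,\vartheta)$ and its length is their $\alpha$-diversity. For $\alpha=\vartheta=\beta$ it has the law of $([0,L],\sum_mQ_m\delta_{LU_m})$ with $(Q_m)\sim{\rm PD}(\beta,\beta)$, $L=\lim_m m\Gamma(1-\beta)Q_m^\beta$, and independent i.i.d. uniform $U_m$ on $[0,1]$.) $\beta$-mixed strings. For $\beta\in(0,1/2)$ let $([0,\ell_1],\lambda_1)$ be a $(\beta,1-2\beta)$-string of beads, $([0,\ell_2],\lambda_2)$ a $(\beta,\beta)$-string of beads, $B\sim{\rm Beta}(1-2\beta,\beta)$, all independent. The $\beta$-mixed string is the interval $[0,\ell]$, $\ell=B^\beta\ell_1+(1-B)^\beta\ell_2$, with the probability measure $\lambda$ which is the sum of the push-forward of $B\lambda_1$ under $x\mapsto B^\beta x$ and the push-forward of $(1-B)\lambda_2$ under $x\mapsto B^\beta\ell_1+(1-B)^\beta x$. For $\beta=1/2$ (where $B=0$), it is a $(1/2,1/2)$-string of beads. Recursive limit trees. $\mathbb U=\bigcup_{n\ge0}\mathbb N^n$, $\mathbb N^0=\{\varnothing\}$. Write $\xi_{\mathbf i}=([0,L_{\mathbf i}],(X_{\mathbf ij})_j,(P_{\mathbf ij})_j)$. For $\mathbf i\ne\varnothing$, $\mathcal T^*_{\mathbf i}$ is the a.s. Gromov-Hausdorff limit, as $n\to\infty$,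 of trees $\sigma^{(n)}_{\mathbf i}$, where $\sigma^{(0)}_{\mathbf i}=[0,L_{\mathbf i}]$ and $\sigma^{(n+1)}_{\mathbf i}=\phi_\beta(\xi_{\mathbf i},\sigma^{(n)}_{\mathbf ij},j\ge1)$; the limit exists for i.i.d. $\beta$-mixed strings. Embedding. $l^1(\mathbb U)=\{(s_{\mathbf i})\in[0,\infty)^{\mathbb U}:\sum s_{\mathbf i}<\infty\}$ with the $l^1$ metric and unit vectors $e_{\mathbf i}$; compact trees in $l^1(\mathbb U)$ are rooted at $0$; $\delta_{\rm HP}=\max\{\delta_{\rm H},\delta_{\rm P}\}$ (Hausdorff distance of trees, Prokhorov distance of measures). With $\check P_{i_1\ldots i_m}=P_{i_1}P_{i_1i_2}\cdots P_{i_1\ldots i_m}$, $\check P_\varnothing=1$, $\check X_\varnothing=0$, $\check X_{\mathbf ij}=\check X_{\mathbf i}+\check P_{\mathbf i}^\beta X_{\mathbf ij}e_{\mathbf i}$, set $$\check{\mathcal T}^{\rm emb}_n=\bigcup_{m=0}^n\bigcup_{\mathbf i\in\mathbb N^m}(\check X_{\mathbf i}+\check P_{\mathbf i}^\beta[0,L_{\mathbf i}]e_{\mathbf i}),\qquad\check\mu^{\rm emb}_n=\sum_{\mathbf i\in\mathbb N^n,j\ge1}\check P_{\mathbf ij}\delta_{\check X_{\mathbf ij}}.$$ *)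

(* Defs.v *)
From HB Require Import structures.
From mathcomp Require Import all_boot all_order all_algebra.
From mathcomp Require Import all_classical all_reals all_analysis.
From mathcomp Require Import ring lra.

Set Implicit Arguments.
Unset Strict Implicit.
Unset Printing Implicit Defensive.

Import Order.TTheory GRing.Theory Num.Theory.
Import numFieldNormedType.Exports.

Local Open Scope classical_set_scope.
Local Open Scope ring_scope.

(* Words of U = \bigcup_n N^n are elements of [seq nat], with letters counted
   from 0, and [rcons i j] is the word ij. *)

(* The distinguished point [point] of a pointed metric space is its root.
   Isometry classes are handled through representatives: equality of classes
   is [rooted_isometric] (resp. [weighted_isometric]) of representatives. *)
#[short(type="pmetricType")]
HB.structure Definition PointedMetric (K : numDomainType) :=
  { M of Metric K M & isPointed M }.

Section trees.
Context {R : realType}.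

Definition isometric_on (M N : metricType R) (K : set M) (f : M -> N) :=
  forall x y, K x -> K y -> mdist (f x) (f y) = mdist x y.

Definition separable_set (M : metricType R) (K : set M) :=
  exists D : set M, [/\ countable D, D `<=` K & K `<=` closure D].

(* An injective path is unique up to reparametrisation, i.e. as a set. *)
Definition is_rtree (M : metricType R) (K : set M) :=
  separable_set K /\
  forall x y, K x -> K y -> exists g : R -> M,
    [/\ g 0 = x, g (mdist x y) = y,
        g @` `[0, mdist x y] `<=` K,
        (forall s t, s \in `[0, mdist x y] -> t \in `[0, mdist x y] ->
           mdist (g s) (g t) = `|s - t|) &
        forall q : R -> M, {within `[0, 1], continuous q} ->
          {in `[0, 1] &, injective q} -> q @` `[0, 1] `<=` K ->
          q 0 = x -> q 1 = y -> q @` `[0, 1] = g @` `[0, mdist x y]].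

Definition compact_rtree (M : metricType R) (K : set M) :=
  compact K /\ is_rtree K.

Definition rooted_isometric (S T : pmetricType R) :=
  exists f : S -> T,
    [/\ isometric_on setT f, f point = point & range f = setT].

Definition thickening (M : metricType R) (A : set M) (e : R) : set M :=
  [set x | exists2 a, A a & mdist a x < e].

Definition hausdorff_dist (M : metricType R) (A B : set M) : \bar R :=
  ereal_inf [set e%:E | e in
    [set e : R | [/\ 0 < e, A `<=` thickening B e & B `<=` thickening A e]]].

Definition borel_set (M : metricType R) : set (set M) := <<s @open M >>.

Definition prokhorov_dist (M : metricType R) (mu nu : set M -> \bar R) :
    \bar R :=
  ereal_inf [set e%:E | e in
    [set e : R | 0 < e /\ forall A : set M, borel_set A ->
       (mu A <= nu (thickening A e) + e%:E)%E /\
       (nu A <= mu (thickening A e) + e%:E)%E]].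

Definition gh_dist (S T : pmetricType R) : \bar R :=
  ereal_inf [set r : \bar R | exists (Z : metricType R) (f : S -> Z) (g : T -> Z),
    [/\ isometric_on setT f, isometric_on setT g &
        r = maxe (mdist (f point) (g point))%:E
                 (hausdorff_dist (range f) (range g))]].

Definition borel (M : pmetricType R) := g_sigma_algebraType (@open M).

(* A weighted tree is given as a subset [wset], containing the root, of a
   pointed metric space, with a Borel probability measure carried by it. *)
Record weighted_space := WeightedSpace {
  wspace : pmetricType R ;
  wset : set wspace ;
  wmeas : probability (borel wspace) R }.
Arguments wset : clear implicits.
Arguments wmeas : clear implicits.

(* push-forward by a map which is only relevant on [K] *)
Definition push_on (M N : Type) (K : set M) (f : M -> N)
    (mu : set M -> \bar R) : set N -> \bar R :=
  fun A => mu (K `&` f @^-1` A).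

Definition ghp_dist (S T : weighted_space) : \bar R :=
  ereal_inf [set r : \bar R | exists (Z : metricType R)
      (f : wspace S -> Z) (g : wspace T -> Z),
    [/\ isometric_on (wset S) f, isometric_on (wset T) g &
        r = maxe (mdist (f point) (g point))%:E
           (maxe (hausdorff_dist (f @` wset S) (g @` wset T))
                 (prokhorov_dist (push_on (wset S) f (wmeas S))
                                 (push_on (wset T) g (wmeas T))))]].

Definition weighted_isometric (S T : weighted_space) :=
  exists f : wspace S -> wspace T,
    [/\ isometric_on (wset S) f, f point = point, f @` wset S = wset T &
        forall A, borel_set A -> push_on (wset S) f (wmeas S) A = wmeas T A].

Definition is_weighted_tree (M : pmetricType R) (K : set M)
    (mu : probability (borel M) R) :=
  [/\ compact_rtree K, K point & mu K = 1%E].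

Definition hp_dist (M : pmetricType R)
    (a b : set M * probability (borel M) R) : \bar R :=
  maxe (hausdorff_dist a.1 b.1)
       (prokhorov_dist (a.2 : set M -> \bar R) (b.2 : set M -> \bar R)).

Definition hp_open (M : pmetricType R)
    (O : set (set M * probability (borel M) R)) :=
  forall a, O a -> is_weighted_tree a.1 a.2 /\
    exists2 e : R, 0 < e & forall b, is_weighted_tree b.1 b.2 ->
      (hp_dist a b < e%:E)%E -> O b.

(* Borel measurability into the space of weighted trees in [M] with the metric
   [hp_dist]. *)
Definition random_weighted_tree d (Omega : measurableType d)
    (M : pmetricType R) (K : Omega -> set M)
    (mu : Omega -> probability (borel M) R) :=
  (forall w, is_weighted_tree (K w) (mu w)) /\
  forall O, hp_open O -> measurable [set w | O (K w, mu w)].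

End trees.

(* [mass] enumerates the atoms in nonincreasing order. *)
Record beads (R : realType) := Beads {
  len : R ;
  loc : nat -> R ;
  mass : nat -> R ;
  len_gt0 : 0 < len ;
  loc_itv : forall j, 0 <= loc j <= len ;
  loc_inj : injective loc ;
  mass_ge0 : forall j, 0 <= mass j ;
  mass_dec : forall j, mass j.+1 <= mass j ;
  mass_sum : (\sum_(0 <= j <oo) (mass j)%:E = 1)%E }.

HB.instance Definition _ (R : realType) := gen_eqMixin (beads R).
HB.instance Definition _ (R : realType) := gen_choiceMixin (beads R).

Section beads_point.
Context {R : realType}.

Let l0 (j : nat) : R := j.+1%:R^-1.
Let m0 (j : nat) : R := (j == 0)%:R.

Let l0_itv j : 0 <= l0 j <= 1.
Proof. by rewrite invr_ge0 ler0n /= invf_le1 ?ltr0n// ler1n. Qed.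

Let l0_inj : injective l0.
Proof. by move=> i j /invr_inj /eqP; rewrite eqr_nat eqSS => /eqP. Qed.

Let m0_ge0 j : 0 <= m0 j. Proof. exact: ler0n. Qed.

Let m0_dec j : m0 j.+1 <= m0 j. Proof. exact: ler0n. Qed.

Let m0_sum : (\sum_(0 <= j <oo) (m0 j)%:E = 1)%E.
Proof.
rewrite (@nneseriesD1 _ _ 0%N)//=; last by move=> j _; rewrite lee_fin.
rewrite eseries0 ?adde0// => j _ /=.
by rewrite /m0; case: eqP.
Qed.

HB.instance Definition _ := isPointed.Build (beads R)
  (Beads ltr01 l0_itv l0_inj m0_ge0 m0_dec m0_sum).

End beads_point.

Section beads_measurable.
Context {R : realType}.

Definition beads_coord : set (set (beads R)) :=
  [set A | exists2 B : set R, measurable B &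
     [\/ A = (@len R) @^-1` B,
         exists j, A = (fun s => loc s j) @^-1` B |
         exists j, A = (fun s => mass s j) @^-1` B]].

HB.instance Definition _ :=
  Measurable.copy (beads R) (g_sigma_algebraType beads_coord).

Definition beads_measure (s : beads R) (A : set R) : \bar R :=
  (\sum_(0 <= j <oo) (mass s j)%:E * \d_(loc s j) A)%E.

End beads_measurable.

Section laws.
Context {R : realType}.
Local Notation lbg := (@lebesgue_measure R).

Definition same_law d d' d'' (Omega : measurableType d)
    (Omega' : measurableType d') (E : measurableType d'')
    (P : probability Omega R) (X : Omega -> E)
    (P' : probability Omega' R) (X' : Omega' -> E) :=
  forall A, measurable A -> P (X @^-1` A) = P' (X' @^-1` A).

Definition mutually_independent d d' (Omega : measurableType d)
    (E : measurableType d') (P : probability Omega R)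
    (I : eqType) (X : I -> Omega -> E) :=
  forall (J : seq I) (A : I -> set E), uniq J ->
    (forall i, measurable (A i)) ->
    P (\big[setI/setT]_(i <- J) (X i @^-1` A i)) =
    (\big[*%E/1%E]_(i <- J) P (X i @^-1` A i))%E.

Definition independent3 d d1 d2 d3 (Omega : measurableType d)
    (E1 : measurableType d1) (E2 : measurableType d2) (E3 : measurableType d3)
    (P : probability Omega R)
    (X1 : Omega -> E1) (X2 : Omega -> E2) (X3 : Omega -> E3) :=
  forall A1 A2 A3, measurable A1 -> measurable A2 -> measurable A3 ->
    (P (X1 @^-1` A1 `&` X2 @^-1` A2 `&` X3 @^-1` A3) =
     P (X1 @^-1` A1) * P (X2 @^-1` A2) * P (X3 @^-1` A3))%E.

Definition Gamma (x : R) : R :=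
  \int[lbg]_(t in `]0, +oo[) (t `^ (x - 1) * expR (- t)).

Definition has_beta_law d (Omega : measurableType d) (P : probability Omega R)
    (B : Omega -> R) (a b : R) :=
  measurable_fun setT B /\
  forall A, measurable A -> P (B @^-1` A) =
    ((Gamma (a + b) / (Gamma a * Gamma b))%:E *
     \int[lbg]_(x in A `&` `]0%R, 1%R[)
       (x `^ (a - 1) * (1 - x) `^ (b - 1))%R%:E)%E.

Definition laplace_exponent (alpha theta s : R) : R :=
  s * Gamma (s + theta) * Gamma (1 - alpha) / Gamma (s + theta + 1 - alpha).

(* [S t w] is only relevant for [0 <= t] *)
Definition is_subordinator d (Omega : measurableType d)
    (P : probability Omega R) (S : R -> Omega -> R) (Phi : R -> R) :=
  [/\ (forall t, 0 <= t -> measurable_fun setT (S t)),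
      (forall w, [/\ S 0 w = 0,
         (forall s t, 0 <= s -> s <= t -> S s w <= S t w) &
         (forall t, 0 <= t -> S ^~ w @ t^'+ --> S t w)]),
      (forall t : nat -> R, 0 <= t 0%N -> nondecreasing_seq t ->
         mutually_independent P (fun k => S (t k.+1) \- S (t k))),
      (forall t h, 0 <= t -> 0 <= h ->
         same_law P (S (t + h) \- S t) P (S h)) &
      (forall t s, 0 <= t -> 0 <= s ->
         (\int[P]_w (expR (- (s * S t w)))%:E = (expR (- (t * Phi s)))%:E)%E)].

(* [ell] is only evaluated at finite times; the equation for [len s] is in
   extended reals, so that it also says that ell at infinity is finite. *)
Definition string_of_path (alpha : R) (S : R -> R) (s : beads R) :=
  let ell t :=
    Gamma (1 - alpha) * \int[lbg]_(u in `[0, t]) expR (- (alpha * S u)) in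
  let Sminus t := lim (S u @[u --> t^'-]) in
  ((len s)%:E = (Gamma (1 - alpha))%:E *
     \int[lbg]_(u in `[0%R, +oo[) (expR (- (alpha * S u)))%:E)%E /\
  forall A, measurable A -> beads_measure s A =
    (\esum_(t in [set t | (0 < t)%R /\ (Sminus t < S t)%R])
       (expR (- Sminus t) - expR (- S t))%:E * \d_(ell t) A)%E.

Definition is_string d (Omega : measurableType d) (P : probability Omega R)
    (alpha theta : R) (xi : Omega -> beads R) :=
  measurable_fun setT xi /\
  exists (d' : measure_display) (Omega' : measurableType d')
    (P' : probability Omega' R) (S : R -> Omega' -> R)
    (zeta : Omega' -> beads R),
    [/\ is_subordinator P' S (laplace_exponent alpha theta),
        measurable_fun setT zeta,
        {ae P', forall w, string_of_path alpha (S ^~ w) (zeta w)} &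
        same_law P xi P' zeta].

(* [s] is the concatenation of [s1] and [s2] scaled by [b] and [1 - b] *)
Definition mixture_of (beta b : R) (s1 s2 s : beads R) :=
  len s = b `^ beta * len s1 + (1 - b) `^ beta * len s2 /\
  forall A, measurable A -> beads_measure s A =
    (b%:E * beads_measure s1 ((fun x => (b `^ beta * x)%R) @^-1` A) +
     (1 - b)%:E * beads_measure s2
       ((fun x => (b `^ beta * len s1 + (1 - b) `^ beta * x)%R) @^-1` A))%E.

Definition is_mixed_string d (Omega : measurableType d)
    (P : probability Omega R) (beta : R) (xi : Omega -> beads R) :=
  if beta == 2^-1 then is_string P 2^-1 2^-1 xi else
  measurable_fun setT xi /\
  exists (d' : measure_display) (Omega' : measurableType d')
    (P' : probability Omega' R) (zeta1 zeta2 : Omega' -> beads R)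
    (B : Omega' -> R) (zeta : Omega' -> beads R),
    [/\ is_string P' beta (1 - 2 * beta) zeta1 /\
          is_string P' beta beta zeta2,
        has_beta_law P' B (1 - 2 * beta) beta,
        independent3 P' zeta1 zeta2 B,
        measurable_fun setT zeta /\
          {ae P', forall w, mixture_of beta (B w) (zeta1 w) (zeta2 w) (zeta w)} &
        same_law P xi P' zeta].

End laws.

Section interval.
Context {R : realType}.
Implicit Type s : beads R.

Definition interval s := {x : R | 0 <= x <= len s}.

HB.instance Definition _ s := gen_eqMixin (interval s).
HB.instance Definition _ s := gen_choiceMixin (interval s).

Definition interval_dist s (x y : interval s) : R := `|sval x - sval y|.

Let dxx s (x : interval s) : interval_dist x x = 0.
Proof. by rewrite /interval_dist subrr normr0. Qed.

Let d0 s (x y : interval s) : interval_dist x y = 0 -> x = y.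
Proof. by move/eqP; rewrite normr_eq0 subr_eq0 => /eqP; exact: val_inj. Qed.

Let dsym s (x y : interval s) : interval_dist x y = interval_dist y x.
Proof. exact: distrC. Qed.

Let dtri s (y x z : interval s) :
  interval_dist x z <= interval_dist x y + interval_dist y z.
Proof. exact: ler_distD. Qed.

HB.instance Definition _ s := isMetric.Build R (interval s)
  (@dxx s) (@d0 s) (@dsym s) (@dtri s).

Let root_itv s : 0 <= (0 : R) <= len s.
Proof. by rewrite lexx ltW ?len_gt0. Qed.

HB.instance Definition _ s := isPointed.Build (interval s)
  (exist _ (0 : R) (root_itv s)).

Definition bead s (j : nat) : interval s := exist _ (loc s j) (loc_itv s j).

End interval.

(* The points of the i-th grafted tree other than its root, which is identified
   with [bead s i]; a tree grafted with scaling factor 0 adds no point. *)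
Definition graft_branch (R : realType) (s : beads R)
    (tau : nat -> pmetricType R) (i : nat) :=
  {t : tau i | 0 < mass s i /\ t <> point}.

(* [beta] only matters for the metric put on this type below. *)
Definition graft_space (R : realType) (beta : R) (s : beads R)
    (tau : nat -> pmetricType R) : Type :=
  (interval s + {i : nat & graft_branch s tau i})%type.

Section graft.
Context {R : realType} (beta : R) (s : beads R) (tau : nat -> pmetricType R).
Local Notation graft := (graft_space beta s tau).
Local Notation graft_branch := (graft_branch s tau).

HB.instance Definition _ := gen_eqMixin graft.
HB.instance Definition _ := gen_choiceMixin graft.

(* scaled distance from a branch point to the point its tree is grafted on *)
Definition graft_height (u : {i : nat & graft_branch i}) : R :=
  mass s (tag u) `^ beta * mdist point (sval (tagged u)).

Definition graft_dist (a b : graft) : R :=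
  match a, b with
  | inl x, inl y => mdist x y
  | inl x, inr v => mdist x (bead s (tag v)) + graft_height v
  | inr u, inl y => graft_height u + mdist (bead s (tag u)) y
  | inr u, inr v =>
      if tag u == tag v then
        mass s (tag u) `^ beta *
          mdist (sval (tagged u)) (sval (tagged_as u v))
      else graft_height u + mdist (bead s (tag u)) (bead s (tag v)) +
           graft_height v
  end.

Let c_gt0 i (t : graft_branch i) : 0 < mass s i `^ beta.
Proof. by apply: powR_gt0; case: (svalP t). Qed.

Let h_gt0 u : 0 < graft_height u.
Proof.
rewrite /graft_height mulr_gt0 ?(c_gt0 (tagged u))// mdist_gt0.
by apply/eqP => /esym; case: (svalP (tagged u)).
Qed.

Let same_dist i (t t' : graft_branch i) :
  graft_dist (inr (existT _ i t)) (inr (existT _ i t')) =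
  mass s i `^ beta * mdist (sval t) (sval t').
Proof.
rewrite /= eqxx; congr (_ * mdist _ (sval _)).
exact: (@tagged_asE _ _ (existT _ i t) t').
Qed.

Let diff_dist i j (t : graft_branch i) (t' : graft_branch j) : i != j ->
  graft_dist (inr (existT _ i t)) (inr (existT _ j t')) =
  graft_height (existT _ i t) + mdist (bead s i) (bead s j) +
  graft_height (existT _ j t').
Proof. by move=> ij; rewrite /= (negbTE ij). Qed.

Let gxx a : graft_dist a a = 0.
Proof. by case: a => [x|[i t]]; rewrite ?same_dist /= mdistxx ?mulr0. Qed.

Let g0 a b : graft_dist a b = 0 -> a = b.
Proof.
case: a b => [x|[i t]] [y|[j t']].
- by move/mdist_positivity => ->.
- by move=> /= /eqP; rewrite gt_eqF// ltr_wpDl ?mdist_ge0.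
- by move=> /= /eqP; rewrite gt_eqF// ltr_wpDr ?mdist_ge0.
- have [ij|ij] := eqVneq i j; last first.
    by rewrite diff_dist// => /eqP; rewrite gt_eqF// ltr_wpDl ?addr_ge0 ?mdist_ge0 ?ltW.
  case: _ / ij t' => t'; rewrite same_dist => /eqP.
  rewrite mulf_eq0 gt_eqF ?(c_gt0 t)//= => /eqP /mdist_positivity.
  by case: t t' => [t ht] [t' ht'] /= e; congr (inr (existT _ _ _)); exact: eq_exist.
Qed.

Let gsym a b : graft_dist a b = graft_dist b a.
Proof.
case: a b => [x|[i t]] [y|[j t']].
- exact: metric_sym.
- by rewrite /= addrC metric_sym.
- by rewrite /= addrC metric_sym.
- have [ij|ij] := eqVneq i j; last first.
    rewrite (diff_dist t t')// (diff_dist t' t) 1?eq_sym//.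
    by rewrite (metric_sym (bead s i)); ring.
  by case: _ / ij t' => t'; rewrite !same_dist metric_sym.
Qed.

Let h_tri i (t t' : graft_branch i) :
  graft_height (existT _ i t) <=
  graft_height (existT _ i t') + mass s i `^ beta * mdist (sval t') (sval t).
Proof.
by rewrite /graft_height /= -mulrDr ler_pM2l ?(c_gt0 t)// metric_triangle.
Qed.

Let h_tri2 i (t t' : graft_branch i) :
  mass s i `^ beta * mdist (sval t') (sval t) <=
  graft_height (existT _ i t) + graft_height (existT _ i t').
Proof.
rewrite /graft_height /= -mulrDr ler_pM2l ?(c_gt0 t)//.
by rewrite (le_trans (metric_triangle _ point _))// addrC [X in _ + X]metric_sym.
Qed.

Let gtri b a c : graft_dist a c <= graft_dist a b + graft_dist b c.
Proof.
case: a b c => [x|[i t]] [y|[j u]] [z|[k v]].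
- exact: metric_triangle.
- rewrite /= addrA lerD2r; exact: metric_triangle.
- have := metric_triangle x (bead s j) z; have := h_gt0 (existT _ j u) => /=; lra.
- have [jk|jk] := eqVneq j k; last first.
    rewrite diff_dist//=; have := h_gt0 (existT _ j u).
    have := metric_triangle x (bead s j) (bead s k); lra.
  case: _ / jk v => v; rewrite same_dist /=; have := h_tri v u; lra.
- rewrite /=; have := metric_triangle (bead s i) y z; lra.
- have [ik|ik] := eqVneq i k; last first.
    rewrite diff_dist//=; have := metric_triangle (bead s i) y (bead s k); lra.
  case: _ / ik v => v; rewrite same_dist /=; have := h_tri2 v t.
  have := mdist_ge0 (bead s i) y; have := mdist_ge0 y (bead s i); lra.
- have [ij|ij] := eqVneq i j; last first.
    rewrite diff_dist//=; have := h_gt0 (existT _ j u).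
    have := metric_triangle (bead s i) (bead s j) z; lra.
  case: _ / ij u => u; rewrite same_dist /=; have := h_tri t u.
  rewrite [mdist (sval u) _]metric_sym; lra.
- have [ij|ij] := eqVneq i j.
    case: _ / ij u => u; rewrite same_dist; have [ik|ik] := eqVneq i k.
      case: _ / ik v => v; rewrite !same_dist -mulrDr ler_pM2l ?(c_gt0 t)//.
      exact: metric_triangle.
    rewrite !diff_dist//; have := h_tri t u.
    rewrite [mdist (sval u) _]metric_sym; lra.
  rewrite (diff_dist t u)//; have [jk|jk] := eqVneq j k.
    case: _ / jk v => v; rewrite same_dist diff_dist//; have := h_tri v u; lra.
  rewrite (diff_dist u v)//; have := h_gt0 (existT _ j u).
  have [ik|ik] := eqVneq i k.
    case: _ / ik v jk => v jk; rewrite same_dist; have := h_tri2 v t.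
    have := mdist_ge0 (bead s i) (bead s j).
    have := mdist_ge0 (bead s j) (bead s i); lra.
  rewrite diff_dist//.
  have := metric_triangle (bead s i) (bead s j) (bead s k); lra.
Qed.

HB.instance Definition _ := isMetric.Build R graft gxx g0 gsym gtri.
HB.instance Definition _ := isPointed.Build graft (inl point).

End graft.

Section one_point.
Context {R : realType}.

Definition one_point : Type := unit.

HB.instance Definition _ := Choice.copy one_point unit.

Definition one_point_dist (x y : one_point) : R := 0.

Let oxx x : one_point_dist x x = 0. Proof. by []. Qed.
Let o0 x y : one_point_dist x y = 0 -> x = y.
Proof. by case: x; case: y. Qed.
Let osym x y : one_point_dist x y = one_point_dist y x. Proof. by []. Qed.
Let otri y x z :
  one_point_dist x z <= one_point_dist x y + one_point_dist y z.
Proof. by rewrite /one_point_dist addr0. Qed.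

HB.instance Definition _ := isMetric.Build R one_point oxx o0 osym otri.
HB.instance Definition _ := isPointed.Build one_point tt.

End one_point.

Section recursive_trees.
Context {R : realType} (beta : R).

Definition phi (s : beads R) (tau : nat -> pmetricType R) : pmetricType R :=
  if `[< compact [set: graft_space beta s tau] >]
  then (graft_space beta s tau : pmetricType R)
  else (one_point : pmetricType R).

(* Limits are unique up to [rooted_isometric]; the one-point tree is a default
   value for sequences without limit. *)
Definition gh_limit (u : nat -> pmetricType R) : pmetricType R :=
  if pselect (exists T : pmetricType R, compact_rtree [set: T] /\
                gh_dist (u n) T @[n --> \oo] --> 0%E) is left h
  then projT1 (cid h) else (one_point : pmetricType R).

Fixpoint sigma (x : seq nat -> beads R) (n : nat) (i : seq nat) :
    pmetricType R :=
  if n is n'.+1 then phi (x i) (fun j => sigma x n' (rcons i j))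
  else (interval (x i) : pmetricType R).

Definition Tstar (x : seq nat -> beads R) (i : seq nat) : pmetricType R :=
  let limit i := gh_limit (fun n => sigma x n i) in
  if i is [::] then phi (x [::]) (fun j => limit [:: j]) else limit i.

End recursive_trees.

Section l1.
Context {R : realType}.

Definition in_l1 (f : seq nat -> R) :=
  (forall u, 0 <= f u) /\ (\esum_(u in setT) (f u)%:E < +oo)%E.

Record l1U := L1U { l1_fun :> seq nat -> R ; l1P : in_l1 l1_fun }.

HB.instance Definition _ := gen_eqMixin l1U.
HB.instance Definition _ := gen_choiceMixin l1U.

Definition l1_dist (f g : l1U) : R :=
  fine (\esum_(u in setT) `|f u - g u|%:E)%E.

Let l1_fin (f g : l1U) : (\esum_(u in setT) `|f u - g u|%:E)%E \is a fin_num.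
Proof.
rewrite ge0_fin_numE; last by apply: esum_ge0 => u _; rewrite lee_fin.
have [[f0 ff] [g0 gf]] := (l1P f, l1P g).
apply: (@le_lt_trans _ _ (\esum_(u in setT) ((f u)%:E + (g u)%:E))%E).
  apply: le_esum => u _; rewrite -EFinD lee_fin.
  by rewrite (le_trans (ler_normB _ _))// !ger0_norm.
by rewrite esumD ?lte_add_pinfty// => u _; rewrite lee_fin.
Qed.

Let lxx f : l1_dist f f = 0.
Proof. by rewrite /l1_dist esum1// => u _; rewrite subrr normr0. Qed.

Let l0 f g : l1_dist f g = 0 -> f = g.
Proof.
move=> fg; have {}fg : (\esum_(u in setT) `|f u - g u|%:E)%E = 0%E.
  by rewrite -(fineK (l1_fin f g)) -/(l1_dist f g) fg.
have {fg} e : l1_fun f = l1_fun g.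
  apply/funext => u; apply/eqP; rewrite -subr_eq0 -normr_eq0 eq_le normr_ge0.
  rewrite andbT; have : (`|f u - g u|%:E <= 0)%E; last by rewrite lee_fin.
  rewrite -fg; apply: esum_ge; exists [set u]; first by split.
  by rewrite fsbig_set1.
by case: f g e => [f hf] [g hg] /= e; subst g; rewrite (Prop_irrelevance hf hg).
Qed.

Let lsym f g : l1_dist f g = l1_dist g f.
Proof. by congr fine; apply: eq_esum => u _; rewrite distrC. Qed.

Let ltri g f h : l1_dist f h <= l1_dist f g + l1_dist g h.
Proof.
rewrite /l1_dist -fineD// fine_le// ?fin_numD ?l1_fin// -esumD//.
by apply: le_esum => u _; rewrite -EFinD lee_fin ler_distD.
Qed.

HB.instance Definition _ := isMetric.Build R l1U lxx l0 lsym ltri.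

Let in_l1_0 : in_l1 (fun=> 0).
Proof. by split=> //; rewrite esum1. Qed.

HB.instance Definition _ := isPointed.Build l1U (L1U in_l1_0).

Definition unit_vec (i : seq nat) : seq nat -> R := fun u => (u == i)%:R.

Lemma in_l1D f g : in_l1 f -> in_l1 g -> in_l1 (f + g).
Proof.
move=> [f0 fs] [g0 gs]; split=> [u|]; first exact: addr_ge0.
under eq_esum do rewrite EFinD.
by rewrite esumD ?lte_add_pinfty// => u _; rewrite lee_fin.
Qed.

Lemma in_l1_unit c i : 0 <= c -> in_l1 (c *: unit_vec i).
Proof.
move=> c0; split=> [u|]; first by rewrite mulr_ge0.
rewrite (esumID [set i])// => [|u _]; last by rewrite lee_fin mulr_ge0.
rewrite setTI esum_set1 ?lee_fin ?mulr_ge0// esum1 ?adde0 ?ltry// => u [_ /eqP ui].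
by rewrite (_ : (c *: unit_vec i) u = c * (u == i)%:R)// (negbTE ui) mulr0.
Qed.

End l1.
Arguments l1U : clear implicits.

Section embedding.
Context {R : realType} (beta : R) (x : seq nat -> beads R).

(* For i = i_1 ... i_m, the factor of index k is P_{i_1 ... i_k i_{k+1}}. *)
Definition checkP (i : seq nat) : R :=
  \prod_(k < size i) mass (x (take k i)) (nth 0%N i k).

Definition checkX (i : seq nat) : seq nat -> R :=
  \sum_(k < size i)
    (checkP (take k i) `^ beta * loc (x (take k i)) (nth 0%N i k)) *:
    unit_vec (take k i).

Lemma checkP_nil : checkP [::] = 1.
Proof. by rewrite /checkP big_ord0. Qed.

Lemma checkX_nil : checkX [::] = 0.
Proof. by rewrite /checkX big_ord0. Qed.

Lemma checkP_rcons i j : checkP (rcons i j) = checkP i * mass (x i) j.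
Proof.
rewrite /checkP size_rcons big_ord_recr /=; congr (_ * _).
  apply: eq_bigr => k _; rewrite nth_rcons ltn_ord -cats1 takel_cat//.
  exact/ltnW/ltn_ord.
by rewrite nth_rcons ltnn eqxx -cats1 take_size_cat.
Qed.

Lemma checkX_rcons i j :
  checkX (rcons i j) =
  checkX i + (checkP i `^ beta * loc (x i) j) *: unit_vec i.
Proof.
rewrite /checkX size_rcons big_ord_recr /=; congr (_ + _).
  apply: eq_bigr => k _; rewrite nth_rcons ltn_ord -cats1 takel_cat//.
  exact/ltnW/ltn_ord.
by rewrite nth_rcons ltnn eqxx -cats1 take_size_cat.
Qed.

Lemma checkP_ge0 i : 0 <= checkP i.
Proof. by apply: prodr_ge0 => k _; exact: mass_ge0. Qed.

Lemma checkX_l1 i : in_l1 (checkX i).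
Proof.
elim/last_ind: i => [|i j IH].
  rewrite checkX_nil; split=> // ; rewrite esum1//.
rewrite checkX_rcons; apply: in_l1D => //; apply: in_l1_unit.
by rewrite mulr_ge0 ?powR_ge0//; case/andP: (loc_itv (x i) j).
Qed.

Lemma emb_point_l1 i (t : interval (x i)) :
  in_l1 (checkX i + (checkP i `^ beta * sval t) *: unit_vec i).
Proof.
apply: in_l1D; first exact: checkX_l1.
by apply: in_l1_unit; rewrite mulr_ge0 ?powR_ge0//; case/andP: (svalP t).
Qed.

(* [emb_point (bead (x i) j)] is the vector [checkX (rcons i j)]. *)
Definition emb_point i (t : interval (x i)) : l1U R := L1U (emb_point_l1 t).

Definition emb_tree (n : nat) : set (l1U R) :=
  \bigcup_(i in [set i : seq nat | (size i <= n)%N]) range (@emb_point i).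

Definition emb_measure (n : nat) (A : set (borel (l1U R))) : \bar R :=
  (\esum_(ij in [set ij : seq nat * nat | size ij.1 = n])
     (checkP (rcons ij.1 ij.2))%:E *
       \d_(emb_point (bead (x ij.1) ij.2) : borel (l1U R)) A)%E.

Section emb_measure_probability.
Variable n : nat.
Local Open Scope ereal_scope.

Let em0 : emb_measure n set0 = 0.
Proof. by rewrite /emb_measure esum1// => ij _; rewrite dirac0 mule0. Qed.

Let t_ge0 (ij : seq nat * nat) (A : set (borel (l1U R))) :
  0 <= (checkP (rcons ij.1 ij.2))%:E *
       \d_(emb_point (bead (x ij.1) ij.2) : borel (l1U R)) A.
Proof. by rewrite mule_ge0// ?lee_fin ?checkP_ge0// diracE lee_fin. Qed.

Let em_ge0 A : 0 <= emb_measure n A.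
Proof. by apply: esum_ge0 => ij _; exact: t_ge0. Qed.

Let esum_swap (I J : choiceType) (A : set I) (B : set J) (a : I -> J -> \bar R) :
  (forall i j, 0 <= a i j) ->
  \esum_(i in A) \esum_(j in B) a i j = \esum_(j in B) \esum_(i in A) a i j.
Proof.
move=> a0; rewrite (@esum_esum _ _ _ A (fun=> B))//.
rewrite (@esum_esum _ _ _ B (fun=> A) (fun j i => a i j))//.
rewrite (@reindex_esum _ _ _ (B `*`` fun=> A) (A `*`` fun=> B)
  (fun k => (k.2, k.1)))//.
split=> [[j i] [/= ? ?]//|[j i] [j' i'] _ _ [-> ->]//|[i j] [/= ? ?]].
by exists (j, i).
Qed.

Let em_sigma : semi_sigma_additive (emb_measure n).
Proof.
move=> F mF tF mUF.
rewrite [X in _ --> X](_ : _ = \sum_(0 <= k <oo) emb_measure n (F k)); last first.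
  rewrite nneseries_esumT// /emb_measure esum_swap//.
  apply: eq_esum => ij _; rewrite -nneseries_esumT// nneseriesZl//.
  by rewrite measure_semi_bigcup.
exact: is_cvg_nneseries.
Qed.

HB.instance Definition _ :=
  isMeasure.Build _ (borel (l1U R)) R (emb_measure n) em0 em_ge0 em_sigma.

Let esum_rcons m (a : seq nat -> \bar R) : (forall i, 0 <= a i) ->
  \esum_(i in [set i | size i = m.+1]) a i =
  \esum_(i in [set i | size i = m]) \esum_(j in [set: nat]) a (rcons i j).
Proof.
move=> a0; rewrite (@esum_esum _ _ _ _ (fun=> setT) (fun i j => a (rcons i j)))//.
rewrite (@reindex_esum _ _ _ ([set i | size i = m] `*`` fun=> setT) _
  (fun k => rcons k.1 k.2))//.
split=> [[i j] [/= im _]|[i j] [i' j'] _ _ /rcons_inj[-> ->]//|i].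
  by rewrite /= size_rcons im.
case/lastP: i => //= i j; rewrite size_rcons => -[im].
by exists (i, j).
Qed.

Let mass_esum i :
  \esum_(j in [set: nat]) (checkP (rcons i j))%:E = (checkP i)%:E.
Proof.
under eq_esum do rewrite checkP_rcons EFinM.
rewrite -nneseries_esumT => [|j]; last first.
  by rewrite mule_ge0// lee_fin ?checkP_ge0 ?mass_ge0.
rewrite nneseriesZl; last by move=> j _; rewrite lee_fin mass_ge0.
by rewrite mass_sum mule1.
Qed.

Let checkP_esum m : \esum_(i in [set i | size i = m]) (checkP i)%:E = 1.
Proof.
elim: m => [|m IH].
  rewrite (_ : [set i | _] = [set [::]]).
    by rewrite esum_set1 ?checkP_nil// lee_fin.
  by apply/seteqP; split=> [i /= /size0nil//|i ->].
rewrite esum_rcons => [|i]; last by rewrite lee_fin checkP_ge0.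
by under eq_esum do rewrite mass_esum.
Qed.

Let emT : emb_measure n setT = 1.
Proof.
rewrite /emb_measure; under eq_esum do rewrite diracT mule1.
rewrite -[RHS](checkP_esum n.+1) esum_rcons => [|i]; last first.
  by rewrite lee_fin checkP_ge0.
rewrite (@esum_esum _ _ _ _ (fun=> setT)) => [|i j _ _]; last first.
  by rewrite lee_fin checkP_ge0.
by congr esum; apply/seteqP; split=> [ij|ij []].
Qed.

HB.instance Definition _ :=
  Measure_isProbability.Build _ (borel (l1U R)) R (emb_measure n) emT.

End emb_measure_probability.

End embedding.

(* Main.v *)
(* The tree is the set of points of l^1(U) whose coordinates live on one branch
   of the tree of words, stay below the segment lengths and leave each segment
   at the bead which the next letter points to. It is a compact R-tree, and the
   Hausdorff limit of the truncated trees, as soon as the family is tight: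
   uniformly on this set, the coordinates off a finite set of words have small
   sum. Grafting commutes with this embedding and Gromov-Hausdorff limits are
   unique, which gives the recursion.

   Tightness comes from moments. For p beta >= 2, independence bounds the p-th
   moment of the segment length of a word u by C E[P_{u_1}^2] E[P_{u_1 u_2}^2]
   ..., whose sum over the words of length n is at most C rho^n, where rho < 1
   bounds the mean mass of the heaviest bead: the squared masses of a string add
   up to at most its largest mass. Hence for some r < 1 all but finitely many
   words u have a segment shorter than r^|u|. For a string driven by a
   subordinator S, both the moments of the length and the largest mass are
   controlled by the Laplace transform of S at integer times.

   The mass measure is the law of a point read off a uniform variable: nested
   intervals of lengths P_u spell an infinite word. Truncating the point at
   depth n yields the n-th approximating measure, hence a coupling which bounds
   the Prokhorov distance. *)

From HB Require Import structures.
From mathcomp Require Import all_boot all_order all_algebra.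
From mathcomp Require Import all_classical all_reals all_analysis.
From mathcomp Require Import measurable_realfun.
From mathcomp Require Import ring lra.
Require Import Defs.

Set Implicit Arguments.
Unset Strict Implicit.
Unset Printing Implicit Defensive.

Import Order.TTheory GRing.Theory Num.Theory.
Import numFieldNormedType.Exports.

Local Open Scope classical_set_scope.
Local Open Scope ring_scope.

(** * Hausdorff and Prokhorov distances *)

(** [gh_limit] returns an arbitrary representative, so nothing is computed with the trees
    themselves: each is identified through an isometry onto an explicit subset of [l1U], and two
    trees with the same image are isometric. The coordinates also decide the tree property, since
    Gromov products at the origin are sums of coordinatewise minima.

    The laws of the strings are reached through an auxiliary subordinator. The signs of its exponent
    are drawn from the existence of strings of finite positive length.

    The square in the moments is what makes them contract: the masses of a string add up to 1, which
    gives no decay by itself. The condition on p beta turns scaling factors into such squares. The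
    rate rho^n is then split into two halves: one allows the division of lengths by r^|u|, the other
    keeps the sum over words finite.

    Measurability of the random tree is obtained without separability of the space of weighted
    trees: the tree is a limit of maps with values in a countable set, for which the preimage of any
    set is measurable. *)

Section ereal_cvg.
Context {R : realType}.

Lemma ereal_cvg0P (u : (\bar R)^nat) : (forall n, (0 <= u n)%E) ->
  (u @ \oo --> 0%E) <->
  (forall e : R, 0 < e -> \forall n \near \oo, (u n < e%:E)%E).
Proof.
move=> u0; split=> [/fine_cvgP[fu cu] e e0|h].
  have {}cu : \forall n \near \oo, `|0 - fine (u n)| < e.
    by move/cvgrPdist_lt : cu => /(_ _ e0).
  near=> n.
  have un : u n \is a fin_num by near: n.
  have : `|0 - fine (u n)| < e by near: n.
  rewrite sub0r normrN => /(le_lt_trans (ler_norm _)).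
  by rewrite -lte_fin fineK.
apply/fine_cvgP; split.
  near=> n; rewrite ge0_fin_numE// (@lt_trans _ _ 1%:E) ?ltry//.
  by near: n; exact: h.
apply/cvgrPdist_lt => e e0; near=> n.
have un1 : (u n < e%:E)%E by near: n; exact: h.
have un : u n \is a fin_num by rewrite ge0_fin_numE// (lt_trans un1) ?ltry.
by rewrite sub0r normrN ger0_norm ?fine_ge0// -lte_fin fineK.
Unshelve. all: by end_near. Qed.

End ereal_cvg.

Section inf_dist.
Context {R : realType}.
Local Open Scope ereal_scope.

Lemma inf_EFin_ge0 (E : set R) : (forall e, E e -> (0 < e)%R) ->
  0 <= ereal_inf [set e%:E | e in E].
Proof.
by move=> h; apply: le_ereal_inf_tmp => _ [e /h e0 <-]; rewrite lee_fin ltW.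
Qed.

Lemma inf_EFin_lt (E : set R) (r : R) :
  ereal_inf [set e%:E | e in E] < r%:E -> exists2 e, E e & (e < r)%R.
Proof. by move/ereal_inf_lt => [_ [e Ee <-]]; rewrite lte_fin; exists e. Qed.

(** Hausdorff and Prokhorov distances are both infima of admissible radii, so both triangle
    inequalities reduce to the additivity of admissible radii. An infimum is infinite when no radius
    is admissible. *)
Lemma inf_EFin_triangle (E F G : set R) :
  (forall e f, E e -> F f -> G (e + f)%R) ->
  (forall e, E e -> (0 < e)%R) -> (forall e, F e -> (0 < e)%R) ->
  ereal_inf [set e%:E | e in G] <=
  ereal_inf [set e%:E | e in E] + ereal_inf [set e%:E | e in F].
Proof.
move=> EFG E0 F0; have iE := inf_EFin_ge0 E0; have iF := inf_EFin_ge0 F0.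
have [->|fE] := eqVneq (ereal_inf [set e%:E | e in E]) +oo.
  by rewrite addye ?leey// gt_eqF// (lt_le_trans _ iF)// ltNy0.
have [->|fF] := eqVneq (ereal_inf [set e%:E | e in F]) +oo.
  by rewrite addey ?leey// gt_eqF// (lt_le_trans _ iE)// ltNy0.
have {}fE : ereal_inf [set e%:E | e in E] \is a fin_num.
  by rewrite ge0_fin_numE// ltey.
have {}fF : ereal_inf [set e%:E | e in F] \is a fin_num.
  by rewrite ge0_fin_numE// ltey.
apply/lee_addgt0Pr => d d0.
have d2 : (0 < d / 2)%R by rewrite divr_gt0.
have [e Ee] : exists2 e, E e & (e < fine (ereal_inf [set e%:E | e in E]) + d / 2)%R.
  by apply: inf_EFin_lt; rewrite EFinD fineK// lteDl// lte_fin.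
have [f Ff] : exists2 f, F f & (f < fine (ereal_inf [set e%:E | e in F]) + d / 2)%R.
  by apply: inf_EFin_lt; rewrite EFinD fineK// lteDl// lte_fin.
move=> hf he; rewrite -(fineK fE) -(fineK fF) -!EFinD.
apply: (@le_trans _ _ (e + f)%:E).
  by apply: ereal_inf_lbound; exists (e + f)%R => //; exact: EFG.
by rewrite lee_fin; lra.
Qed.

End inf_dist.

Section hausdorff_prokhorov.
Context {R : realType}.
Implicit Type M : metricType R.

Lemma thickening_sub M (A B : set M) e : A `<=` B ->
  thickening A e `<=` thickening B e.
Proof. by move=> AB x [a /AB Ba ax]; exists a. Qed.

Lemma thickeningD M (A : set M) e f :
  thickening (thickening A e) f `<=` thickening A (e + f).
Proof.
move=> x [y [a Aa ay] yx]; exists a => //.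
by rewrite (le_lt_trans (metric_triangle _ y _))// ltrD.
Qed.

Lemma sub_thickening M (A : set M) e : 0 < e -> A `<=` thickening A e.
Proof. by move=> e0 x Ax; exists x => //; rewrite mdistxx. Qed.

Lemma open_thickening M (A : set M) e : open (thickening A e).
Proof.
rewrite openE => x [a Aa ax]; apply/metricType_numDomainType.nbhs_mdistP.
exists (e - mdist a x) => /=; first by rewrite subr_gt0.
move=> y xy; exists a => //.
by rewrite (le_lt_trans (metric_triangle _ x _))// addrC -ltrBrDr.
Qed.

Lemma borel_thickening M (A : set M) e : borel_set (thickening A e).
Proof. by apply: sub_gen_smallest; exact: open_thickening. Qed.

Lemma hausdorff_dist_ge0 M (A B : set M) : (0 <= hausdorff_dist A B)%E.
Proof. by apply: inf_EFin_ge0 => e []. Qed.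

Lemma hausdorff_distC M (A B : set M) : hausdorff_dist A B = hausdorff_dist B A.
Proof.
by congr ereal_inf; congr image; apply/seteqP; split=> e [].
Qed.

Lemma hausdorff_dist_triangle M (A B C : set M) :
  (hausdorff_dist A C <= hausdorff_dist A B + hausdorff_dist B C)%E.
Proof.
apply: inf_EFin_triangle => [e f [e0 AB BA] [f0 BC CB]|e []//|e []//].
split; first exact: addr_gt0.
  rewrite addrC; apply: subset_trans (@thickeningD _ _ _ _).
  exact: subset_trans AB (thickening_sub _).
apply: subset_trans (@thickeningD _ _ _ _).
exact: subset_trans CB (thickening_sub _).
Qed.

Lemma hausdorff_dist_le M (A B : set M) (e : R) : 0 < e ->
  A `<=` thickening B e -> B `<=` thickening A e ->
  (hausdorff_dist A B <= e%:E)%E.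
Proof. by move=> e0 AB BA; apply: ereal_inf_lbound; exists e. Qed.

Lemma prokhorov_distC M (mu nu : set M -> \bar R) :
  prokhorov_dist mu nu = prokhorov_dist nu mu.
Proof.
congr ereal_inf; congr image.
by apply/seteqP; split=> e [e0 h]; split=> // A /h[].
Qed.

Lemma prokhorov_dist_triangle (M : pmetricType R)
    (mu nu la : probability (borel M) R) :
  (prokhorov_dist (mu : set M -> \bar R) (la : set M -> \bar R) <=
   prokhorov_dist (mu : set M -> \bar R) (nu : set M -> \bar R) +
   prokhorov_dist (nu : set M -> \bar R) (la : set M -> \bar R))%E.
Proof.
have key (m1 m2 m3 : probability (borel M) R) (e f : R) :
    (forall A, borel_set A -> (m1 A <= m2 (thickening A e) + e%:E)%E) ->
    (forall A, borel_set A -> (m2 A <= m3 (thickening A f) + f%:E)%E) ->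
    forall A, borel_set A -> (m1 A <= m3 (thickening A (e + f)) + (e + f)%:E)%E.
  move=> h1 h2 A bA; apply: (le_trans (h1 A bA)).
  apply: (@le_trans _ _ (m3 (thickening (thickening A e) f) + f%:E + e%:E)%E).
    by rewrite leeD2r//; apply: h2; exact: borel_thickening.
  rewrite -addeA -EFinD [f + e]addrC leeD2r//.
  apply: le_measure; rewrite ?inE; [exact: borel_thickening..|].
  exact: thickeningD.
apply: inf_EFin_triangle => [e f [e0 h] [f0 k]|e []//|e []//].
split; first exact: addr_gt0.
move=> A bA; split.
  by apply: (key mu nu la) => // B bB; [exact: (h B bB).1|exact: (k B bB).1].
by rewrite (addrC e f); apply: (key la nu mu) => // B bB;
  [exact: (k B bB).2|exact: (h B bB).2].
Qed.

Section hp.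
Variable M : pmetricType R.
Implicit Types a b c : set M * probability (borel M) R.

Lemma hp_dist_ge0 a b : (0 <= hp_dist a b)%E.
Proof. by rewrite le_max hausdorff_dist_ge0. Qed.

Lemma hp_distC a b : hp_dist a b = hp_dist b a.
Proof. by rewrite /hp_dist hausdorff_distC prokhorov_distC. Qed.

Lemma hp_dist_triangle b a c : (hp_dist a c <= hp_dist a b + hp_dist b c)%E.
Proof.
rewrite {1}/hp_dist ge_max; apply/andP; split.
  apply: (le_trans (hausdorff_dist_triangle _ b.1 _)).
  by apply: leeD; rewrite le_max lexx.
apply: (le_trans (prokhorov_dist_triangle _ b.2 _)).
by apply: leeD; rewrite le_max lexx orbT.
Qed.

Lemma hp_distxx a : hp_dist a a = 0%E.
Proof.
apply/eqP; rewrite eq_le hp_dist_ge0 andbT; apply/lee_addgt0Pr => e e0.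
rewrite add0e ge_max; apply/andP; split.
  by apply: hausdorff_dist_le => //; exact: sub_thickening.
apply: ereal_inf_lbound; exists e => //; split=> // A bA.
suff : (a.2 A <= a.2 (thickening A e) + e%:E)%E by [].
apply: (@le_trans _ _ (a.2 (thickening A e))).
  apply: le_measure; rewrite ?inE//; first exact: borel_thickening.
  exact: sub_thickening.
by rewrite leeDl// lee_fin ltW.
Qed.

Lemma hp_dist_le a b (e : R) :
  (hausdorff_dist a.1 b.1 <= e%:E)%E ->
  (prokhorov_dist (a.2 : set M -> \bar R) (b.2 : set M -> \bar R) <= e%:E)%E ->
  (hp_dist a b <= e%:E)%E.
Proof. by rewrite /hp_dist ge_max => -> ->. Qed.

End hp.

(* The easy half of Strassen's theorem. *)
Lemma prokhorov_dist_coupling (M : pmetricType R) d (E : measurableType d)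
    (P : probability E R) (X Y : E -> M) (N : set E) (e : R) :
  0 < e -> measurable N -> (P N <= e%:E)%E ->
  (forall A, borel_set A -> measurable (X @^-1` A)) ->
  (forall A, borel_set A -> measurable (Y @^-1` A)) ->
  (forall t, ~ N t -> mdist (X t) (Y t) < e) ->
  (prokhorov_dist (fun A => P (X @^-1` A)) (fun A => P (Y @^-1` A)) <= e%:E)%E.
Proof.
move=> e0 mN PN mX mY XY.
have key (U V : E -> M) : (forall A, borel_set A -> measurable (U @^-1` A)) ->
    (forall A, borel_set A -> measurable (V @^-1` A)) ->
    (forall t, ~ N t -> mdist (U t) (V t) < e) ->
    forall A, borel_set A ->
    (P (U @^-1` A) <= P (V @^-1` (thickening A e)) + e%:E)%E.
  move=> mU mV UV A bA.
  have mVe : measurable (V @^-1` (thickening A e)).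
    by apply: mV; exact: borel_thickening.
  apply: (@le_trans _ _ (P (V @^-1` (thickening A e) `|` N))).
    apply: le_measure; rewrite ?inE//; [exact: mU|exact: measurableU|].
    move=> t At; have [Nt|Nt] := pselect (N t); first by right.
    by left; exists (U t) => //; exact: UV.
  apply: (le_trans (measureU2 _ _ _)) => //.
  by rewrite leeD2l.
apply: ereal_inf_lbound; exists e => //; split=> // A bA; split.
  exact: key.
by apply: key => // t Nt; rewrite metric_sym; exact: XY.
Qed.

End hausdorff_prokhorov.

(** * R-trees from Gromov products *)

Section metric_topology.
Context {R : realType}.
Implicit Types M N : metricType R.

Lemma nbhs_mdist M (x : M) (e : R) : 0 < e -> nbhs x [set y | mdist x y < e].
Proof. by move=> e0; apply/metricType_numDomainType.nbhs_mdistP; exists e. Qed.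

Lemma filter_cvg_mdist M (F : set_system M) (x : M) : Filter F ->
  (forall e : R, 0 < e -> F [set y | mdist x y < e]) -> F --> x.
Proof. by move=> FF h; apply/metricType_numDomainType.fcvgrPdist_lt. Qed.

Lemma within_continuous_mdist M (a b : R) (q : R -> M) t e :
  {within `[a, b], continuous q} -> t \in `[a, b] -> 0 < e ->
  exists2 d : R, 0 < d & forall t', t' \in `[a, b] -> `|t' - t| < d ->
    mdist (q t) (q t') < e.
Proof.
move=> /subspace_continuousP cq tab e0.
have := cq t tab [set y | mdist (q t) y < e] (nbhs_mdist _ e0).
rewrite nbhs_filterE /= nbhs_simpl /= => -[d d0 dq]; exists d => // t' t'ab t't.
apply: dq => //=.
by rewrite distrC.
Qed.

Lemma isometric_within_continuous M N (K : set M) (f : M -> N) :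
  isometric_on K f -> {within K, continuous f}.
Proof.
move=> fK; apply/subspace_continuousP => x Kx.
apply: filter_cvg_mdist => e e0.
apply: filterS (nbhs_mdist x e0) => y xy Ky /=.
by rewrite fK.
Qed.

Lemma isometric_compact M N (K : set M) (f : M -> N) :
  isometric_on K f -> compact K -> compact (f @` K).
Proof. by move=> /isometric_within_continuous; exact: continuous_compact. Qed.

Lemma compact_net M (K : set M) (e : R) : compact K -> 0 < e ->
  exists2 D : set M, finite_set D & D `<=` K /\ K `<=` thickening D e.
Proof.
move=> cK e0; apply: contrapT => nD.
(* Without a finite net, what finitely many balls leave uncovered in [K] generates a proper filter.
   The member that leaves out the ball around a cluster point [p] cannot meet that ball. *)
pose F := filter_from [set D : set M | finite_set D /\ D `<=` K]
  (fun D => K `\` thickening D e).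
have FF : ProperFilter F.
  apply: filter_from_proper; first apply: filter_from_filter.
  - by exists set0; split=> //; exact: finite_set0.
  - move=> D E [fD DK] [fE EK]; exists (D `|` E).
      by split; [rewrite finite_setU|rewrite subUset].
    move=> x [Kx nx]; split; split=> // hx; apply: nx.
      exact: thickening_sub (@subsetUl _ _ _) _ hx.
    exact: thickening_sub (@subsetUr _ _ _) _ hx.
  - move=> D [fD DK]; apply/set0P/eqP => D0; apply: nD; exists D => //.
    by split=> // x Kx; apply: contrapT => nx; have : set0 x by rewrite -D0.
have FK : F K by exists set0 => [|x []//]; split=> //; exact: finite_set0.
have [p [Kp Fp]] := cK F FF FK.
have Fp1 : F (K `\` thickening [set p] e).
  by exists [set p] => //; split=> [|_ ->//]; exact: finite_set1.
have [y [[_ ny] py]] := Fp _ _ Fp1 (nbhs_mdist p e0).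
by apply: ny; exists p.
Qed.

Lemma compact_separable M (K : set M) : compact K -> separable_set K.
Proof.
move=> cK.
have /choice[D hD] : forall n : nat, exists D : set M,
    [/\ finite_set D, D `<=` K & K `<=` thickening D n.+1%:R^-1].
  move=> n; have [|D fD [DK KD]] := compact_net cK (_ : 0 < n.+1%:R^-1 :> R).
    by rewrite invr_gt0.
  by exists D.
exists (\bigcup_n D n); split.
- by apply: bigcup_countable => // n _; apply: finite_set_countable; case: (hD n).
- by move=> x [n _]; case: (hD n) => _ + _ => /(_ x).
- move=> x Kx B /metricType_numDomainType.nbhs_mdistP[e /= e0 eB].
  have [n en] : exists n : nat, n.+1%:R^-1 < e.
    have /ltr_add_invr[n] : 0 < e by [].
    by rewrite add0r => ?; exists n.
  have [_ DK /(_ x Kx)[y Dy yx]] := hD n.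
  exists y; split; first by exists n.
  by apply: eB => /=; rewrite metric_sym (lt_trans yx).
Qed.

End metric_topology.

Section tree_criterion.
Context {R : realType} (M : metricType R).
Implicit Types (K : set M) (a b c o p x y : M).

(** In a tree, this is the distance from [o] to the point where the paths from [o] to [a] and to [b]
    separate. *)
Definition gromov o a b : R := (mdist o a + mdist o b - mdist a b) / 2.

Definition is_geodesic K (g : R -> M) (l : R) :=
  (forall s, s \in `[0, l] -> K (g s)) /\
  (forall s t, s \in `[0, l] -> t \in `[0, l] -> mdist (g s) (g t) = `|s - t|).

(** Geodesics start at the root only, and 0-hyperbolicity takes the root as its only base point:
    these are the two facts that l^1 coordinates give directly. The lemmas below move them to
    arbitrary points. *)
Definition rooted_tree_like K o :=
  [/\ K o,
     forall c, K c -> exists g, [/\ g 0 = o, g (mdist o c) = c &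
       is_geodesic K g (mdist o c)] &
     forall a b c, K a -> K b -> K c ->
       Num.min (gromov o a b) (gromov o b c) <= gromov o a c].

Lemma gromovC o a b : gromov o a b = gromov o b a.
Proof. by rewrite /gromov (metric_sym a b) (addrC (mdist o a)). Qed.

Lemma gromovxx o a : gromov o a a = mdist o a.
Proof. by rewrite /gromov mdistxx subr0; lra. Qed.

Lemma gromov_ge0 o a b : 0 <= gromov o a b.
Proof.
by rewrite /gromov; have := metric_triangle a o b; rewrite (metric_sym a o); lra.
Qed.

Lemma gromov_le o a b : gromov o a b <= mdist o a.
Proof. by rewrite /gromov; have := metric_triangle o a b; lra. Qed.

Variables (K : set M) (o : M).
Hypothesis Ko : rooted_tree_like K o.

(** Change of base point. By [E], the claim compares three sums of products at [o], namely ab + pc,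
    bc + pa and ac + pb: the last is at least the smaller of the other two. Four instances of the
    inequality at [o] settle this by cases. *)
Lemma gromov_ultra p a b c : K p -> K a -> K b -> K c ->
  Num.min (gromov p a b) (gromov p b c) <= gromov p a c.
Proof.
case: Ko => _ _ U Kp Ka Kb Kc.
have E x y : gromov p x y =
    mdist o p - gromov o p x - gromov o p y + gromov o x y.
  by rewrite /gromov (metric_sym p x); lra.
have := U a b c Ka Kb Kc; have := U a p c Ka Kp Kc.
have := U p a b Kp Ka Kb; have := U p c b Kp Kc Kb.
rewrite !E (gromovC _ a p) (gromovC _ c b).
rewrite !ge_min => /orP[] ? /orP[] ? /orP[] ? /orP[] ?; apply/orP;
  case: (lerP (gromov o a b + gromov o p c) (gromov o a c + gromov o p b)) => ?;
  by [left; lra|right; lra].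
Qed.

(** The geodesic runs from [x] down to height [m], where the root paths to [x] and [y] separate,
    then up to [y]. *)
Lemma geodesic_between x y : K x -> K y -> exists g, [/\ g 0 = x,
  g (mdist x y) = y & is_geodesic K g (mdist x y)].
Proof.
case: Ko => _ G U Kx Ky.
have [gx [gx0 gx1 [gxK gxi]]] := G x Kx.
have [gy [gy0 gy1 [gyK gyi]]] := G y Ky.
set m := gromov o x y.
have m0 : 0 <= m by exact: gromov_ge0.
have mx : m <= mdist o x by exact: gromov_le.
have my : m <= mdist o y by rewrite /m gromovC; exact: gromov_le.
have dxy : mdist x y = mdist o x - m + (mdist o y - m) by rewrite /m /gromov; lra.
have dgx s : s \in `[0, mdist o x] -> mdist o (gx s) = s.
  move=> sx; rewrite -{1}gx0 gxi// ?sub0r ?normrN ?ger0_norm//.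
    by move: sx; rewrite in_itv/= => /andP[].
  by rewrite in_itv/= lexx mdist_ge0.
have dgy s : s \in `[0, mdist o y] -> mdist o (gy s) = s.
  move=> sy; rewrite -{1}gy0 gyi// ?sub0r ?normrN ?ger0_norm//.
    by move: sy; rewrite in_itv/= => /andP[].
  by rewrite in_itv/= lexx mdist_ge0.
have gpx s : s \in `[0, mdist o x] -> gromov o (gx s) x = s.
  move=> sx; rewrite /gromov dgx// -{2}gx1 gxi//; last first.
    by rewrite in_itv/= lexx mdist_ge0.
  by move: sx; rewrite in_itv/= => /andP[? ?]; rewrite ler0_norm; lra.
have gpy s : s \in `[0, mdist o y] -> gromov o (gy s) y = s.
  move=> sy; rewrite /gromov dgy// -{2}gy1 gyi//; last first.
    by rewrite in_itv/= lexx mdist_ge0.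
  by move: sy; rewrite in_itv/= => /andP[? ?]; rewrite ler0_norm; lra.
(* From height [m] on, a point on each root path has product exactly [m] with the other, so
   distances add up through the branch point. *)
have cross s t : m <= s <= mdist o x -> m <= t <= mdist o y ->
    mdist (gx s) (gy t) = s + t - 2 * m.
  move=> /andP[ms sx] /andP[mt ty].
  have sI : s \in `[0, mdist o x] by rewrite in_itv/= sx (le_trans m0).
  have tI : t \in `[0, mdist o y] by rewrite in_itv/= ty (le_trans m0).
  have Ks := gxK _ sI; have Kt := gyK _ tI.
  suff : gromov o (gx s) (gy t) = m by rewrite {1}/gromov dgx// dgy//; lra.
  apply/eqP; rewrite eq_le; apply/andP; split; last first.
    have h1 := U (gx s) x y Ks Kx Ky; rewrite gpx// -/m in h1.
    have := U (gx s) y (gy t) Ks Ky Kt; rewrite (gromovC _ y) gpy//.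
    by move: h1; rewrite !ge_min => /orP[?|?] /orP[?|?]; lra.
  (* Otherwise the consecutive products along [x], [gx s], [gy t], [y] all exceed [m], and so does
     the product of [x] and [y], which is [m]. *)
  rewrite leNgt; apply/negP => mst.
  have stm : gromov o (gx s) (gy t) <= s.
    by rewrite -[leRHS]dgx// gromov_le.
  have ttm : gromov o (gx s) (gy t) <= t.
    by rewrite -[leRHS]dgy// gromovC gromov_le.
  have h1 := U x (gx s) (gy t) Kx Ks Kt; rewrite (gromovC _ x) gpx// in h1.
  have := U x (gy t) y Kx Kt Ky; rewrite gpy// -/m.
  suff : forall z : R, Num.min z t <= m -> Num.min s (gromov o (gx s) (gy t)) <= z -> m < m.
    by move=> h h2; move: (h _ h2 h1); rewrite ltxx.
  move=> {h1} z h2 h1.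
  by move: h2 h1; rewrite !ge_min => /orP[?|?] /orP[?|?]; lra.
exists (fun s => if s <= mdist o x - m then gx (mdist o x - s)
                 else gy (s - (mdist o x - m) + m)); split.
- by rewrite subr_ge0 mx subr0 gx1.
- case: ifPn => [h|_].
    have ym : mdist o y = m by lra.
    have gym : gy m = y by move: gy1; rewrite ym.
    rewrite (_ : mdist o x - _ = m); last by lra.
    apply: mdist_positivity; rewrite -gym cross ?lexx ?mx ?my//; lra.
  by rewrite (_ : _ + m = mdist o y) ?gy1//; lra.
- split=> [s|s t].
    rewrite in_itv/= => /andP[s0 s1]; have [h|h] := leP s (mdist o x - m).
      by apply: gxK; rewrite in_itv/=; apply/andP; split; lra.
    by apply: gyK; rewrite in_itv/=; apply/andP; split; lra.
  rewrite !in_itv/= => /andP[s0 s1] /andP[t0 t1].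
  have [sx|sx] := leP s (mdist o x - m); have [tx|tx] := leP t (mdist o x - m).
  + rewrite gxi ?in_itv/=; [|lra|lra].
    by rewrite -normrN; congr `|_|; lra.
  + rewrite cross; [|lra|lra].
    by rewrite ler0_norm; lra.
  + rewrite metric_sym cross; [|lra|lra].
    by rewrite ger0_norm; lra.
  + rewrite gyi ?in_itv/=; [|lra|lra].
    by congr `|_|; lra.
Qed.

(** Removing [m] disconnects its sides. On points other than [m], a positive product at [m] is an
    equivalence relation, by [gromov_ultra], with open classes. A path that avoids [m] stays in one
    class, whereas its end points have product 0. *)
Lemma path_separation (q : R -> M) (s0 s1 : R) (m : M) : s0 <= s1 ->
  (forall t e, t \in `[s0, s1] -> 0 < e -> exists2 d : R, 0 < d &
     forall t', t' \in `[s0, s1] -> `|t' - t| < d -> mdist (q t) (q t') < e) ->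
  (forall t, t \in `[s0, s1] -> K (q t)) -> K m ->
  gromov m (q s0) (q s1) = 0 ->
  exists2 s, s \in `[s0, s1] & q s = m.
Proof.
move=> s01 cq qK Km g0; apply: contrapT => nm.
have qm t : t \in `[s0, s1] -> 0 < mdist m (q t).
  move=> ts; rewrite mdist_gt0; apply/eqP => e; apply: nm; exists t => //.
(* Times at which the path is still in the class of its start. The supremum [u] belongs to [A]; it
   is not [s1], because of [g0], and then a later time [v] belongs to [A] too. *)
pose A := [set t | t \in `[s0, s1] /\ 0 < gromov m (q s0) (q t)].
have s0I : s0 \in `[s0, s1] by rewrite in_itv/= lexx.
have s1I : s1 \in `[s0, s1] by rewrite in_itv/= lexx s01.
have As0 : A s0 by split=> //; rewrite gromovxx qm.
have supA : has_sup A.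
  split; first by exists s0.
  by exists s1 => t []; rewrite in_itv/= => /andP[].
set u := sup A.
have uI : u \in `[s0, s1].
  rewrite in_itv/=; apply/andP; split; first exact: (ub_le_sup supA.2).
  apply: ge_sup; first by exists s0.
  by move=> t []; rewrite in_itv/= => /andP[].
have Kq0 := qK _ s0I; have Ku := qK _ uI.
have [d d0 hd] := cq u (mdist m (q u)) uI (qm _ uI).
have near_u t : t \in `[s0, s1] -> `|t - u| < d -> 0 < gromov m (q u) (q t).
  move=> tI /(hd _ tI) h.
  rewrite /gromov; have := qm t tI; have := mdist_ge0 m (q t); lra.
have [t [tI At] ut] : exists2 t, A t & u - d < t by exact: sup_adherent.
have tu : t <= u by apply: (ub_le_sup supA.2).
have Au : 0 < gromov m (q s0) (q u).
  have gtu : 0 < gromov m (q t) (q u).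
    by rewrite gromovC near_u// ler0_norm ?subr_le0//; lra.
  apply: (lt_le_trans _ (gromov_ultra Km Kq0 (qK _ tI) Ku)).
  by rewrite lt_min At.
have us1 : u < s1.
  rewrite lt_neqAle; move: (uI); rewrite in_itv/= => /andP[_ ->]; rewrite andbT.
  by apply/eqP => e; move: Au; rewrite e g0 ltxx.
pose v := Num.min s1 (u + d / 2).
have vu : u < v by rewrite lt_min us1/=; lra.
have vI : v \in `[s0, s1].
  rewrite in_itv/= ge_min lexx/= andbT (le_trans _ (ltW vu))//.
  by move: uI; rewrite in_itv/= => /andP[].
suff : v <= u by lra.
apply: (ub_le_sup supA.2); split=> //.
have guv : 0 < gromov m (q u) (q v).
  apply: near_u => //; rewrite gtr0_norm ?subr_gt0//.
  have : v <= u + d / 2 by rewrite ge_min lexx orbT.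
  lra.
apply: (lt_le_trans _ (gromov_ultra Km Kq0 Ku (qK _ vI))).
by rewrite lt_min Au.
Qed.

(** An injective path covers the geodesic because each geodesic point separates the end points.
    Conversely, the projection [g r] of a path point [q s] separates it from both ends, so it is
    visited both before and after time [s], and injectivity forces [q s = g r]. *)
Lemma rooted_tree_like_rtree : separable_set K -> is_rtree K.
Proof.
move=> sK; split=> // x y Kx Ky.
have [g [g0 g1 [gK gi]]] := geodesic_between Kx Ky.
have D0 : 0 <= mdist x y := mdist_ge0 _ _.
have I0 : 0 \in `[0, mdist x y] by rewrite in_itv/= lexx.
have I1 : mdist x y \in `[0, mdist x y] by rewrite in_itv/= lexx D0.
exists g; split=> //; first by move=> _ [s /= /gK Ks <-].
move=> q cq qinj qK q0 q1.
have Kq t : t \in `[0, 1] -> K (q t) by move=> tI; apply: qK; exists t.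
have gx r : r \in `[0, mdist x y] -> mdist x (g r) = r.
  move=> rI; rewrite -{1}g0 gi// sub0r normrN ger0_norm//.
  by move: rI; rewrite in_itv/= => /andP[].
have gy r : r \in `[0, mdist x y] -> mdist (g r) y = mdist x y - r.
  move=> rI; rewrite -[in mdist (g r) _]g1 gi// distrC ger0_norm//.
  by move: rI; rewrite in_itv/= subr_ge0 => /andP[].
have sep (a b : R) (m : M) : 0 <= a -> a <= b -> b <= 1 -> K m ->
    gromov m (q a) (q b) = 0 -> exists2 s, s \in `[a, b] & q s = m.
  move=> a0 ab b1 Km gm.
  have sub t : t \in `[a, b] -> t \in `[0, 1].
    by rewrite !in_itv/= => /andP[? ?]; apply/andP; split; lra.
  apply: path_separation => // [t e tI e0|t /sub /Kq //].
  have [d d0 hd] := within_continuous_mdist cq (sub _ tI) e0.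
  by exists d => // t' /sub t'I; exact: hd.
apply/seteqP; split=> [_ [s /= sI <-]|_ [r /= rI <-]]; last first.
  have [] := sep 0 1 (g r) => //; first exact: gK.
    by rewrite q0 q1 /gromov (metric_sym _ x) gx// gy//; lra.
  by move=> s sI <-; exists s.
have Kc := Kq s sI.
pose r := gromov x (q s) y.
have hr : 2 * r = mdist x (q s) + mdist x y - mdist (q s) y by rewrite /r /gromov; lra.
have rI : r \in `[0, mdist x y].
  by rewrite in_itv/= gromov_ge0 /r gromovC gromov_le.
have dcm : mdist (q s) (g r) <= mdist x (q s) - r.
  have := gromov_ultra Kx Kc Ky (gK _ rI).
  rewrite -/r (_ : gromov x y (g r) = r); last first.
    by rewrite /gromov gx// (metric_sym y) gy//; lra.
  by rewrite minxx /gromov gx//; lra.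
move: (sI); rewrite in_itv/= => /andP[sge0 sle1].
have [|s1 s1I e1] := sep 0 s (g r) (lexx _) sge0 sle1 (gK _ rI).
  apply/eqP; rewrite eq_le gromov_ge0 andbT q0 /gromov (metric_sym _ x) gx//.
  by rewrite (metric_sym (g r)); lra.
have [|s2 s2I e2] := sep s 1 (g r) sge0 sle1 (lexx _) (gK _ rI).
  apply/eqP; rewrite eq_le gromov_ge0 andbT q1 /gromov gy// (metric_sym (g r)).
  lra.
have s12 : s1 = s2.
  move: s1I s2I; rewrite !in_itv/= => /andP[? ?] /andP[? ?].
  by apply: qinj; rewrite ?in_itv/= ?e1//; apply/andP; split; lra.
have -> : s = s1.
  by move: s1I s2I; rewrite -s12 !in_itv/= => /andP[? ?] /andP[? ?]; lra.
by exists r.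
Qed.

End tree_criterion.

(** * Uniqueness of Gromov-Hausdorff limits *)

Section ultra_fmap.

Lemma ultra_fmap T U (f : T -> U) (F : set_system T) :
  UltraFilter F -> UltraFilter (f @ F).
Proof.
move=> FU; split; first exact: fmap_proper_filter.
move=> G PG FG; apply/seteqP; split=> // A GA.
have [//|FnA] := in_ultra_setVsetC (f @^-1` A) FU.
have /FG GnA : (f @ F) (~` A) by [].
by have [x []] := filter_ex (filterI GA GnA).
Qed.

End ultra_fmap.

Section gh_uniqueness.
Context {R : realType}.
Implicit Types S T U : pmetricType R.

Lemma dist_distance_le (M : metricType R) (x y x' y' : M) :
  `|mdist x y - mdist x' y'| <= mdist x x' + mdist y y'.
Proof.
rewrite ler_norml; apply/andP; split.
  have := metric_triangle x' x y'; have := metric_triangle x y y'.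
  by rewrite (metric_sym x' x); lra.
have := metric_triangle x x' y; have := metric_triangle x' y' y.
by rewrite (metric_sym y' y); lra.
Qed.

(* Such maps exist, in both directions, between spaces at Gromov-Hausdorff
   distance less than [e / 2]. *)
Definition almost_inverse S U (e : R) (a : S -> U) (b : U -> S) :=
  [/\ forall x y, `|mdist (a x) (a y) - mdist x y| <= e,
      forall x, mdist (b (a x)) x <= e & mdist (a point) point <= e].

Lemma gh_dist_almost_inverse U S (e : R) : 0 < e ->
  (gh_dist U S < (e / 2)%:E)%E -> exists (a : S -> U) (b : U -> S),
    almost_inverse e a b /\ almost_inverse e b a.
Proof.
move=> e0 /ereal_inf_lt[_ [Z [i [j [iI jI ->]]]]].
rewrite gt_max lte_fin => /andP[ij0 /inf_EFin_lt[h [h0 ij ji] he]].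
have /choice[a ha] : forall x, exists u, mdist (i u) (j x) < h.
  by move=> x; have [|_ [u _ <-] ux] := ji (j x); [exists x|exists u].
have /choice[b hb] : forall u, exists x, mdist (j x) (i u) < h.
  by move=> u; have [|_ [x _ <-] ux] := ij (i u); [exists u|exists x].
exists a, b; split; split.
- move=> x y; rewrite -iI// -(jI x y)//.
  apply: (le_trans (dist_distance_le _ _ _ _)).
  by have := ha x; have := ha y; lra.
- move=> x; rewrite -jI//; have := metric_triangle (j (b (a x))) (i (a x)) (j x).
  by have := ha x; have := hb (a x); lra.
- rewrite -iI//; have := metric_triangle (i (a point)) (j point) (i point).
  by rewrite (metric_sym (j point) (i point)); have := ha point; lra.
- move=> x y; rewrite -jI// -(iI x y)//.
  apply: (le_trans (dist_distance_le _ _ _ _)).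
  by have := hb x; have := hb y; lra.
- move=> x; rewrite -iI//; have := metric_triangle (i (a (b x))) (j (b x)) (i x).
  by have := hb x; have := ha (b x); lra.
- rewrite -jI//; have := metric_triangle (j (b point)) (i point) (j point).
  by have := hb point; lra.
Qed.

Definition almost_isometry S T (e : R) (f : S -> T) :=
  [/\ forall x y, `|mdist (f x) (f y) - mdist x y| <= e,
      mdist (f point) point <= e & forall y, exists x, mdist (f x) y <= e].

Lemma almost_isometry_comp S U T (e : R) (a : S -> U) b (a' : T -> U) b' :
  almost_inverse e a b -> almost_inverse e b a ->
  almost_inverse e a' b' -> almost_inverse e b' a' ->
  almost_isometry (3 * e) (b' \o a).
Proof.
move=> [a1 a2 a3] [b1 b2 b3] [c1 c2 c3] [d1 d2 d3].
have e0 : 0 <= e by apply: le_trans a3; exact: mdist_ge0.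
have L x y : mdist (b' x) (b' y) <= mdist x y + e.
  by have := d1 x y; rewrite ler_norml => /andP[]; lra.
split=> [x y||y] /=.
- have := a1 x y; have := d1 (a x) (a y); rewrite !ler_norml.
  by move=> /andP[? ?] /andP[? ?]; apply/andP; split; lra.
- have := L (a point) point; have := metric_triangle (b' (a point)) (b' point) point.
  lra.
- exists (b (a' y)); have := L (a (b (a' y))) (a' y).
  have := metric_triangle (b' (a (b (a' y)))) (b' (a' y)) y.
  by have := b2 (a' y); have := c2 y; lra.
Qed.

(** The isometry is a pointwise limit along an ultrafilter finer than [\oo]: compactness makes every
    sequence converge along it, which replaces a diagonal extraction. The same ultrafilter yields
    preimages, as limits of approximate preimages. *)
Lemma almost_isometries_rooted_isometric S T :
  compact [set: S] -> compact [set: T] ->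
  (forall e : R, 0 < e -> exists f : S -> T, almost_isometry e f) ->
  rooted_isometric S T.
Proof.
move=> cS cT approx.
have /choice[f hf] : forall n : nat, exists f : S -> T,
    almost_isometry n.+1%:R^-1 f.
  by move=> n; apply: approx; rewrite invr_gt0.
have [G [GU ooG]] := ultraFilterLemma (eventually_filter : ProperFilter \oo).
have lim_ex (M : pmetricType R) (u : nat -> M) : compact [set: M] ->
    exists p : M, u @ G --> p.
  move=> cM; have : UltraFilter (u @ G) by exact: ultra_fmap.
  rewrite compact_ultra in cM => UG.
  by have [|p [_ up]] := cM _ UG; [exact: filterT|exists p].
have /choice[g hg] : forall x : S, exists p : T, (fun n => f n x) @ G --> p.
  by move=> x; exact: lim_ex.
have near_g x e : 0 < e -> G [set n | mdist (g x) (f n x) < e].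
  by move=> e0; apply: hg (nbhs_mdist (g x) e0).
have small (e : R) : 0 < e -> G [set n : nat | n.+1%:R^-1 < e].
  move=> e0; apply: ooG.
  exact: near_infty_natSinv_lt (PosNum e0).
have giso : isometric_on setT g.
  move=> x y _ _; apply/eqP; rewrite -subr_eq0 -normr_le0.
  apply/ler_addgt0Pr => e e0; rewrite add0r.
  have e3 : 0 < e / 3 by lra.
  have [n [/= [n1 n2] n3]] :=
    filter_ex (filterI (filterI (near_g x _ e3) (near_g y _ e3)) (small _ e3)).
  have [/(_ x y) h _ _] := hf n.
  move: (n.+1%:R^-1) h n3 => k h n3.
  have := dist_distance_le (g x) (g y) (f n x) (f n y).
  by move: h; rewrite !ler_norml => /andP[? ?] /andP[? ?]; apply/andP; split; lra.
exists g; split=> //.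
  apply: mdist_positivity; apply/eqP; rewrite eq_le mdist_ge0 andbT.
  apply/ler_addgt0Pr => e e0; rewrite add0r.
  have e2 : 0 < e / 2 by lra.
  have [n [/= n1 n3]] := filter_ex (filterI (near_g point _ e2) (small _ e2)).
  have [_ h _] := hf n.
  move: (n.+1%:R^-1) h n3 => k h n3.
  by have := metric_triangle (g point) (f n point) point; lra.
apply/seteqP; split=> // y _.
have /choice[u hu] : forall n, exists x, mdist (f n x) y <= n.+1%:R^-1.
  by move=> n; have [_ _] := hf n; exact.
have [x ux] := lim_ex S u cS.
exists x => //; apply: mdist_positivity; apply/eqP; rewrite eq_le mdist_ge0 andbT.
apply/ler_addgt0Pr => e e0; rewrite add0r.
have e4 : 0 < e / 4 by lra.
have Gu : G [set n | mdist x (u n) < e / 4] by apply: ux (nbhs_mdist x e4).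
have [n [/= [n1 n2] n3]] :=
  filter_ex (filterI (filterI (near_g x _ e4) Gu) (small _ e4)).
have [/(_ x (u n)) h _ _] := hf n.
have := hu n; move: (n.+1%:R^-1) h n3 => k h n3.
have := metric_triangle (g x) (f n x) y.
have := metric_triangle (f n x) (f n (u n)) y.
by move: h; rewrite ler_norml => /andP[? ?]; lra.
Qed.

Lemma gh_dist_ge0 S T : (0 <= gh_dist S T)%E.
Proof.
apply: le_ereal_inf_tmp => _ [Z [f [g [_ _ ->]]]].
by rewrite le_max lee_fin mdist_ge0.
Qed.

Lemma gh_limit_unique (u : nat -> pmetricType R) S T :
  compact [set: S] -> compact [set: T] ->
  gh_dist (u n) S @[n --> \oo] --> 0%E -> gh_dist (u n) T @[n --> \oo] --> 0%E ->
  rooted_isometric S T.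
Proof.
move=> cS cT uS uT; apply: almost_isometries_rooted_isometric => // e e0.
(* The half is lost in [gh_dist_almost_inverse], the third in [almost_isometry_comp]. *)
have e6 : 0 < e / 3 / 2 by lra.
have uS0 : forall n, (0 <= gh_dist (u n) S)%E by move=> n; exact: gh_dist_ge0.
have uT0 : forall n, (0 <= gh_dist (u n) T)%E by move=> n; exact: gh_dist_ge0.
have hS := (ereal_cvg0P uS0).1 uS _ e6; have hT := (ereal_cvg0P uT0).1 uT _ e6.
have [n [nS nT]] := filter_ex (filterI hS hT).
have e3 : 0 < e / 3 by lra.
have [a [b [ab ba]]] := gh_dist_almost_inverse e3 nS.
have [a' [b' [ab' ba']]] := gh_dist_almost_inverse e3 nT.
exists (b' \o a); rewrite (_ : e = 3 * (e / 3)); last by lra.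
exact: almost_isometry_comp ab ba ab' ba'.
Qed.

End gh_uniqueness.

Section subtree_space.
Context {R : realType} (M : pmetricType R) (K : set M) (Kpoint : K point).

(* [Kpoint] is a parameter of the type, so that the root can be canonical. *)
Definition subtree of K point : Type := {x : M | K x}.
Local Notation sub := (subtree Kpoint).

HB.instance Definition _ := gen_eqMixin sub.
HB.instance Definition _ := gen_choiceMixin sub.

Definition subtree_dist (x y : sub) : R := mdist (sval x) (sval y).

Let sxx x : subtree_dist x x = 0. Proof. exact: mdistxx. Qed.
Let s0 x y : subtree_dist x y = 0 -> x = y.
Proof.
by move/mdist_positivity; case: x y => [x Kx] [y Ky] /= e; exact: eq_exist.
Qed.
Let ssym x y : subtree_dist x y = subtree_dist y x. Proof. exact: metric_sym. Qed.
Let stri y x z : subtree_dist x z <= subtree_dist x y + subtree_dist y z.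
Proof. exact: metric_triangle. Qed.

HB.instance Definition _ := isMetric.Build R sub sxx s0 ssym stri.
HB.instance Definition _ := isPointed.Build sub (exist _ point Kpoint).

Definition subtree_val (x : sub) : M := sval x.

Lemma subtree_val_isometric : isometric_on setT subtree_val.
Proof. by []. Qed.

Lemma range_subtree_val : range subtree_val = K.
Proof.
apply/seteqP; split=> [_ [x _ <-]|x Kx]; first exact: (svalP x).
by exists (exist _ x Kx).
Qed.

End subtree_space.

Section isometries.
Context {R : realType}.

(* junk value [point] off the range of [f] *)
Definition isometry_inv (S : pmetricType R) (M : Type) (f : S -> M) (y : M) : S :=
  if pselect (exists x, f x = y) is left h then projT1 (cid h) else point.

Section inverse.
Context (S : pmetricType R) (M : metricType R) (f : S -> M).
Hypothesis fI : isometric_on setT f.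

Lemma isometric_inj : injective f.
Proof.
by move=> x y e; apply: mdist_positivity; rewrite -fI// e mdistxx.
Qed.

Lemma isometry_invK : cancel f (isometry_inv f).
Proof.
move=> x; rewrite /isometry_inv; case: pselect => [h|[]]; last by exists x.
by case: cid => y /= /isometric_inj.
Qed.

Lemma isometry_inv_isometric : isometric_on (range f) (isometry_inv f).
Proof. by move=> _ _ [x _ <-] [y _ <-]; rewrite !isometry_invK fI. Qed.

Lemma isometry_inv_image : isometry_inv f @` range f = setT.
Proof.
apply/seteqP; split=> // x _; exists (f x); first by exists x.
exact: isometry_invK.
Qed.

Lemma isometry_compact_domain : compact (range f) -> compact [set: S].
Proof.
by move=> /(isometric_compact isometry_inv_isometric); rewrite isometry_inv_image.
Qed.

End inverse.

Lemma rooted_tree_like_isometry (M N : metricType R) (K : set M) (f : M -> N) o :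
  isometric_on K f -> rooted_tree_like K o -> rooted_tree_like (f @` K) (f o).
Proof.
move=> fI [Ko G U]; split; first by exists o.
  move=> _ [c Kc <-]; have [g [g0 g1 [gK gi]]] := G c Kc.
  exists (f \o g); rewrite /= g0 fI// g1; split=> //; split.
    by move=> s sI /=; exists (g s) => //; exact: gK.
  by move=> s t sI tI /=; rewrite fI ?gi//; exact: gK.
move=> _ _ _ [a Ka <-] [b Kb <-] [c Kc <-].
by rewrite /gromov !fI//; exact: U.
Qed.

Lemma rooted_isometric_common_image (S T M : pmetricType R) (f : S -> M) (g : T -> M) :
  isometric_on setT f -> isometric_on setT g ->
  f point = point -> g point = point -> range f = range g ->
  rooted_isometric S T.
Proof.
move=> fI gI f0 g0 fg; exists (isometry_inv g \o f); split.
- move=> x y _ _ /=; rewrite isometry_inv_isometric ?fI// -fg; by [exists x|exists y].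
- by rewrite /= f0 -g0 isometry_invK.
- by rewrite -(image_comp f (isometry_inv g)) fg isometry_inv_image.
Qed.

End isometries.

(** * Sums over words *)

Section words.

Lemma branching_words (u v : seq nat) : [\/ prefix u v, prefix v u |
  exists p j k u' v', [/\ j <> k, u = p ++ j :: u' & v = p ++ k :: v']].
Proof.
elim: u v => [|a u IH] [|b v]; [by constructor 1|by constructor 1|by constructor 2|].
rewrite !prefix_cons; have [->|ab] := eqVneq b a; last first.
  by constructor 3; exists [::], a, b, u, v; split=> //; apply/eqP; rewrite eq_sym.
have [uv|vu|[p [j [k [u' [v' [jk -> ->]]]]]]] := IH v.
- by constructor 1.
- by constructor 2.
- by constructor 3; exists (a :: p), j, k, u', v'.
Qed.

Lemma seq_argmax (T : eqType) (m : T -> nat) (s : seq T) : s != [::] ->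
  exists2 v, v \in s & forall u, u \in s -> (m u <= m v)%N.
Proof.
elim: s => // a s IH _; have [->|/IH[v vs vm]] := eqVneq s [::].
  by exists a; rewrite ?mem_head// => u; rewrite inE => /eqP ->.
have [av|va] := leqP (m a) (m v).
  by exists v; rewrite ?inE ?vs ?orbT// => u; rewrite inE => /orP[/eqP -> //|/vm].
exists a; rewrite ?mem_head// => u; rewrite inE => /orP[/eqP -> //|/vm h].
exact: leq_trans h (ltnW va).
Qed.

End words.

Section esum_words.
Context {R : realType}.
Implicit Types (c G : seq nat -> R).

Lemma le_esum_set (T : choiceType) (A B : set T) (a : T -> \bar R) :
  (forall t, (0 <= a t)%E) -> A `<=` B ->
  (\esum_(t in A) a t <= \esum_(t in B) a t)%E.
Proof.
move=> a0 AB; rewrite (esumID A B)// (_ : B `&` A = A); last first.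
  by apply/seteqP; split=> [t []//|t At]; split=> //; exact: AB.
by rewrite leeDl// esum_ge0.
Qed.

Lemma esum_notin_cons (T : choiceType) (w : T) (W : seq T) (a : T -> \bar R) :
  (forall t, (0 <= a t)%E) ->
  (\esum_(t in [set t | t \notin W]) a t <=
   a w + \esum_(t in [set t | t \notin w :: W]) a t)%E.
Proof.
move=> a0; rewrite (esumID [set w])//; apply: leeD.
  by rewrite -[leRHS](esum_set1 (t := w))//; apply: le_esum_set => // t [].
apply: le_esum_set => // t [/= tW /eqP tw].
by rewrite inE negb_or tw.
Qed.

Lemma esum_split_seq (T : choiceType) (W : seq T) (a : T -> R) :
  (forall t, 0 <= a t) ->
  (\esum_(t in setT) (a t)%:E <=
   (\sum_(t <- W) a t)%:E + \esum_(t in [set t | t \notin W]) (a t)%:E)%E.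
Proof.
move=> a0; elim: W => [|w W IH].
  by rewrite big_nil add0e; apply: le_esum_set.
apply: (le_trans IH); rewrite big_cons EFinD -addeA addeCA leeD2l//.
exact: esum_notin_cons.
Qed.

(** The support of [G] is a chain for the prefix order, so a finite part of it consists of prefixes
    of its longest word. Finite sums are therefore dominated by sums along the prefixes of a single
    word. *)
Lemma chain_esum_le c G (B : R) : 0 <= B ->
  (forall u v, 0 < c u -> 0 < c v -> prefix u v || prefix v u) ->
  (forall u, 0 <= G u) -> (forall u, 0 < G u -> 0 < c u) ->
  (forall v, 0 < c v -> \sum_(i < (size v).+1) G (take i v) <= B) ->
  (\esum_(u in setT) (G u)%:E <= B%:E)%E.
Proof.
move=> B0 cc G0 Gc hB.
pose S := [set u | 0 < G u].
rewrite (esumID S)// => [|u _]; last by rewrite lee_fin.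
rewrite [X in (_ + X)%E]esum1 ?adde0 => [|u [_ /negP]]; last first.
  by rewrite -leNgt => Gu; congr EFin; apply/eqP; rewrite eq_le Gu G0.
rewrite setTI; apply: ge_ereal_sup => _ [X [fX XS] <-].
have [->|/set0P[w Xw]] := eqVneq X set0; first by rewrite fsbig_set0 lee_fin.
have [] := @seq_argmax _ size (finmap.enum_fset (fset_set X)).
  apply/eqP => e; have : w \in finmap.enum_fset (fset_set X).
    by have := in_fset_set fX w; rewrite mem_set.
  by rewrite e.
move=> v vX vm.
have Xv : X v by have := in_fset_set fX v; rewrite vX => /esym/set_mem.
pose s := [seq take i v | i <- iota 0 (size v).+1].
have us : uniq s.
  rewrite map_inj_in_uniq ?iota_uniq// => i j; rewrite !mem_iota !add0n !ltnS.
  by move=> /andP[_ iv] /andP[_ jv] /(congr1 size); rewrite !size_takel.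
apply: (@le_trans _ _ (\sum_(u \in [set` s]) (G u)%:E)%E).
  apply: lee_fsum_nneg_subset => //; first exact: finite_seq.
    2: by move=> u _; rewrite lee_fin.
  move=> u; rewrite !inE => Xu.
  have uX : u \in finmap.enum_fset (fset_set X).
    by have := in_fset_set fX u; rewrite mem_set.
  have uv : prefix u v.
    have /orP[//|vu] := cc u v (Gc _ (XS _ Xu)) (Gc _ (XS _ Xv)).
    have e : size v = size u.
      by apply/eqP; rewrite eqn_leq (size_prefix vu) vm.
    by move: vu; rewrite prefixE e take_size => /eqP ->; exact: prefix_refl.
  apply/mapP; exists (size u); last by move: uv; rewrite prefixE => /eqP.
  by rewrite mem_iota add0n ltnS size_prefix.
rewrite -fsbig_seq//= /s big_map -[X in iota X _]/(0%N).
rewrite -[iota _ _]/(index_iota 0 (size v).+1) big_mkord sumEFin lee_fin hB//.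
exact/Gc/XS.
Qed.

End esum_words.

(** * Gromov products in l^1 *)

Section l1_metric.
Context {R : realType}.
Implicit Types f g : l1U R.

Lemma l1_ge0 f u : 0 <= f u. Proof. by case: (l1P f) => + _; exact. Qed.

Lemma l1_ext f g : (forall u, f u = g u) -> f = g.
Proof.
move=> fg; case: f g fg => [f hf] [g hg] /= fg.
have e : f = g by exact/funext.
by subst g; rewrite (Prop_irrelevance hf hg).
Qed.

Lemma l1_sum_fin f : (\esum_(u in setT) (f u)%:E)%E \is a fin_num.
Proof.
rewrite ge0_fin_numE; first by case: (l1P f).
by apply: esum_ge0 => u _; rewrite lee_fin l1_ge0.
Qed.

Lemma l1_mdistE f g : (mdist f g)%:E = (\esum_(u in setT) `|f u - g u|%:E)%E.
Proof.
rewrite -[mdist f g]/(fine (\esum_(u in setT) `|f u - g u|%:E)%E) fineK//.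
rewrite ge0_fin_numE; last by apply: esum_ge0 => u _; rewrite lee_fin.
have [[f0 ff] [g0 gf]] := (l1P f, l1P g).
apply: (@le_lt_trans _ _ (\esum_(u in setT) ((f u)%:E + (g u)%:E))%E).
  apply: le_esum => u _; rewrite -EFinD lee_fin.
  by rewrite (le_trans (ler_normB _ _))// !ger0_norm.
by rewrite esumD ?lte_add_pinfty// => u _; rewrite lee_fin.
Qed.

Lemma l1_mdist_point f : (mdist point f)%:E = (\esum_(u in setT) (f u)%:E)%E.
Proof.
rewrite l1_mdistE; apply: eq_esum => u _.
by rewrite sub0r normrN ger0_norm// l1_ge0.
Qed.

(** Nonnegative numbers satisfy |a - b| = a + b - 2 min(a, b). The four-point condition at the root
    thus becomes a comparison of coordinatewise minima. *)
Lemma l1_gromovE f g :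
  (gromov point f g)%:E = (\esum_(u in setT) (Num.min (f u) (g u))%:E)%E.
Proof.
have m0 u : 0 <= Num.min (f u) (g u) by rewrite le_min !l1_ge0.
have E : ((mdist point f)%:E + (mdist point g)%:E = (mdist f g)%:E +
    (\esum_(u in setT) (Num.min (f u) (g u))%:E +
     \esum_(u in setT) (Num.min (f u) (g u))%:E))%E.
  rewrite !l1_mdist_point l1_mdistE -!esumD;
    try by move=> u _; rewrite ?adde_ge0 ?lee_fin ?l1_ge0 ?m0.
  apply: eq_esum => u _; rewrite -!EFinD; congr EFin.
  by case: (leP (f u) (g u)) => h; [rewrite ler0_norm|rewrite gtr0_norm]; lra.
have fm : (\esum_(u in setT) (Num.min (f u) (g u))%:E)%E \is a fin_num.
  rewrite ge0_fin_numE ?esum_ge0// => [|u _]; last by rewrite lee_fin.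
  case: (l1P f) => _; apply: le_lt_trans; apply: le_esum => u _.
  by rewrite lee_fin ge_min lexx.
rewrite -(fineK fm); congr EFin; move: E; rewrite -(fineK fm) -!EFinD => -[].
by rewrite /gromov; lra.
Qed.

End l1_metric.

(** * The limit tree *)

Section tree_functions.
Context {R : realType} (beta : R) (x : seq nat -> beads R).
Implicit Types (u v w : seq nat) (f g c : seq nat -> R).

Definition subfamily (u : seq nat) : seq nat -> beads R := fun v => x (u ++ v).

Definition branch_pos u j : R := checkP x u `^ beta * loc (x u) j.

Definition seg_len u : R := checkP x u `^ beta * len (x u).

(* Coordinates of the points of the closure of the union of the [emb_tree n] *)
Definition tree_fun f :=
  (forall u, 0 <= f u <= seg_len u) /\
  (forall u j v, 0 < f (u ++ j :: v) -> f u = branch_pos u j).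

(** [D] is the set of depths in use: the integers up to [n] give the truncated tree, [setT] the
    limit, and removing a first letter shifts [D] by one. Compactness, geodesics and grafting are
    thus treated once for all stages. *)
Definition limit_tree (D : set nat) : set (l1U R) :=
  [set f : l1U R | tree_fun f /\ forall u, ~ D (size u) -> f u = 0].

Definition tight_tree := forall e : R, 0 < e -> exists W : seq (seq nat),
  forall f, tree_fun f ->
  (\esum_(u in [set u | u \notin W]) (f u)%:E <= e%:E)%E.

Lemma checkP_cat u v : checkP x (u ++ v) = checkP x u * checkP (subfamily u) v.
Proof.
elim/last_ind: v => [|v j IH]; first by rewrite cats0 checkP_nil mulr1.
by rewrite -rcons_cat !checkP_rcons IH mulrA.
Qed.

Lemma powR_checkP_gt0 u v : checkP x (u ++ v) `^ beta != 0 -> 0 < checkP x u `^ beta.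
Proof.
move=> h; rewrite lt_neqAle powR_ge0 andbT eq_sym; apply: contra h.
rewrite !powR_eq0 => /andP[/eqP h ->]; rewrite andbT.
by rewrite checkP_cat h mul0r.
Qed.

Lemma branch_pos_ge0 u j : 0 <= branch_pos u j <= seg_len u.
Proof.
have /andP[l0 l1] := loc_itv (x u) j.
by rewrite mulr_ge0 ?powR_ge0//= ler_wpM2l// powR_ge0.
Qed.

Lemma seg_len_ge0 u : 0 <= seg_len u.
Proof. by rewrite mulr_ge0 ?powR_ge0// ltW// len_gt0. Qed.

Lemma branch_pos_inj u j k : 0 < checkP x u `^ beta ->
  branch_pos u j = branch_pos u k -> j = k.
Proof.
move=> P0 /(mulfI (lt0r_neq0 P0)).
exact: loc_inj.
Qed.

Lemma tree_fun_ge0 f u : tree_fun f -> 0 <= f u.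
Proof. by case=> /(_ u) /andP[]. Qed.

Lemma tree_fun_checkP f u v : tree_fun f -> 0 < f (u ++ v) ->
  0 < checkP x u `^ beta.
Proof.
case=> /(_ (u ++ v)) /andP[_ fle] _ f0; apply: (@powR_checkP_gt0 u v).
apply/eqP => e; move: fle; rewrite /seg_len e mul0r => /(lt_le_trans f0).
by rewrite ltxx.
Qed.

(** Two words that branch at [p] would prescribe two different beads for the coordinate at [p],
    while the beads of one string lie at distinct places. *)
Lemma tree_fun_chain f u v : tree_fun f -> 0 < f u -> 0 < f v ->
  prefix u v || prefix v u.
Proof.
move=> ft fu fv; have [->//|->|[p [j [k [u' [v' [jk eu ev]]]]]]] := branching_words u v.
  by rewrite orbT.
exfalso; apply: jk; rewrite eu in fu; rewrite ev in fv.
apply: (@branch_pos_inj p); first exact: tree_fun_checkP fu.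
by rewrite -(ft.2 _ _ _ fu) -(ft.2 _ _ _ fv).
Qed.

Lemma tree_fun0 : tree_fun (fun=> 0).
Proof. by split=> [u|u j v]; rewrite ?ltxx// lexx seg_len_ge0. Qed.

Lemma limit_tree_point D : limit_tree D point.
Proof. by split=> //; exact: tree_fun0. Qed.

Lemma limit_treeS D E : D `<=` E -> limit_tree D `<=` limit_tree E.
Proof. by move=> DE f [ft f0]; split=> // u Eu; apply: f0 => /DE. Qed.

Lemma tight_in_l1 f : tight_tree -> tree_fun f -> in_l1 f.
Proof.
move=> tx ft; split=> [u|]; first exact: tree_fun_ge0.
have [W hW] := tx 1 ltr01.
apply: (le_lt_trans (esum_split_seq W (fun u => tree_fun_ge0 u ft))).
by rewrite lte_add_pinfty ?ltry// (le_lt_trans (hW f ft))// ltry.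
Qed.

Section truncation.

Definition trunc_fun (n : nat) f : seq nat -> R :=
  fun u => if (size u <= n)%N then f u else 0.

Lemma trunc_fun_l1 n f : in_l1 f -> in_l1 (trunc_fun n f).
Proof.
move=> [f0 fs]; split=> [u|]; first by rewrite /trunc_fun; case: ifP.
apply: le_lt_trans fs; apply: le_esum => u _; rewrite lee_fin /trunc_fun.
by case: ifP.
Qed.

Definition l1_trunc n (f : l1U R) : l1U R := L1U (trunc_fun_l1 n (l1P f)).

Lemma trunc_tree_fun n f : tree_fun f -> tree_fun (trunc_fun n f).
Proof.
move=> ft; split=> [u|u j v].
  by rewrite /trunc_fun; case: ifP => _; [exact: ft.1|rewrite lexx seg_len_ge0].
rewrite /trunc_fun size_cat /=; case: ifPn => [h|_]; last by rewrite ltxx.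
by rewrite (leq_trans _ h) ?leq_addr//; exact: ft.2.
Qed.

Lemma l1_trunc_limit_tree n (f : l1U R) : tree_fun f ->
  limit_tree [set k | (k <= n)%N] (l1_trunc n f).
Proof.
move=> ft; split; first exact: trunc_tree_fun.
by move=> u /= /negP nu; rewrite /trunc_fun (negbTE nu).
Qed.

Lemma tight_tail (e : R) : tight_tree -> 0 < e -> exists n : nat,
  forall m, (n <= m)%N -> forall f : l1U R, tree_fun f ->
  mdist f (l1_trunc m f) <= e.
Proof.
move=> tx /tx[W hW]; exists (\max_(w <- W) size w)%N => m nm f ft.
rewrite -lee_fin l1_mdistE; apply: le_trans (hW f ft).
rewrite esum_mkcond [leRHS]esum_mkcond; apply: le_esum => u _; rewrite in_setT.
case: ifPn => [_|]; rewrite lee_fin /= /trunc_fun.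
  case: ifPn => _; first by rewrite subrr normr0 l1_ge0.
  by rewrite subr0 ger0_norm// l1_ge0.
rewrite notin_setE/= => /negP; rewrite negbK => uW.
have um : (size u <= m)%N.
  by apply: leq_trans nm; exact: leq_bigmax_seq.
by rewrite um subrr normr0.
Qed.

End truncation.

Section compactness.
Hypothesis tx : tight_tree.

(** Along an ultrafilter each coordinate converges, being confined to a segment. The conditions that
    define the tree pass to the limit, and tightness, uniform on the tree, turns coordinatewise
    convergence into convergence in l^1. *)
Lemma compact_limit_tree D : compact (limit_tree D).
Proof.
rewrite compact_ultra => U UU UT.
have /choice[p hp] : forall u, exists p : R, 0 <= p <= seg_len u /\
    forall e : R, 0 < e -> U [set F | `|p - F u| < e].
  move=> u; have : UltraFilter ((fun F : l1U R => F u) @ U) by exact: ultra_fmap.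
  move=> UuU; have := @segment_compact R 0 (seg_len u).
  rewrite compact_ultra => /(_ _ UuU)[|q [qI Uq]].
    have : U [set F : l1U R | [set` `[0, seg_len u]] (F u)]; last by [].
    by apply: filterS UT => F [[/(_ u) hF _] _]; rewrite /= in_itv.
  exists q; split; first by move: qI; rewrite /= in_itv.
  by move=> e e0; have /cvgrPdist_lt := Uq; exact.
have near_p u e : 0 < e -> U [set F | `|p u - F u| < e] by exact: (hp u).2.
(* The branching condition is an equality with a constant, so it survives in the limit once it holds
   for [U]-many [F]; positivity of [p] at a longer word provides that. *)
have p_eq u a : U [set F | F u = a] -> p u = a.
  move=> Ua; apply/eqP; rewrite -subr_eq0 -normr_le0; apply/ler_addgt0Pr => e e0.
  rewrite add0r; have [F [/= <- /ltW]] := filter_ex (filterI Ua (near_p u e e0)).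
  by [].
have pt : tree_fun p.
  split=> [u|u j v p0]; first exact: (hp u).1.
  apply: p_eq; apply: filterS (filterI UT (near_p _ _ p0)) => F [[[_ Ft] _] /=].
  move=> h; apply: (Ft _ _ v); move: h.
  by rewrite ltr_norml => /andP[_]; lra.
pose q := L1U (tight_in_l1 tx pt).
exists q; split.
  split=> // u Du; apply: p_eq; apply: filterS UT => F [_]; exact.
apply: filter_cvg_mdist => e e0.
have e3 : 0 < e / 3 / 2 by lra.
have [W hW] := tx e3.
have UW d : 0 < d -> U [set F | \sum_(u <- W) `|p u - F u| < d].
  elim: (W) d => [d d0|w V IH d d0].
    by apply: filterS filterT => F _ /=; rewrite big_nil.
  have d2 : 0 < d / 2 by lra.
  apply: filterS (filterI (near_p w _ d2) (IH _ d2)) => F [/= ? ?].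
  by rewrite big_cons; lra.
apply: filterS (filterI UT (UW _ e3)) => F [[Ft _] /= FW].
rewrite -lte_fin l1_mdistE.
apply: (@le_lt_trans _ _ (e / 3 / 2 + (e / 3 / 2 + e / 3 / 2))%:E); last first.
  by rewrite lte_fin; lra.
apply: (le_trans (esum_split_seq W (fun u => normr_ge0 (p u - F u)))).
rewrite EFinD; apply: leeD; first by rewrite lee_fin (ltW FW).
apply: (@le_trans _ _ (\esum_(u in [set u | u \notin W]) ((p u)%:E + (F u)%:E))%E).
  apply: le_esum => u _; rewrite -EFinD lee_fin (le_trans (ler_normB _ _))//.
  by rewrite !ger0_norm ?l1_ge0// (tree_fun_ge0 _ pt).
rewrite esumD; last 2 first.
- by move=> u _; rewrite lee_fin (tree_fun_ge0 _ pt).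
- by move=> u _; rewrite lee_fin l1_ge0.
by rewrite EFinD leeD// hW.
Qed.

Lemma closed_limit_tree D : closed (limit_tree D).
Proof.
by apply: compact_closed; [exact: metric_hausdorff|exact: compact_limit_tree].
Qed.

End compactness.

End tree_functions.

Section min_increments.
Context {R : realType}.
Implicit Types s t a b : R.

(** [Num.min t b - Num.min t a] is the length of the part of [a, b] that lies below [t]; the bounds
    and the monotonicity in [t] follow this picture. *)
Lemma min_incr_ge0 t a b : a <= b -> 0 <= Num.min t b - Num.min t a.
Proof. by case: (leP t b); case: (leP t a); lra. Qed.

Lemma min_incr_le t a b : a <= b -> Num.min t b - Num.min t a <= b - a.
Proof. by case: (leP t b); case: (leP t a); lra. Qed.

Lemma min_incr_homo s t a b : s <= t -> a <= b ->
  Num.min s b - Num.min s a <= Num.min t b - Num.min t a.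
Proof.
by case: (leP t b); case: (leP t a); case: (leP s b); case: (leP s a); lra.
Qed.

End min_increments.

(** * Geodesics and the four-point condition in the limit tree *)

Section tree_geodesics.
Context {R : realType} (beta : R) (x : seq nat -> beads R).
Implicit Types (u v w : seq nat).

Lemma prefix_sum_le (f : l1U R) v :
  \sum_(i < (size v).+1) f (take i v) <= mdist point f.
Proof.
rewrite -lee_fin l1_mdist_point -sumEFin.
pose s := [seq take i v | i <- iota 0 (size v).+1].
have us : uniq s.
  rewrite map_inj_in_uniq ?iota_uniq// => i j; rewrite !mem_iota !add0n !ltnS.
  by move=> /andP[_ iv] /andP[_ jv] /(congr1 size); rewrite !size_takel.
apply: esum_ge; exists [set` s]; first by split=> //; exact: finite_seq.
rewrite -fsbig_seq//= /s big_map -[iota _ _]/(index_iota 0 (size v).+1).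
by rewrite big_mkord.
Qed.

Section geodesic.
Variable c : l1U R.
Hypothesis ct : tree_fun beta x c.

Definition below u : R := \sum_(i < size u) c (take i u).

(* The point at distance [t] from the root on the path to [c]: the coordinates
   of [c] are filled in the order of their depth. *)
Definition geod_fun (t : R) u : R :=
  Num.min t (below u + c u) - Num.min t (below u).

Lemma below_take u i : (i <= size u)%N ->
  below (take i u) = \sum_(k < i) c (take k u).
Proof.
move=> iu; rewrite /below size_takel//.
by apply: eq_bigr => k _; rewrite take_takel// ltnW.
Qed.

Lemma sum_take_le_below u i : (i <= size u)%N ->
  \sum_(k < i) c (take k u) <= below u.
Proof.
move=> iu; rewrite /below -!(big_mkord xpredT (fun k => c (take k u))).
rewrite (big_cat_nat _ iu)//= lerDl.
by apply: sumr_ge0 => k _; exact: l1_ge0.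
Qed.

Lemma below_ge0 u : 0 <= below u.
Proof. by apply: sumr_ge0 => i _; exact: l1_ge0. Qed.

Lemma belowS u : below u <= below u + c u.
Proof. by rewrite lerDl l1_ge0. Qed.

(** Along the prefixes of [v], the coordinates of [c] occupy adjacent intervals from [below u] to
    [below u + c u], so their parts below [t] telescope. *)
Lemma geod_sum (t : R) v : \sum_(i < (size v).+1) geod_fun t (take i v) =
  Num.min t (below v + c v) - Num.min t 0.
Proof.
pose S i : R := \sum_(k < i) c (take k v).
have Sv : below v + c v = S (size v).+1.
  by rewrite /S big_ord_recr/= take_size; congr (_ + _).
have S0 : S 0%N = 0 by rewrite /S big_ord0.
transitivity (Num.min t (S (size v).+1) - Num.min t (S 0%N)); last by rewrite Sv S0.
rewrite -(telescope_sumr (fun i => Num.min t (S i)))// big_mkord.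
apply: eq_bigr => i _; have iv : (i <= size v)%N by rewrite -ltnS.
by rewrite /geod_fun below_take// -/(S i) /S big_ord_recr.
Qed.

Lemma geod_fun_bound (t : R) u : 0 <= geod_fun t u <= c u.
Proof.
rewrite min_incr_ge0 ?belowS//=.
by apply: (le_trans (min_incr_le t (belowS u))); lra.
Qed.

Lemma geod_fun_tree t : tree_fun beta x (geod_fun t).
Proof.
split=> [u|u j v].
  have /andP[g0 gc] := geod_fun_bound t u; rewrite g0/= (le_trans gc)//.
  by have [/(_ u) /andP[]] := ct.
set w := u ++ j :: v => gw.
have /andP[_ gcw] := geod_fun_bound t w.
have cu : c u = branch_pos beta x u j.
  by apply: (ct.2 _ _ v); exact: lt_le_trans gcw.
have tw : below w < t.
  rewrite ltNge; apply/negP => tw; move: gw; rewrite /geod_fun.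
  by rewrite (min_idPl tw) (min_idPl (le_trans tw (belowS w))) subrr ltxx.
(* A positive value at the longer word [w] means that [t] has passed [below w], which already counts
   the whole of [c u]. The coordinate at [u] is then full and equals the branching position. *)
suff uw : below u + c u <= below w.
  rewrite /geod_fun (min_idPr _) ?(min_idPr _) -?cu; [lra| |].
    by rewrite (le_trans (belowS u))// (le_trans uw)// ltW.
  by rewrite (le_trans uw)// ltW.
have sw : ((size u).+1 <= size w)%N by rewrite size_cat /= addnS leq_addr.
apply: le_trans (sum_take_le_below sw); rewrite big_ord_recr /= -below_take.
  by rewrite /w take_size_cat.
exact: ltnW.
Qed.

Lemma geod_l1 t : in_l1 (geod_fun t).
Proof.
split=> [u|]; first by case/andP: (geod_fun_bound t u).
case: (l1P c) => _; apply: le_lt_trans; apply: le_esum => u _.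
by rewrite lee_fin; case/andP: (geod_fun_bound t u).
Qed.

Definition geod t : l1U R := L1U (geod_l1 t).

Lemma geod0 : geod 0 = point.
Proof.
apply: l1_ext => u /=; rewrite /geod_fun !(min_idPl _) ?subrr//.
  exact: below_ge0.
by rewrite addr_ge0 ?below_ge0 ?l1_ge0.
Qed.

Lemma geod1 : geod (mdist point c) = c.
Proof.
apply: l1_ext => u /=.
have h : below u + c u <= mdist point c.
  apply: le_trans (prefix_sum_le c u); rewrite big_ord_recr /= take_size.
  by rewrite /below.
rewrite /geod_fun !(min_idPr _)//; first lra.
by rewrite (le_trans (belowS u)).
Qed.

Lemma geod_dist_le s t : 0 <= s -> s <= t -> mdist (geod s) (geod t) <= t - s.
Proof.
move=> s0 st; rewrite -lee_fin l1_mdistE.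
under eq_esum do rewrite distrC.
have g0 u : 0 <= geod t u - geod s u by rewrite subr_ge0 min_incr_homo ?belowS.
under eq_esum do rewrite ger0_norm//.
apply: (@chain_esum_le _ c) => //; first by rewrite subr_ge0.
- by move=> u v; exact: (tree_fun_chain ct).
- move=> u gu; rewrite lt_neqAle l1_ge0 andbT eq_sym; apply/eqP => c0.
  have /andP[_ h] := geod_fun_bound t u; have /andP[h' _] := geod_fun_bound s u.
  by move: gu; rewrite /= subr_gt0 => /(le_lt_trans h'); rewrite ltNge -c0 h.
- move=> v _; rewrite sumrB !geod_sum (min_idPr s0) (min_idPr (le_trans s0 st)).
  rewrite !subr0.
  by case: (leP s (below v + c v)); case: (leP t (below v + c v)); lra.
Qed.

End geodesic.

(** Upper bounds suffice: on each of the three pieces cut by [s] and [t] the distance is at most the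
    change of parameter, and the total is the distance between the root and [c], so no piece can be
    shorter. *)
Lemma geod_dist c (ct : tree_fun beta x (c : l1U R)) s t :
  s \in `[0, mdist point c] -> t \in `[0, mdist point c] ->
  mdist (geod c s) (geod c t) = `|s - t|.
Proof.
wlog st : s t / s <= t.
  by move=> H sI tI; have [|/ltW] := leP s t => h; last rewrite metric_sym distrC;
    exact: H.
rewrite !in_itv/= => /andP[s0 s1] /andP[t0 t1].
rewrite ler0_norm ?subr_le0// opprB; apply/eqP; rewrite eq_le geod_dist_le//=.
have := metric_triangle (geod c 0) (geod c s) (geod c (mdist point c)).
have := metric_triangle (geod c s) (geod c t) (geod c (mdist point c)).
have := geod_dist_le ct (lexx 0) s0; have := geod_dist_le ct t0 t1.
by rewrite geod0 geod1; lra.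
Qed.

(** The parts of the path to [k] shared with [f] and with [g] are both initial pieces of that path,
    hence nested. Failures at [u] and [v] would both lie on the path to [k]; at the shorter word,
    [k] and the function that is positive at the longer one share the branching position, so their
    minimum is the value of [k] itself. *)
Lemma min_comparable (f g k : seq nat -> R) : tree_fun beta x f ->
  tree_fun beta x g -> tree_fun beta x k ->
  (forall u, Num.min (f u) (k u) <= Num.min (k u) (g u)) \/
  (forall u, Num.min (k u) (g u) <= Num.min (f u) (k u)).
Proof.
move=> ft gt kt; apply: contrapT => /not_orP[].
move=> /existsNP[u /negP]; rewrite -ltNge => hu.
move=> /existsNP[v /negP]; rewrite -ltNge => hv.
have m0 (a b : R) : 0 <= a -> 0 <= b -> 0 <= Num.min a b.
  by move=> a0 b0; rewrite le_min a0.
have fu : 0 < Num.min (f u) (k u).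
  apply: le_lt_trans hu; by apply: m0; apply: tree_fun_ge0; eassumption.
have gv : 0 < Num.min (k v) (g v).
  apply: le_lt_trans hv; by apply: m0; apply: tree_fun_ge0; eassumption.
move: (fu) (gv); rewrite !lt_min => /andP[fu0 ku0] /andP[kv0 gv0].
have [/prefixP[[|j w] e]|/prefixP[[|j w] e]] := orP (tree_fun_chain kt ku0 kv0).
- by move: hv; rewrite e cats0 => /(lt_trans hu); rewrite ltxx.
- have := kt.2 u j w; have := gt.2 u j w; rewrite -e => /(_ gv0) gu /(_ kv0) ku.
  by move: hu; rewrite ltNge gu ku minxx ge_min lexx orbT.
- by move: hu; rewrite e cats0 => /(lt_trans hv); rewrite ltxx.
- have := kt.2 v j w; have := ft.2 v j w; rewrite -e => /(_ fu0) fv /(_ ku0) kv.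
  by move: hv; rewrite ltNge fv kv minxx ge_min lexx.
Qed.

Lemma limit_tree_rooted_tree_like D :
  rooted_tree_like (limit_tree beta x D) point.
Proof.
split; first exact: limit_tree_point.
  move=> c [ct c0]; exists (geod c); rewrite geod0 geod1; split=> //; split.
    move=> s _; split; first exact: geod_fun_tree.
    move=> u /c0 cu; apply/eqP; rewrite eq_le.
    by have := geod_fun_bound c s u; rewrite cu andbC.
  by move=> s t; exact: geod_dist.
move=> a b c [at_ _] [bt _] [ct _].
have mono (f f' g g' : l1U R) :
    (forall u, Num.min (f u) (f' u) <= Num.min (g u) (g' u)) ->
    gromov point f f' <= gromov point g g'.
  by move=> h; rewrite -lee_fin !l1_gromovE; apply: le_esum => u _; rewrite lee_fin.
have [h|h] := min_comparable at_ ct bt; rewrite ge_min; apply/orP; [left|right];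
  apply: mono => u; have := h u; rewrite !le_min => /andP[h1 h2].
  by rewrite ge_min lexx h2.
by rewrite h1 ge_min lexx orbT.
Qed.

Lemma limit_tree_rtree D : tight_tree beta x ->
  compact_rtree (limit_tree beta x D).
Proof.
move=> tx; have cK := compact_limit_tree (D := D) tx.
split=> //; apply: rooted_tree_like_rtree (limit_tree_rooted_tree_like D) _.
exact: compact_separable.
Qed.

Lemma checkX_eval u w : checkX beta x u w =
  if prefix w u && (size w < size u)%N then branch_pos beta x w (nth 0%N u (size w))
  else 0.
Proof.
have E : checkX beta x u w = \sum_(k < size u)
    branch_pos beta x (take k u) (nth 0%N u k) * (w == take k u)%:R.
  by rewrite /checkX fct_sumE; apply: eq_bigr.
rewrite E; case: ifPn => [/andP[wu wlt]|nw].
  rewrite (bigD1 (Ordinal wlt))//= big1 ?addr0.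
    by move: wu; rewrite prefixE => /eqP ->; rewrite eqxx mulr1.
  move=> i /eqP iw; case: eqP => [e|]; rewrite ?mulr0//; exfalso; apply: iw.
  by apply: val_inj; rewrite /= e size_takel// ltnW.
apply: big1 => i _; case: eqP => [e|]; rewrite ?mulr0//; exfalso.
move: nw; rewrite e prefix_take /= size_takel ?ltn_ord//; exact: ltnW.
Qed.

Lemma emb_point_eval u (t : interval (x u)) w : emb_point beta t w =
  if w == u then checkP x u `^ beta * sval t
  else if prefix w u then branch_pos beta x w (nth 0%N u (size w)) else 0.
Proof.
rewrite -[emb_point beta t w]/(checkX beta x u w +
  (checkP x u `^ beta * sval t) * (w == u)%:R) checkX_eval.
have [->|wu] := eqVneq w u; first by rewrite ltnn andbF add0r mulr1.
rewrite mulr0 addr0; case: (boolP (prefix w u)) => //= pw.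
rewrite ltn_neqAle size_prefix// andbT; case: eqP => //= e.
by move: pw wu; rewrite prefixE e take_size eq_sym => ->.
Qed.

Lemma emb_point_tree_fun u (t : interval (x u)) : tree_fun beta x (emb_point beta t).
Proof.
split=> [w|w j v]; rewrite emb_point_eval.
  case: eqP => [->|_].
    have /andP[t0 t1] := svalP t.
    by rewrite mulr_ge0 ?powR_ge0//= ler_wpM2l// powR_ge0.
  by case: ifP => _; [exact: branch_pos_ge0|rewrite lexx seg_len_ge0].
move=> h; have {h} /prefixP[v' e] : prefix (w ++ j :: v) u.
  move: h; case: eqP => [->|_]; first by rewrite prefix_refl.
  by case: ifP => //; rewrite ltxx.
have wu : w != u.
  by apply/eqP => /(congr1 size); rewrite e !size_cat /= -addnA -[LHS]addn0 => /eqP; rewrite eqn_add2l.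
rewrite emb_point_eval (negbTE wu) e -catA prefix_prefix.
by rewrite nth_cat ltnn subnn.
Qed.

(** A point of depth at most [n] sits on the segment of the deepest word at which it is positive:
    the chain property and the branching condition determine its other coordinates. If there is no
    such word, the point is the root. *)
Lemma emb_treeE n : emb_tree beta x n = limit_tree beta x [set k | (k <= n)%N].
Proof.
apply/seteqP; split=> [_ [u /= un [t _ <-]]|f [ft f0]].
  split; first exact: emb_point_tree_fun.
  move=> w wn; rewrite emb_point_eval; case: eqP => [wu|_].
    by exfalso; apply: wn; rewrite /= wu.
  by case: ifPn => // /size_prefix wu; exfalso; apply: wn; exact: leq_trans un.
pose Q k := `[< exists v, size v = k /\ 0 < f v >].
have Qn k : Q k -> (k <= n)%N.
  move=> /asboolP[v [<- fv]]; apply: contrapT => /f0 e.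
  by move: fv; rewrite e ltxx.
have [/ex_maxnP - /(_ _ Qn)[k /asboolP[v [vk fv]] kmax]|nQ] := pselect (exists k, Q k).
  have P0 : 0 < checkP x v `^ beta.
    by have := @tree_fun_checkP _ _ _ f v [::] ft; rewrite cats0; exact.
  have tI : 0 <= f v / checkP x v `^ beta <= len (x v).
    apply/andP; split; first by apply: divr_ge0; [exact: l1_ge0|exact: ltW].
    by rewrite ler_pdivrMr// mulrC; case/andP: (ft.1 v).
  exists v; first by rewrite /= Qn//; apply/asboolP; exists v.
  exists (exist (fun y : R => 0 <= y <= len (x v)) _ tI) => //; apply: l1_ext => w; rewrite emb_point_eval /=.
  case: eqP => [->|/eqP wv]; first by rewrite mulrC divfK// gt_eqF.
  case: ifPn => [/prefixP[[|j v'] e]|nwv].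
  - by rewrite e cats0 eqxx in wv.
  - have -> : nth 0%N v (size w) = j by rewrite e nth_cat ltnn subnn.
    by rewrite (ft.2 w j v')// -e.
  - apply/eqP; rewrite eq_sym eq_le l1_ge0 andbT leNgt; apply/negP => fw.
    have := tree_fun_chain ft fw fv; rewrite (negbTE nwv) /= => vw.
    have h : (size w <= size v)%N.
      by rewrite vk; apply: kmax; apply/asboolP; exists w.
    have e : size v = size w by apply/eqP; rewrite eqn_leq size_prefix.
    by move: vw wv; rewrite prefixE e take_size => /eqP ->; rewrite eqxx.
have t0 : 0 <= (0 : R) <= len (x [::]) by rewrite lexx ltW ?len_gt0.
exists [::] => //; exists (exist (fun y : R => 0 <= y <= len (x [::])) _ t0) => //; apply: l1_ext => w.
rewrite emb_point_eval prefixs0 /= mulr0; case: eqP => _;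
  apply/eqP; rewrite eq_sym eq_le l1_ge0 andbT leNgt; apply/negP => fw;
  by apply: nQ; exists (size w); apply/asboolP; exists w.
Qed.

End tree_geodesics.

(** * Grafting *)

Section esum_branches.
Context {R : realType}.

Lemma esumZ (T : choiceType) (D : set T) (c : R) (a : T -> R) :
  0 <= c -> (forall t, 0 <= a t) ->
  (\esum_(t in D) (c * a t)%:E = c%:E * \esum_(t in D) (a t)%:E)%E.
Proof.
have le (d : R) (b : T -> R) : 0 <= d -> (forall t, 0 <= b t) ->
    (\esum_(t in D) (d * b t)%:E <= d%:E * \esum_(t in D) (b t)%:E)%E.
  move=> d0 b0; apply: ge_ereal_sup => _ [X [fX XD] <-].
  have b0E t : (0 <= (b t)%:E)%E by rewrite lee_fin.
  rewrite (_ : (\sum_(t \in X) (d * b t)%:E = d%:E * \sum_(t \in X) (b t)%:E)%E).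
    rewrite lee_wpmul2l ?lee_fin//.
    by apply: esum_ge; exists X.
  by rewrite ge0_mule_fsumr.
move=> c0 a0; apply/eqP; rewrite eq_le le//=.
have [->|cn0] := eqVneq c 0.
  by rewrite mul0e esum_ge0// => t _; rewrite lee_fin mul0r.
have cp : 0 < c by rewrite lt_neqAle eq_sym cn0.
rewrite -lee_pdivlMl// -[X in (X <= _)%E](_ : \esum_(t in D) (c^-1 * (c * a t))%:E = _)%E.
  by apply: le => [|t]; rewrite ?invr_ge0 ?mulr_ge0.
by apply: eq_esum => t _; rewrite mulKf.
Qed.

Lemma esum_cons (F : seq nat -> \bar R) j : (forall u, (0 <= F u)%E) ->
  (\esum_(u in [set u | ohead u = Some j]) F u = \esum_(v in setT) F (j :: v))%E.
Proof.
move=> F0; rewrite (@reindex_esum _ _ _ setT _ (cons j))//.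
split; [by move=> v _|by move=> v v' _ _ []|].
by move=> [|k v] // [<-]; exists v.
Qed.

Lemma esum_branch (F : seq nat -> \bar R) j : (forall u, (0 <= F u)%E) ->
  (forall k v, k != j -> F (k :: v) = 0%E) ->
  (\esum_(u in setT) F u = F [::] + \esum_(v in setT) F (j :: v))%E.
Proof.
move=> F0 Fj; rewrite (esumID [set [::]])// setTI esum_set1//; congr (_ + _)%E.
rewrite -esum_cons// (esumID [set u | ohead u = Some j])//.
rewrite [X in (_ + X)%E]esum1 ?adde0; last first.
  move=> [|k v] [[_ h] h']; first by case: h.
  by rewrite Fj//; apply/eqP => kj; apply: h'; rewrite /= kj.
congr esum; apply/seteqP; split=> [u [] //|[|k v] //= h].
Qed.

Lemma esum_branch2 (F : seq nat -> \bar R) j k : j != k ->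
  (forall u, (0 <= F u)%E) ->
  (forall i v, i != j -> i != k -> F (i :: v) = 0%E) ->
  (\esum_(u in setT) F u = F [::] + \esum_(v in setT) F (j :: v) +
                           \esum_(v in setT) F (k :: v))%E.
Proof.
move=> jk F0 Fjk.
pose G u := if ohead u == Some k then 0%E else F u.
pose H u := if ohead u == Some k then F u else 0%E.
have G0 u : (0 <= G u)%E by rewrite /G; case: ifP.
have H0 u : (0 <= H u)%E by rewrite /H; case: ifP.
transitivity (\esum_(u in setT) (G u + H u))%E.
  by apply: eq_esum => u _; rewrite /G /H; case: ifP; rewrite ?add0e ?adde0.
rewrite esumD// (@esum_branch G j)//; last first.
  move=> i v ij; rewrite /G /=; case: eqP => // h; rewrite Fjk//.
  by apply/eqP => ik; apply: h; rewrite ik.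
rewrite (@esum_branch H k)//; last first.
  move=> i v ik; rewrite /H /=; case: eqP => // -[ik'].
  by rewrite ik' eqxx in ik.
rewrite {1}/H /= add0e {1}/G /=; congr (_ + _ + _)%E; apply: eq_esum => v _.
  by rewrite /G /=; case: eqP => // -[jk']; rewrite jk' eqxx in jk.
by rewrite /H /= eqxx.
Qed.

End esum_branches.

Section graft_embedding.
Context {R : realType} (beta : R) (s : beads R).

Definition scale j : R := mass s j `^ beta.

Definition graft_fun j (g : seq nat -> R) (u : seq nat) : R :=
  if u is k :: v then if k == j then scale j * g v else 0 else loc s j.

Lemma scale_ge0 j : 0 <= scale j. Proof. exact: powR_ge0. Qed.

Lemma loc_ge0 j : 0 <= loc s j. Proof. by case/andP: (loc_itv s j). Qed.

Lemma graft_fun_l1 j g : in_l1 g -> in_l1 (graft_fun j g).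
Proof.
move=> [g0 gs].
have G0 u : 0 <= graft_fun j g u.
  case: u => [|k v] /=; first exact: loc_ge0.
  by case: ifP => // _; rewrite mulr_ge0 ?scale_ge0.
split=> //; rewrite (@esum_branch _ _ j)/= ?eqxx; last first.
- by move=> k v /negbTE ->.
- by move=> u; rewrite lee_fin.
rewrite esumZ ?scale_ge0// lte_add_pinfty ?ltry// lte_mul_pinfty//.
by rewrite lee_fin scale_ge0.
Qed.

Definition graft_pt j (g : l1U R) : l1U R := L1U (graft_fun_l1 j (l1P g)).

Definition seg_fun (t : R) (u : seq nat) : R := t * (u == [::])%:R.

Lemma seg_fun_l1 t : 0 <= t -> in_l1 (seg_fun t).
Proof. by move=> t0; exact: (in_l1_unit [::] t0). Qed.

Definition seg_pt (t : interval s) : l1U R :=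
  L1U (seg_fun_l1 (proj1 (andP (svalP t)))).

Lemma graft_ptE j g v : graft_pt j g (j :: v) = scale j * g v.
Proof. by rewrite /= eqxx. Qed.

Lemma graft_pt_neq j g k v : k != j -> graft_pt j g (k :: v) = 0.
Proof. by move=> /= /negbTE ->. Qed.

Lemma esum_scale j (g : l1U R) :
  (\esum_(v in setT) (scale j * g v)%:E = (scale j * mdist point g)%:E)%E.
Proof.
rewrite esumZ ?scale_ge0//; last by move=> v; exact: l1_ge0.
by rewrite -l1_mdist_point.
Qed.

(** This formula and the next three match the kinds of pairs distinguished by [graft_dist]; the
    isometry property of [graft_map] is read off them. *)
Lemma mdist_seg_seg t t' : mdist (seg_pt t) (seg_pt t') = mdist t t'.
Proof.
apply: EFin_inj; rewrite l1_mdistE (@esum_branch _ _ 0%N); last first.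
- by move=> k v _; rewrite /= /seg_fun !mulr0 subrr normr0.
- by move=> u; rewrite lee_fin.
rewrite esum1 ?adde0; first by rewrite /= /seg_fun !mulr1.
by move=> v _; rewrite /= /seg_fun !mulr0 subrr normr0.
Qed.

Lemma mdist_seg_graft t j g : mdist (seg_pt t) (graft_pt j g) =
  mdist t (bead s j) + scale j * mdist point g.
Proof.
apply: EFin_inj; rewrite l1_mdistE (@esum_branch _ _ j); last first.
- move=> k v kj; rewrite graft_pt_neq//= /seg_fun mulr0 subrr normr0//.
- by move=> u; rewrite lee_fin.
rewrite EFinD -esum_scale; congr (_ + _)%E; first by rewrite /= /seg_fun mulr1.
apply: eq_esum => v _; rewrite graft_ptE /= /seg_fun mulr0 sub0r normrN ger0_norm//.
by rewrite mulr_ge0 ?scale_ge0 ?l1_ge0.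
Qed.

Lemma mdist_graft_same j g g' :
  mdist (graft_pt j g) (graft_pt j g') = scale j * mdist g g'.
Proof.
apply: EFin_inj; rewrite l1_mdistE (@esum_branch _ _ j); last first.
- by move=> k v kj; rewrite !graft_pt_neq// subrr normr0.
- by move=> u; rewrite lee_fin.
rewrite /= subrr normr0 add0e EFinM l1_mdistE -esumZ ?scale_ge0//.
by apply: eq_esum => v _; rewrite eqxx -mulrBr normrM ger0_norm ?scale_ge0.
Qed.

Lemma mdist_graft_diff j k g g' : j != k ->
  mdist (graft_pt j g) (graft_pt k g') =
  scale j * mdist point g + mdist (bead s j) (bead s k) + scale k * mdist point g'.
Proof.
move=> jk; apply: EFin_inj; rewrite l1_mdistE (@esum_branch2 _ _ _ _ jk); last first.
- by move=> i v ij ik; rewrite !graft_pt_neq// subrr normr0.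
- by move=> u; rewrite lee_fin.
rewrite [scale j * _ + _]addrC !EFinD -!esum_scale.
congr (_ + _ + _)%E; apply: eq_esum => v _; rewrite graft_ptE.
  by rewrite graft_pt_neq// subr0 ger0_norm// mulr_ge0 ?scale_ge0 ?l1_ge0.
rewrite graft_pt_neq 1?eq_sym// sub0r normrN ger0_norm//.
by rewrite mulr_ge0 ?scale_ge0 ?l1_ge0.
Qed.

Lemma graft_pt_point j : graft_pt j point = seg_pt (bead s j).
Proof.
apply: mdist_positivity; rewrite metric_sym mdist_seg_graft !mdistxx mulr0.
by rewrite addr0.
Qed.

Section graft_map.
Variables (tau : nat -> pmetricType R) (f : forall j, tau j -> l1U R).
Hypothesis fI : forall j, isometric_on setT (@f j).
Hypothesis f0 : forall j, f (point : tau j) = point.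

Definition graft_map (a : graft_space beta s tau) : l1U R :=
  match a with
  | inl t => seg_pt t
  | inr u => graft_pt (tag u) (f (sval (tagged u)))
  end.

Let f_norm j (t : tau j) : mdist point (f t) = mdist point t.
Proof. by rewrite -(f0 j) fI. Qed.

Lemma graft_map_isometric : isometric_on setT graft_map.
Proof.
move=> [t|[j b]] [t'|[k b']] _ _; rewrite -[RHS]/(graft_dist _ _) /=.
- exact: mdist_seg_seg.
- by rewrite mdist_seg_graft f_norm.
- by rewrite metric_sym mdist_seg_graft f_norm addrC (metric_sym t').
- have [jk|jk] := eqVneq j k; last by rewrite mdist_graft_diff// !f_norm.
  case: _ / jk b' => b'; rewrite mdist_graft_same fI//.
  congr (_ * mdist _ (sval _)).
  by rewrite (@tagged_asE _ _ (existT _ j b) b').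
Qed.

Lemma graft_map_point : graft_map point = point.
Proof. by apply: l1_ext => u; rewrite /= /seg_fun mul0r. Qed.

Lemma range_graft_map : range graft_map =
  range seg_pt `|` \bigcup_(j in [set j | 0 < mass s j]) (graft_pt j @` range (@f j)).
Proof.
apply/seteqP; split.
  move=> _ [[t|[j [b [mj bp]]]] _ <-]; first by left; exists t.
  by right; exists j => //; exists (f b) => //; exists b.
move=> _ [[t _ <-]|[j /= mj [_ [b _ <-] <-]]]; first by exists (inl t).
(* The root of a grafted tree is not a branch point: it is represented by the bead to which it is
   glued. *)
have [->|/eqP bp] := eqVneq b point.
  by exists (inl (bead s j)) => //=; rewrite f0 graft_pt_point.
by exists (inr (existT (graft_branch s tau) j (exist _ b (conj mj bp)))).
Qed.

End graft_map.

End graft_embedding.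

(** * The recursion, read in l^1 *)

Section recursive_embedding.
Context {R : realType} (beta : R).
Hypothesis beta_gt0 : 0 < beta.
Implicit Types (x y : seq nat -> beads R) (D : set nat).

Lemma checkP1 y j : checkP y [:: j] = mass (y [::]) j.
Proof. by rewrite -[[:: j]]/(rcons [::] j) checkP_rcons checkP_nil mul1r. Qed.

Lemma scale_cons y j v : checkP y (j :: v) `^ beta =
  scale beta (y [::]) j * checkP (subfamily y [:: j]) v `^ beta.
Proof.
by rewrite -[j :: v]/([:: j] ++ v) checkP_cat checkP1 powRM ?mass_ge0 ?checkP_ge0.
Qed.

Lemma seg_len_nil y : seg_len beta y [::] = len (y [::]).
Proof. by rewrite /seg_len checkP_nil powR1 mul1r. Qed.

Lemma branch_pos_nil y j : branch_pos beta y [::] j = loc (y [::]) j.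
Proof. by rewrite /branch_pos checkP_nil powR1 mul1r. Qed.

Lemma seg_len_cons y j v : seg_len beta y (j :: v) =
  scale beta (y [::]) j * seg_len beta (subfamily y [:: j]) v.
Proof. by rewrite /seg_len scale_cons -mulrA. Qed.

Lemma branch_pos_cons y j v k : branch_pos beta y (j :: v) k =
  scale beta (y [::]) j * branch_pos beta (subfamily y [:: j]) v k.
Proof. by rewrite /branch_pos scale_cons -mulrA. Qed.

Lemma subfamily_rcons x i j : subfamily (subfamily x i) [:: j] = subfamily x (rcons i j).
Proof. by apply/funext => v; rewrite /subfamily cat_rcons. Qed.

Lemma subfamily_nil x i : subfamily x i [::] = x i.
Proof. by rewrite /subfamily cats0. Qed.

(** A point either stays on the first segment or leaves it at a single bead [j]. In the latter case,
    dividing its coordinates behind [j] by the scale gives a point of the tree of the subfamily at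
    [j]. *)
Lemma limit_tree_graft y s D : y [::] = s -> D 0%N ->
  limit_tree beta y D = range (@seg_pt _ s) `|`
    \bigcup_(j in [set j | 0 < mass s j]) (graft_pt beta s j @`
       limit_tree beta (subfamily y [:: j]) [set k | D k.+1]).
Proof.
move=> <- D0; apply/seteqP; split=> [f [ft f0]|f]; last first.
  case=> [[t _ <-]|[j /= mj [g [gt g0] <-]]].
    have /andP[t0 t1] := svalP t.
    split=> [|[|k v] h]; [split|by []|by rewrite /= /seg_fun mulr0].
      move=> [|k v]; rewrite /= /seg_fun ?mulr1 ?mulr0 ?seg_len_nil ?t0//.
      by rewrite lexx seg_len_ge0.
    by move=> [|i u] k v; rewrite /= /seg_fun mulr0 ltxx.
  have s0 := scale_ge0 beta (y [::]) j.
  split=> [|[|k v] h //]; last first.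
    by rewrite /=; case: ifP => // _; rewrite g0 ?mulr0.
  split=> [[|k v]|[|i u] k v].
  - by rewrite seg_len_nil; exact: loc_itv.
  - rewrite /=; case: eqP => [->|_]; last by rewrite lexx seg_len_ge0.
    have /andP[g1 g2] := gt.1 v.
    by rewrite mulr_ge0//= seg_len_cons ler_wpM2l.
  - rewrite /= branch_pos_nil; case: eqP => [->//|_]; by rewrite ltxx.
  - rewrite /=; case: eqP => [->|_]; last by rewrite ltxx.
    move=> h; rewrite branch_pos_cons; congr (_ * _); apply: (gt.2 u k v).
    rewrite lt_neqAle (tree_fun_ge0 _ gt) andbT; apply/eqP => e.
    by move: h; rewrite -e mulr0 ltxx.
have [[j [v fj]]|nf] := pselect (exists j v, 0 < f (j :: v)); last first.
  left; have fI : 0 <= f [::] <= len (y [::]) by rewrite -seg_len_nil; exact: ft.1.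
  exists (exist _ (f [::]) fI) => //; apply: l1_ext => -[|j v]; rewrite /= /seg_fun.
    by rewrite mulr1.
  rewrite mulr0; apply/eqP; rewrite eq_sym eq_le l1_ge0 andbT leNgt; apply/negP.
  by move=> h; apply: nf; exists j, v.
right.
have sj : 0 < scale beta (y [::]) j.
  rewrite lt_neqAle scale_ge0 andbT; apply/eqP => e.
  have := @tree_fun_checkP _ _ _ f [:: j] v ft fj.
  by rewrite checkP1 -[_ `^ _]/(scale _ _ _) -e ltxx.
(* A bead without mass has scale 0 since [beta] is positive, so no point leaves the segment there.
   This agrees with [graft_branch], which drops such trees. *)
have mj : 0 < mass (y [::]) j.
  rewrite lt_neqAle mass_ge0 andbT; apply/eqP => e.
  by move: sj; rewrite /scale -e powR0 ?ltxx// gt_eqF.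
exists j => //.
have gl1 : in_l1 (fun v => (scale beta (y [::]) j)^-1 * f (j :: v)).
  split=> [w|]; first by rewrite mulr_ge0 ?invr_ge0 ?scale_ge0 ?l1_ge0.
  rewrite esumZ ?invr_ge0 ?scale_ge0//; last by move=> w; exact: l1_ge0.
  rewrite lte_mul_pinfty// ?lee_fin ?invr_ge0 ?scale_ge0//.
  case: (l1P f) => _; apply: le_lt_trans.
  rewrite -(esum_cons (F := fun u => (f u)%:E)); last first.
    by move=> u; rewrite lee_fin l1_ge0.
  by apply: le_esum_set => // u; rewrite lee_fin l1_ge0.
exists (L1U gl1); last first.
  apply: l1_ext => -[|k w] /=; first by rewrite (ft.2 [::] j v)// branch_pos_nil.
  case: eqP => [->|kj]; first by rewrite mulVKf// gt_eqF.
  apply/eqP; rewrite eq_sym eq_le l1_ge0 andbT leNgt; apply/negP => fk; apply: kj.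
  apply: (@loc_inj _ (y [::])).
  by rewrite -!branch_pos_nil -(ft.2 [::] j v fj) -(ft.2 [::] k w fk).
split=> [|w /= Dw]; last by rewrite f0 ?mulr0.
split=> [w|w k w'] /=.
  have /andP[h0 h1] := ft.1 (j :: w).
  rewrite mulr_ge0 ?invr_ge0 ?scale_ge0//= ler_pdivrMl//.
  by rewrite -seg_len_cons.
rewrite pmulr_rgt0 ?invr_gt0// => /(ft.2 (j :: w) k w') ->.
by rewrite branch_pos_cons mulKf// gt_eqF.
Qed.

Lemma limit_tree0 y s : y [::] = s ->
  limit_tree beta y [set k | (k <= 0)%N] = range (@seg_pt _ s).
Proof.
move=> ys; rewrite (limit_tree_graft ys)//; apply: setUidl => f.
move=> [j _ [g [_ g0] <-]]; exists (bead s j) => //.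
rewrite -(graft_pt_point beta); congr graft_pt.
by apply: l1_ext => u; rewrite g0.
Qed.

Definition embeds_onto (T : pmetricType R) (K : set (l1U R)) :=
  exists f : T -> l1U R, [/\ isometric_on setT f, f point = point & range f = K].

(** Compactness of the grafted space is pulled back from its image in l^1, so [phi] does not fall
    back on the one-point tree. *)
Lemma phi_embeds y s D (tau : nat -> pmetricType R) :
  y [::] = s -> D 0%N -> tight_tree beta y ->
  (forall j, embeds_onto (tau j)
     (limit_tree beta (subfamily y [:: j]) [set k | D k.+1])) ->
  embeds_onto (phi beta s tau) (limit_tree beta y D).
Proof.
move=> ys D0 ty h; pose f j := projT1 (cid (h j)).
have hf j := projT2 (cid (h j)).
have fI j : isometric_on setT (f j) by case: (hf j).
have f0 j : f j point = point by case: (hf j).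
have fr j : range (f j) =
    limit_tree beta (subfamily y [:: j]) [set k | D k.+1] by case: (hf j).
have rF : range (@graft_map _ beta s tau f) = limit_tree beta y D.
  rewrite range_graft_map// (limit_tree_graft ys)//; congr (_ `|` _).
  by apply: eq_bigcupr => j _; rewrite fr.
have cG : compact [set: graft_space beta s tau].
  apply: (isometry_compact_domain (graft_map_isometric fI f0)).
  by rewrite rF; exact: compact_limit_tree.
rewrite /phi; case: asboolP => // _.
exists (@graft_map _ beta s tau f); split=> //; first exact: graft_map_isometric.
exact: graft_map_point.
Qed.

Section family.
Variable x : seq nat -> beads R.
Hypothesis tx : forall i, tight_tree beta (subfamily x i).

Lemma sigma_embeds n i : embeds_onto (sigma beta x n i)
  (limit_tree beta (subfamily x i) [set k | (k <= n)%N]).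
Proof.
elim: n i => [|n IH] i /=.
  exists (@seg_pt _ (x i)); split.
  - by move=> t t' _ _; exact: mdist_seg_seg.
  - by apply: l1_ext => u; rewrite /= /seg_fun mul0r.
  - by rewrite (limit_tree0 (subfamily_nil x i)).
apply: (phi_embeds (subfamily_nil x i)) => // j.
by rewrite subfamily_rcons; exact: IH.
Qed.

Lemma limit_tree_hausdorff y (e : R) : tight_tree beta y -> 0 < e ->
  \forall n \near \oo, (hausdorff_dist (limit_tree beta y [set k | (k <= n)%N])
     (limit_tree beta y setT) < e%:E)%E.
Proof.
move=> ty e0; have e2 : 0 < e / 2 by lra.
have e4 : 0 < e / 4 by lra.
have [N hN] := tight_tail ty e4.
exists N => // n /= Nn; apply: (@le_lt_trans _ _ (e / 2)%:E); last first.
  by rewrite lte_fin; lra.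
apply: hausdorff_dist_le => //.
  apply: subset_trans (sub_thickening e2).
  exact: limit_treeS.
move=> f [ft _]; exists (l1_trunc n f); first exact: l1_trunc_limit_tree.
by rewrite metric_sym; have := hN n Nn f ft; lra.
Qed.

Let limT i : pmetricType R :=
  subtree (limit_tree_point beta (subfamily x i) setT).

Lemma gh_sigma i : gh_dist (sigma beta x n i) (limT i) @[n --> \oo] --> 0%E.
Proof.
apply/ereal_cvg0P => [n|e e0]; first exact: gh_dist_ge0.
have := limit_tree_hausdorff (tx i) e0; apply: filterS => n hn.
have [f [fI f0 fr]] := sigma_embeds n i.
apply: (le_lt_trans _ hn); apply: ereal_inf_lbound.
exists (l1U R), f, (@subtree_val _ _ _ _); split=> //.
rewrite fr range_subtree_val f0 mdistxx.
by rewrite max_r// hausdorff_dist_ge0.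
Qed.

Lemma compact_rtree_limit i : compact_rtree [set: limT i].
Proof.
have c : compact [set: limT i].
  apply: isometry_compact_domain (@subtree_val_isometric _ _ _ _) _.
  by rewrite range_subtree_val; exact: compact_limit_tree.
split=> //; apply: (rooted_tree_like_rtree (o := point)) (compact_separable c).
have [v [vI v0 vr]] : embeds_onto (limT i) (limit_tree beta (subfamily x i) setT).
  by exists (@subtree_val _ _ _ _); split=> //; exact: range_subtree_val.
rewrite -(isometry_inv_image vI) -[X in rooted_tree_like _ X](isometry_invK vI) v0.
apply: rooted_tree_like_isometry; first exact: isometry_inv_isometric.
by rewrite vr; exact: limit_tree_rooted_tree_like.
Qed.

(** [gh_limit] chooses some limit; uniqueness of limits transfers the embedding from the concrete
    limit [limT i] to the chosen one. *)
Lemma gh_limit_embeds i : embeds_onto (gh_limit (fun n => sigma beta x n i))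
  (limit_tree beta (subfamily x i) setT).
Proof.
rewrite /gh_limit; case: pselect => [h|[]]; last first.
  by exists (limT i); split; [exact: compact_rtree_limit|exact: gh_sigma].
case: cid => T [[cT _] gT] /=.
have [f [fI f0 fr]] := gh_limit_unique cT (compact_rtree_limit i).1 gT (gh_sigma i).
exists (@subtree_val _ _ _ _ \o f); split.
- by move=> a b _ _ /=; rewrite subtree_val_isometric// fI.
- by rewrite /= f0.
- by rewrite -(image_comp f) fr range_subtree_val.
Qed.

Lemma phi_Tstar_embeds i (tau : nat -> pmetricType R) :
  (forall j, embeds_onto (tau j) (limit_tree beta (subfamily x (rcons i j)) setT)) ->
  embeds_onto (phi beta (x i) tau) (limit_tree beta (subfamily x i) setT).
Proof.
move=> h; apply: (phi_embeds (subfamily_nil x i)) => // j.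
by rewrite subfamily_rcons; exact: h.
Qed.

Lemma Tstar_embeds i :
  embeds_onto (Tstar beta x i) (limit_tree beta (subfamily x i) setT).
Proof.
case: i => [|j i]; last exact: gh_limit_embeds.
by apply: phi_Tstar_embeds => j; exact: gh_limit_embeds.
Qed.

Lemma Tstar_recursive i : rooted_isometric (Tstar beta x i)
  (phi beta (x i) (fun j => Tstar beta x (rcons i j))).
Proof.
have [f [fI f0 fr]] := Tstar_embeds i.
have [g [gI g0 gr]] := phi_Tstar_embeds (i := i) (fun j => Tstar_embeds (rcons i j)).
exact: rooted_isometric_common_image fI gI f0 g0 (etrans fr (esym gr)).
Qed.

End family.
End recursive_embedding.

(** * The mass measure *)

Section laws_of_maps.
Context {R : realType}.

(** A totalised push-forward: the Dirac mass stands in for maps that are not measurable, so that the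
    term carries no proof of measurability. *)
Definition law d d' (E : measurableType d) (E' : measurableType d')
    (P : probability E R) (X : E -> E') : probability E' R :=
  if pselect (measurable_fun setT X) is left mX
  then distribution P (mfun_Sub (mem_set mX)) else \d_(point : E').

Lemma lawE d d' (E : measurableType d) (E' : measurableType d')
    (P : probability E R) (X : E -> E') A :
  measurable_fun setT X -> law P X A = P (X @^-1` A).
Proof. by rewrite /law; case: pselect. Qed.

Lemma measurable_fun_borel d (E : measurableType d) (M : pmetricType R)
    (X : E -> borel M) :
  (forall O : set M, open O -> measurable (X @^-1` O)) -> measurable_fun setT X.
Proof.
move=> h.
have H : preimage_set_system setT X (@open M) `<=` measurable; last first.
  exact: (@measurability _ _ E (borel M) setT X (@open M) erefl H).
move=> _ [V oV <-].
by rewrite setTI; exact: h.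
Qed.

Lemma borel_open (M : pmetricType R) (O : set M) : open O -> borel_set O.
Proof. by move=> oO; apply: sub_gen_smallest. Qed.

Lemma borel_closed (M : pmetricType R) (K : set M) : closed K -> borel_set K.
Proof.
move=> cK; rewrite -[K]setCK; apply: (@measurableC _ (borel M)).
by apply: borel_open; exact: closed_openC.
Qed.

Lemma measure_full d (E : measurableType d) (P : probability E R) (K A : set E) :
  measurable K -> measurable A -> P K = 1%E -> P (K `&` A) = P A.
Proof.
move=> mK mA K1; rewrite setIC (measureDI P mA mK).
have zK : P (~` K) = 0%E by rewrite probability_setC// K1 subee.
suff z : P (A `\` K) = 0%E.
  by rewrite -[LHS]add0e; congr (_ + _)%E; exact: esym.
apply: (@subset_measure0 _ _ _ P _ (~` K)) => //.
- exact: measurableD.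
- exact: measurableC.
Qed.

Section transfer.
Variables (S M : pmetricType R) (K : set M) (f : S -> M).
Variable mu : probability (borel M) R.
Hypotheses (fI : isometric_on setT f) (f0 : f point = point) (fr : range f = K).
Hypotheses (cK : closed K) (muK : mu K = 1%E).

(** On [K], the preimage of an open [O] is the trace of the open set [O'], a union of balls of [M]
    that copy balls of [S] contained in [O]. Off [K], the inverse is the constant [point]. *)
Lemma isometry_inv_measurable :
  measurable_fun setT (isometry_inv f : borel M -> borel S).
Proof.
apply: measurable_fun_borel => O oO.
pose O' : set M := [set y | exists x e, [/\ 0 < e,
   (forall x', mdist x x' < e -> O x') & mdist (f x) y < e]].
have oO' : open O'.
  rewrite (_ : O' = \bigcup_(p in [set p : S * R | 0 < p.2 /\
      forall x', mdist p.1 x' < p.2 -> O x']) thickening [set f p.1] p.2).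
    by apply: bigcup_open => p _; exact: open_thickening.
  apply/seteqP; split=> [y [x [e [e0 h xy]]]|y [[x e] [/= e0 h] [_ -> xy]]].
    by exists (x, e) => //; exists (f x).
  by exists x, e.
have E : isometry_inv f @^-1` O = (K `&` O') `|`
    (~` K `&` [set _ | O (point : S)]).
  apply/seteqP; split=> [y /= Oy|y].
    have [Ky|nKy] := pselect (K y); last first.
      right; split=> //=; move: Oy; rewrite /isometry_inv; case: pselect => //.
      by move=> [x xy] _; exfalso; apply: nKy; rewrite -fr; exists x.
    left; split=> //; move: Ky Oy; rewrite -fr => -[x _ <-].
    rewrite isometry_invK// => Ox.
    have /metricType_numDomainType.nbhs_mdistP[e /= e0 he] := open_nbhs_nbhs (conj oO Ox).
    exists x, e; split=> //; last by rewrite mdistxx.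
  case=> [[]|[nKy /= O0]].
    rewrite -{1}fr => -[x _ <-] [x' [e [e0 h]]]; rewrite fI// => xx'.
    by rewrite /= isometry_invK//; exact: h.
  rewrite /isometry_inv; case: pselect => // -[x xy]; exfalso; apply: nKy.
  by rewrite -fr; exists x.
rewrite E; apply: (@measurableU _ (borel M)); apply: (@measurableI _ (borel M)).
- exact: borel_closed.
- exact: borel_open.
- by apply: (@measurableC _ (borel M)); exact: borel_closed.
- have [h|h] := pselect (O (point : S)).
    rewrite (_ : [set _ | _] = setT); first exact: (@measurableT _ (borel M)).
    by apply/seteqP; split.
  rewrite (_ : [set _ | _] = set0); first exact: (@measurable0 _ (borel M)).
  by apply/seteqP; split.
Qed.

Definition pullback_measure : probability (borel S) R :=
  law mu (isometry_inv f : borel M -> borel S).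

Lemma pullback_measureE A : borel_set A ->
  push_on setT f pullback_measure A = mu A.
Proof.
move=> bA; rewrite /push_on setTI lawE; last exact: isometry_inv_measurable.
have mK : measurable (K : set (borel M)) by exact: borel_closed.
have mA' : measurable ((isometry_inv f : borel M -> borel S) @^-1` (f @^-1` A)).
  rewrite -[X in measurable X]setTI; apply: isometry_inv_measurable => //.
  have /(_ measurableT A bA) : measurable_fun setT (f : borel S -> borel M).
    apply: measurable_fun_borel => O oO; apply: borel_open.
    move: oO; apply: open_comp => x _; apply: filter_cvg_mdist => e e0.
    by apply: filterS (nbhs_mdist x e0) => y xy /=; rewrite fI.
  by rewrite setTI.
rewrite -(measure_full mK mA' muK) -(measure_full mK bA muK); congr (mu _).
apply/seteqP; split=> y [Ky /= h]; split=> //; move: Ky h; rewrite -fr => -[x _ <-];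
  by rewrite /= isometry_invK.
Qed.

Lemma pullback_weighted_isometric :
  weighted_isometric (WeightedSpace setT pullback_measure) (WeightedSpace K mu).
Proof.
exists f; split=> //= A.
exact: pullback_measureE.
Qed.

(** [M] itself serves as the common space, with [id] and [f] as embeddings. *)
Lemma ghp_dist_pullback (L : set M) (nu : probability (borel M) R) :
  closed L -> nu L = 1%E ->
  (ghp_dist (WeightedSpace L nu) (WeightedSpace setT pullback_measure) <=
   hp_dist (L, nu) (K, mu))%E.
Proof.
move=> cL nuL; apply: ereal_inf_lbound; exists M, id, f; split=> //=.
rewrite f0 mdistxx image_id fr [RHS]max_r; last first.
  by rewrite le_max hausdorff_dist_ge0.
rewrite /hp_dist /=; congr (maxe _ _); congr ereal_inf; congr image.
have E1 A : borel_set A -> push_on L id nu A = nu A.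
  move=> bA; rewrite /push_on preimage_id measure_full//; exact: borel_closed.
apply/seteqP; split=> e [e0 h]; split=> // A bA; have [h1 h2] := h A bA;
  have bt := borel_thickening A e; move: h1 h2;
  by rewrite !E1// !pullback_measureE.
Qed.

Lemma ghp_dist_ge0 (U V : @weighted_space R) : (0 <= ghp_dist U V)%E.
Proof.
apply: le_ereal_inf_tmp => _ [Z [g [h [_ _ ->]]]].
by rewrite le_max lee_fin mdist_ge0.
Qed.

End transfer.

End laws_of_maps.

Section uniform_law.
Context {R : realType}.

Definition unif01 : set R -> \bar R :=
  mrestr (@lebesgue_measure R) (measurable_itv `[0, 1[).

Let unif01_0 : unif01 set0 = 0%E.
Proof. exact: (measure0 (mrestr (@lebesgue_measure R) (measurable_itv `[0, 1[))). Qed.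

Let unif01_ge0 A : (0 <= unif01 A)%E.
Proof. exact: (measure_ge0 (mrestr (@lebesgue_measure R) (measurable_itv `[0, 1[))). Qed.

Let unif01_sigma : semi_sigma_additive unif01.
Proof.
exact: (@measure_semi_sigma_additive _ _ _
  (mrestr (@lebesgue_measure R) (measurable_itv `[0, 1[))).
Qed.

HB.instance Definition _ :=
  isMeasure.Build _ _ R unif01 unif01_0 unif01_ge0 unif01_sigma.

Lemma unif01_setT : unif01 setT = 1%E.
Proof.
by rewrite /unif01 /mrestr setTI lebesgue_measure_itv/= lte01 sube0.
Qed.

HB.instance Definition _ := @Measure_isProbability.Build _ _ R unif01 unif01_setT.

Lemma unif01_itv (a b : R) : 0 <= a -> a <= b -> b <= 1 ->
  unif01 `[a, b[%classic = (b - a)%:E.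
Proof.
move=> a0 ab b1; rewrite /unif01 /mrestr setIidl; last first.
  move=> t; rewrite /= !in_itv/= => /andP[? ?]; apply/andP; split; lra.
rewrite lebesgue_measure_itv/= lte_fin; move: ab; rewrite le_eqVlt.
by case/predU1P => [->|->]; rewrite ?ltxx ?subrr// -EFinB.
Qed.

Lemma unif01_set1 (a : R) : unif01 [set a] = 0%E.
Proof.
apply/eqP; rewrite -measure_le0 -(lebesgue_measure_set1 a) /unif01 /mrestr.
by apply: le_measure; rewrite ?inE//; exact: measurableI.
Qed.

End uniform_law.

(** * Countably valued approximations *)

Section discrete_measurability.
Context d (E : measurableType d) {R : realType}.

(** With a countable target, measurable fibres make the preimage of every set measurable.
    Approximations of trees and measures can then be handled through codes, with no sigma-algebra on
    the space of weighted trees. *)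
Definition measurable_code (T : Type) (c : E -> T) :=
  forall v, measurable [set t | c t = v].

Lemma measurable_code_preimage (T : countType) (c : E -> T) (A : set T) :
  measurable_code c -> measurable (c @^-1` A).
Proof.
move=> mc; rewrite (_ : _ @^-1` _ = \bigcup_v
    (if v \in A then [set t | c t = v] else set0)); last first.
  apply/seteqP; split=> [t At|t [v _]]; last first.
    by case: ifPn => // /set_mem Av /= ctv; rewrite /= ctv.
  by exists (c t) => //; rewrite mem_set.
apply: countable_bigcupT_measurable; first exact: countableP.
by move=> v; case: ifP.
Qed.

Lemma measurable_code_mkseq (T : Type) (c : nat -> E -> T) N :
  (forall i, measurable_code (c i)) ->
  measurable_code (fun t => mkseq (c^~ t) N).
Proof.
move=> mc; elim: N => [|N IH] v.
  case: v => [|a v]; last by rewrite (_ : [set _ | _] = set0)//; apply/seteqP; split.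
  by rewrite (_ : [set _ | _] = setT)//; apply/seteqP; split.
case/lastP: v => [|v a].
  by rewrite (_ : [set _ | _] = set0)//; apply/seteqP; split.
rewrite (_ : [set _ | _] = [set t | mkseq (c^~ t) N = v] `&` [set t | c N t = a]).
  by apply: measurableI; [exact: IH|exact: mc].
apply/seteqP; split=> t /=; rewrite /mkseq -addn1 iotaD map_cat /= cats1.
  by move/rcons_inj => [-> ->].
by move=> [-> ->].
Qed.

Lemma measurable_code_truncn (f : E -> R) : measurable_fun setT f ->
  measurable_code (fun t => Num.truncn (f t)).
Proof.
move=> mf n.
have mlt (a : R) : measurable [set t | f t < a].
  rewrite (_ : [set _ | _] = setT `&` f @^-1` `]-oo, a[%classic); first exact: mf.
  by rewrite setTI; apply/seteqP; split=> t /=; rewrite in_itv.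
case: n => [|n].
  rewrite (_ : [set _ | _] = [set t | f t < 1%:R])//.
  apply/seteqP; split=> t /=; rewrite -(truncn_le_nat _ 0) leqn0; first by move=> ->.
  by move/eqP.
rewrite (_ : [set _ | _] = [set t | f t < n.+2%:R] `\` [set t | f t < n.+1%:R]).
  exact: measurableD.
apply/seteqP; split=> t /=; rewrite -!truncn_le_nat.
  by move=> ->; rewrite ltnn.
by move=> [h1 /negP]; rewrite -ltnNge => h2; apply/eqP; rewrite eqn_leq h1.
Qed.

End discrete_measurability.

Section measurable_limits.
Context {R : realType} (X : Type) (dist : X -> X -> \bar R).
Hypothesis distC : forall a b, dist a b = dist b a.
Hypothesis dist_triangle : forall b a c, (dist a c <= dist a b + dist b c)%E.

Definition dist_open (O : set X) :=
  forall a, O a -> exists2 e : R, 0 < e & forall b, (dist a b < e%:E)%E -> O b.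

(* [F t] is in the open set [O] if and only if some ball of radius 1/(k+1)
   around [F_ n t] is, with room to spare, contained in [O] for large [n]. *)
Lemma measurable_dist_limit d (E : measurableType d) (F_ : nat -> E -> X)
    (F : E -> X) :
  (forall n O, dist_open O -> measurable (F_ n @^-1` O)) ->
  (forall t (e : R), 0 < e -> \forall n \near \oo, (dist (F t) (F_ n t) < e%:E)%E) ->
  forall O, dist_open O -> measurable (F @^-1` O).
Proof.
move=> mF FF O oO.
pose Ok (q : R) := [set a | exists2 r : R, q < r &
  forall b, (dist a b < r%:E)%E -> O b].
have oOk q : dist_open (Ok q).
  move=> a [r kr hr]; exists ((r - q) / 2); first by rewrite divr_gt0// subr_gt0.
  move=> b ab; exists ((r + q) / 2); first by move: kr; lra.
  move=> c bc; apply: hr; apply: (le_lt_trans (dist_triangle b a c)).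
  rewrite (_ : r = (r - q) / 2 + (r + q) / 2); last by lra.
  by rewrite EFinD lteD.
rewrite (_ : F @^-1` O = \bigcup_k \bigcup_N \bigcap_(n in [set n | (N <= n)%N])
    (F_ n @^-1` Ok k.+1%:R^-1)).
  apply: bigcupT_measurable => k; apply: bigcupT_measurable => N.
  by apply: bigcap_measurable => [|n _]; [exists N => /=|apply: mF].
apply/seteqP; split=> [t /= /oO[e e0 he]|t [k _ [N _ h]]].
  have e2 : 0 < e / 2 by rewrite divr_gt0.
  have [k /= ke] : exists k : nat, k.+1%:R^-1 < e / 2.
    by have /ltr_add_invr[k] := e2; rewrite add0r; exists k.
  have [N _ hN] := FF t _ e2; exists k => //; exists N => // n Nn.
  exists (e / 2) => // b nb; apply: he.
  apply: (le_lt_trans (dist_triangle (F_ n t) _ b)).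
  by rewrite [X in (_ < X%:E)%E](splitr e) EFinD lteD//; exact: hN.
have k0 : (0 : R) < k.+1%:R^-1 by rewrite invr_gt0.
have [N' _ hN'] := FF t _ k0.
have [r kr hr] := h (maxn N N') (leq_maxl _ _).
apply: hr; rewrite distC; apply: (lt_trans (hN' _ (leq_maxr _ _))).
by rewrite lte_fin.
Qed.

End measurable_limits.

Section l1_rounding.
Context {R : realType}.

Definition round_code (N : nat) (f : seq nat -> R) : seq nat :=
  mkseq (fun k => if unpickle k is Some u then Num.truncn (f u * N.+1%:R) else 0%N) N.

Definition round_fun (N : nat) (v : seq nat) (u : seq nat) : R :=
  if (pickle u < N)%N then (nth 0%N v (pickle u))%:R / N.+1%:R else 0.

Lemma round_fun_l1 N v : in_l1 (round_fun N v).
Proof.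
have r0 u : 0 <= round_fun N v u.
  by rewrite /round_fun; case: ifP => // _; rewrite divr_ge0.
split=> //.
pose W := pmap (fun k => unpickle k : option (seq nat)) (iota 0 N).
apply: (le_lt_trans (esum_split_seq W r0)).
rewrite esum1 ?adde0 ?ltry// => u /= uW; rewrite /round_fun; case: ifPn => // uN.
move: uW; rewrite mem_pmap; move/negP; case.
by apply/mapP; exists (pickle u); rewrite ?mem_iota// pickleK.
Qed.

Definition round_pt N v : l1U R := L1U (round_fun_l1 N v).

Definition round_l1 N (f : l1U R) : l1U R := round_pt N (round_code N f).

Lemma round_l1E N (f : l1U R) u : round_l1 N f u =
  if (pickle u < N)%N then (Num.truncn (f u * N.+1%:R))%:R / N.+1%:R else 0.
Proof.
rewrite /round_l1 /= /round_fun; case: ifP => // uN.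
by rewrite nth_mkseq// pickleK.
Qed.

Lemma round_l1_bound N (f : l1U R) u :
  0 <= f u - round_l1 N f u <= f u /\
  ((pickle u < N)%N -> f u - round_l1 N f u <= N.+1%:R^-1).
Proof.
rewrite round_l1E; have f0 := l1_ge0 f u; case: ifP => _; last first.
  by split=> //; rewrite subr0 f0 lexx.
have N0 : (0 : R) < N.+1%:R by [].
have /truncn_itv/andP[h1 h2] : 0 <= f u * N.+1%:R by rewrite mulr_ge0.
have k1 : (Num.truncn (f u * N.+1%:R))%:R / N.+1%:R <= f u.
  by rewrite ler_pdivrMr.
have k2 : f u <= (Num.truncn (f u * N.+1%:R))%:R / N.+1%:R + N.+1%:R^-1.
  by rewrite -[X in _ + X]mul1r -mulrDl ler_pdivlMr// natr1 ltW.
have k3 : 0 <= (Num.truncn (f u * N.+1%:R))%:R / N.+1%:R :> R by rewrite divr_ge0.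
move: k1 k2 k3; set a := (Num.truncn _)%:R / _; set b := N.+1%:R^-1 => k1 k2 k3.
split=> [|_]; last by lra.
by apply/andP; split; lra.
Qed.

Lemma round_l1_dist_le (W : seq (seq nat)) N (f : l1U R) :
  (forall u, u \in W -> (pickle u < N)%N) ->
  ((mdist f (round_l1 N f))%:E <= ((size W)%:R / N.+1%:R)%:E +
    \esum_(u in [set u | u \notin W]) (f u)%:E)%E.
Proof.
move=> WN; rewrite l1_mdistE.
apply: (le_trans (esum_split_seq W (fun u => normr_ge0 (f u - round_l1 N f u)))).
apply: leeD.
  rewrite lee_fin; elim: W WN => [|w W IH] WN; first by rewrite big_nil mul0r.
  rewrite big_cons /= -natr1 mulrDl mul1r addrC; apply: lerD.
    by apply: IH => u uW; apply: WN; rewrite inE uW orbT.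
  have [/andP[h _] /(_ (WN w (mem_head _ _)))] := round_l1_bound N f w.
  by rewrite ger0_norm.
apply: le_esum => u _; rewrite lee_fin.
by have [/andP[h h' _]] := round_l1_bound N f u; rewrite ger0_norm.
Qed.

(** [N] depends on [W] and [e] but not on [f], so that on a tight tree one resolution serves all
    points. One [e] pays for the words of [W], the other for the remaining words. *)
Lemma round_l1_near (W : seq (seq nat)) (e : R) : 0 < e ->
  \forall N \near \oo, forall f : l1U R,
    (\esum_(u in [set u | u \notin W]) (f u)%:E <= e%:E)%E ->
    mdist f (round_l1 N f) < 2 * e.
Proof.
move=> e0.
have e1 : 0 < e / (size W).+1%:R by rewrite divr_gt0.
have h1 : \forall N \near \oo, N.+1%:R^-1 < e / (size W).+1%:R.
  exact: near_infty_natSinv_lt (PosNum e1).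
have h2 : \forall N \near \oo, (\max_(u <- W) (pickle u).+1 <= N)%N.
  by exists (\max_(u <- W) (pickle u).+1)%N.
apply: filterS (filterI h1 h2) => N [N1 N2] f hf.
rewrite -lte_fin; apply: (@le_lt_trans _ _ (((size W)%:R / N.+1%:R)%:E +
    \esum_(u in [set u | u \notin W]) (f u)%:E)%E).
  apply: round_l1_dist_le => u uW; apply: leq_trans N2.
  by apply: (@leq_bigmax_seq _ W xpredT (fun u => (pickle u).+1)) uW _.
rewrite (_ : 2 * e = e + e); last by lra.
apply: (le_lt_trans (leeD2l _ hf)); rewrite -EFinD lte_fin ltrD2r.
have [->|s0] := posnP (size W); first by rewrite mul0r.
apply: (@lt_le_trans _ _ ((size W)%:R * (e / (size W).+1%:R))).
  by rewrite ltr_pM2l// ltr0n.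
rewrite mulrCA ler_piMr ?(ltW e0)// ler_pdivrMr// mul1r ler_nat//.
Qed.

Lemma l1_tight (f : l1U R) (e : R) : 0 < e -> exists W : seq (seq nat),
  (\esum_(u in [set u | u \notin W]) (f u)%:E <= e%:E)%E.
Proof.
move=> e0; have ff := l1_sum_fin f.
have f0 u : (0 <= (f u)%:E)%E by rewrite lee_fin l1_ge0.
have [_ [X [fX _] <-] hX] := ub_ereal_sup_adherent e0 ff.
exists (finmap.enum_fset (fset_set X)).
have E : (\esum_(u in setT) (f u)%:E = \sum_(u \in X) (f u)%:E +
    \esum_(u in ~` X) (f u)%:E)%E.
  by rewrite (esumID X)// !setTI esum_fset.
rewrite [X in (X <= _)%E](_ : _ = \esum_(u in ~` X) (f u)%:E)%E; last first.
  congr esum; apply/seteqP; split=> u /= nu.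
    by move=> Xu; move/negP : nu; apply; have := in_fset_set fX u; rewrite mem_set.
  by apply/negP; have -> := in_fset_set fX u; move/set_mem.
have fXf : (\sum_(u \in X) (f u)%:E)%E \is a fin_num by rewrite fsumEFin.
move: hX; rewrite -[ereal_sup _]/(\esum_(u in setT) (f u)%:E)%E E => hX.
rewrite leNgt; apply/negP => h'; move: hX; apply/negP.
by rewrite -leNgt leeBrDr// leeD2l// ltW.
Qed.

Lemma round_l1_cvg (f : l1U R) (e : R) : 0 < e ->
  \forall N \near \oo, mdist f (round_l1 N f) < e.
Proof.
move=> e0; have e2 : 0 < e / 2 by rewrite divr_gt0.
have [W hW] := l1_tight f e2; have := round_l1_near W e2.
by apply: filterS => N /(_ f hW); rewrite mulrC divfK.
Qed.

Lemma measurable_round_code d (E : measurableType d) (f : E -> l1U R) N :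
  (forall u, measurable_fun setT (fun t => f t u)) ->
  measurable_code (fun t => round_code N (f t)).
Proof.
move=> mf; apply: (measurable_code_mkseq (c := fun k t =>
  if unpickle k is Some u then Num.truncn (f t u * N.+1%:R) else 0%N)) => k.
case: (unpickle k) => [u|v]; first by apply: measurable_code_truncn;
  apply: measurable_funM => //; exact: mf.
have [->|v0] := eqVneq v 0%N.
  by rewrite (_ : [set _ | _] = setT)//; apply/seteqP; split.
rewrite (_ : [set _ | _] = set0)//; apply/seteqP; split=> // t /= e.
by rewrite -e in v0.
Qed.

(* [l1U] is separable: coordinatewise measurable maps are Borel. *)
Lemma measurable_fun_l1 d (E : measurableType d) (f : E -> l1U R) :
  (forall u, measurable_fun setT (fun t => f t u)) ->
  measurable_fun setT (f : E -> borel (l1U R)).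
Proof.
move=> mf; apply: measurable_fun_borel => O oO.
apply: (@measurable_dist_limit R (l1U R) (fun a b => (mdist a b)%:E) _ _ _ _
  (fun N t => round_l1 N (f t))).
- by move=> a b; rewrite metric_sym.
- by move=> b a c; rewrite -EFinD lee_fin metric_triangle.
- move=> N V _; apply: (@measurable_code_preimage _ _ _ (fun t => round_code N (f t))
    [set v | V (round_pt N v)]).
  exact: measurable_round_code.
- by move=> t e e0; apply: filterS (round_l1_cvg (f t) e0) => N; rewrite lte_fin.
- move=> a Oa; have /metricType_numDomainType.nbhs_mdistP[e /= e0 he] :=
    open_nbhs_nbhs (conj oO Oa).
  by exists e => // b; rewrite lte_fin; exact: he.
Qed.

End l1_rounding.

(** * Coding of infinite words by nested intervals *)

Section cells.
Context {R : realType} (x : seq nat -> beads R).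
Implicit Types (u v w : seq nat) (s : R).

Definition cumul (b : beads R) j : R := \sum_(i < j) mass b i.

Lemma cumulS b j : cumul b j.+1 = cumul b j + mass b j.
Proof. by rewrite /cumul big_ord_recr. Qed.

Lemma cumul0 b : cumul b 0 = 0. Proof. by rewrite /cumul big_ord0. Qed.

Lemma cumul_homo b : {homo cumul b : i j / (i <= j)%N >-> i <= j}.
Proof.
by apply: homo_leq => [j|i j k|j]; [exact: lexx|exact: le_trans|
  rewrite cumulS lerDl mass_ge0].
Qed.

Lemma cumul_ge0 b j : 0 <= cumul b j.
Proof. by rewrite -(cumul0 b) cumul_homo. Qed.

Lemma cumul_le1 b j : cumul b j <= 1.
Proof.
rewrite -lee_fin -(mass_sum b) /cumul -sumEFin -(big_mkord xpredT (fun i => (mass b i)%:E)).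
by apply: nneseries_lim_ge => i _; rewrite lee_fin mass_ge0.
Qed.

Lemma cumul_gt b (t : R) : t < 1 -> exists j, t < cumul b j.
Proof.
move=> t1; apply: contrapT => nt.
have h j : cumul b j <= t by rewrite leNgt; apply/negP => h; apply: nt; exists j.
have : (1 <= t%:E)%E; last by rewrite lee_fin leNgt t1.
rewrite -(mass_sum b); apply: lime_le.
  by apply: is_cvg_nneseries => i _ _; rewrite lee_fin mass_ge0.
apply: nearW => n; rewrite sumEFin lee_fin big_mkord; exact: h.
Qed.

Definition left_end u : R :=
  \sum_(k < size u) checkP x (take k u) * cumul (x (take k u)) (nth 0%N u k).

Definition cell u : set R := `[left_end u, left_end u + checkP x u[%classic.

Lemma left_end_rcons u j :
  left_end (rcons u j) = left_end u + checkP x u * cumul (x u) j.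
Proof.
rewrite /left_end size_rcons big_ord_recr /=; congr (_ + _).
  apply: eq_bigr => k _; rewrite nth_rcons ltn_ord -cats1 takel_cat//.
  exact/ltnW/ltn_ord.
by rewrite nth_rcons ltnn eqxx -cats1 take_size_cat.
Qed.

Lemma cell_rconsE u j s : cell (rcons u j) s =
  (left_end u + checkP x u * cumul (x u) j <= s <
   left_end u + checkP x u * cumul (x u) j.+1) :> Prop.
Proof.
by rewrite /cell /= in_itv /= left_end_rcons checkP_rcons cumulS mulrDr addrA.
Qed.

Lemma cellE u s : cell u s = (left_end u <= s < left_end u + checkP x u) :> Prop.
Proof. by rewrite /cell /= in_itv. Qed.

Lemma sub_cell_rcons u j : cell (rcons u j) `<=` cell u.
Proof.
move=> s; rewrite cell_rconsE cellE => /andP[h1 h2]; apply/andP; split.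
  by apply: le_trans h1; rewrite lerDl mulr_ge0 ?checkP_ge0 ?cumul_ge0.
apply: (lt_le_trans h2); rewrite lerD2l.
by rewrite ler_piMr ?checkP_ge0 ?cumul_le1.
Qed.

Lemma sub_cell_cat u v : cell (u ++ v) `<=` cell u.
Proof.
elim/last_ind: v => [|v j IH]; first by rewrite cats0.
rewrite -rcons_cat; exact: subset_trans (@sub_cell_rcons _ _) IH.
Qed.

Lemma cell_letter_inj u j k s : cell (rcons u j) s -> cell (rcons u k) s -> j = k.
Proof.
have lt i i' : (i < i')%N -> cell (rcons u i) s -> ~ cell (rcons u i') s.
  move=> ii'; rewrite !cell_rconsE => /andP[_ h] /andP[h' _].
  have := le_lt_trans h' h; rewrite ltrD2l ltNge => /negP; apply.
  by rewrite ler_wpM2l ?checkP_ge0// cumul_homo.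
move=> hj hk; apply/eqP; rewrite eqn_leq; apply/andP; split; rewrite leqNgt;
  by apply/negP => /lt; apply.
Qed.

Lemma cell_chain u v s : cell u s -> cell v s -> prefix u v || prefix v u.
Proof.
move=> us vs; have [->//|->|[p [j [k [u' [v' [jk eu ev]]]]]]] := branching_words u v.
  by rewrite orbT.
exfalso; apply: jk; apply: (@cell_letter_inj p _ _ s).
  by apply: (@sub_cell_cat _ u'); rewrite cat_rcons -eu.
by apply: (@sub_cell_cat _ v'); rewrite cat_rcons -ev.
Qed.

Lemma cell_split u s : cell u s -> exists j, cell (rcons u j) s.
Proof.
rewrite cellE => /andP[h1 h2].
have P0 : 0 < checkP x u by move: (le_lt_trans h1 h2); rewrite ltrDl.
pose t := (s - left_end u) / checkP x u.
have t1 : t < 1 by rewrite ltr_pdivrMr// mul1r ltrBlDl.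
have t0 : 0 <= t by rewrite divr_ge0 ?subr_ge0// ltW.
have exj : exists j, t < cumul (x u) j by exact: cumul_gt.
(* The letter is the predecessor of the least index whose cumulated mass exceeds the relative
   position [t]; index 0 is ruled out by [cumul0]. *)
case: (ex_minnP exj) => -[|j] tj jmin.
  by move: tj; rewrite cumul0 ltNge t0.
exists j; rewrite cell_rconsE -lerBrDl -ltrBlDl [checkP x u * _]mulrC.
rewrite -ler_pdivlMr// [checkP x u * _]mulrC -ltr_pdivrMr// -/t tj andbT.
by rewrite leNgt; apply/negP => /jmin; rewrite ltnn.
Qed.

Lemma cell_root s : 0 <= s < 1 -> cell [::] s.
Proof. by rewrite cellE /left_end big_ord0 checkP_nil add0r. Qed.

Lemma cell_level n s : 0 <= s < 1 -> exists2 u, size u = n & cell u s.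
Proof.
move=> s01; elim: n => [|n [u un /cell_split[j uj]]].
  by exists [::] => //; exact: cell_root.
by exists (rcons u j) => //; rewrite size_rcons un.
Qed.

Lemma cell_bounds u : 0 <= left_end u /\ left_end u + checkP x u <= 1.
Proof.
elim/last_ind: u => [|u j [IH1 IH2]].
  by rewrite /left_end big_ord0 checkP_nil add0r.
rewrite left_end_rcons checkP_rcons; split.
  by rewrite addr_ge0 ?mulr_ge0 ?checkP_ge0 ?cumul_ge0.
rewrite -addrA -mulrDr -cumulS; apply: le_trans IH2; rewrite lerD2l.
by rewrite ler_piMr ?checkP_ge0 ?cumul_le1.
Qed.

Lemma unif01_cell u : unif01 (cell u) = (checkP x u)%:E.
Proof.
have [h1 h2] := cell_bounds u; rewrite unif01_itv//; last first.
  by rewrite lerDl checkP_ge0.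
by congr EFin; lra.
Qed.

Lemma measurable_cell u : measurable (cell u).
Proof. exact: measurable_itv. Qed.

End cells.

Section limit_points.
Context {R : realType} (beta : R) (x : seq nat -> beads R).
Hypothesis tx : tight_tree beta x.
Implicit Types (u v w : seq nat) (s : R).

(* The point of the boundary of the tree coded by [s]: the nested cells
   containing [s] spell an infinite word. *)
Definition limit_fun s u : R :=
  if pselect (exists j, cell x (rcons u j) s) is left h
  then branch_pos beta x u (projT1 (cid h)) else 0.

Lemma limit_fun_cell s u j : cell x (rcons u j) s ->
  limit_fun s u = branch_pos beta x u j.
Proof.
move=> uj; rewrite /limit_fun; case: pselect => [h|[]]; last by exists j.
by congr branch_pos; case: cid => k /= uk; exact: cell_letter_inj uk uj.
Qed.

Lemma limit_fun_eq0 s u : (forall j, ~ cell x (rcons u j) s) -> limit_fun s u = 0.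
Proof.
move=> h; rewrite /limit_fun; case: pselect => // hj; exfalso.
by case: hj => j; exact: h.
Qed.

Lemma limit_fun_tree s : tree_fun beta x (limit_fun s).
Proof.
split=> [u|u j v].
  have [[j uj]|nu] := pselect (exists j, cell x (rcons u j) s).
    by rewrite (limit_fun_cell uj); exact: branch_pos_ge0.
  rewrite limit_fun_eq0 ?lexx ?seg_len_ge0// => j uj; apply: nu; by exists j.
have [[k wk] _|nw] := pselect (exists k, cell x (rcons (u ++ j :: v) k) s); last first.
  by rewrite limit_fun_eq0 ?ltxx// => k wk; apply: nw; exists k.
apply: limit_fun_cell; apply: (@sub_cell_cat _ _ _ (rcons v k)).
by rewrite cat_rcons -rcons_cons -rcons_cat.
Qed.

Definition limit_point s : l1U R := L1U (tight_in_l1 tx (limit_fun_tree s)).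

Lemma limit_point_tree s : limit_tree beta x setT (limit_point s).
Proof. by split; [exact: limit_fun_tree|move=> u []]. Qed.

(** The coupling behind the mass measure: on the cell of [rcons i j], whose length is the mass of
    the atom, truncation yields exactly that atom. By [cell_chain], up to this depth only [i] and
    its prefixes can have a nonzero coordinate. *)
Lemma trunc_limit_point s i j : cell x (rcons i j) s ->
  l1_trunc (size i) (limit_point s) = emb_point beta (bead (x i) j).
Proof.
move=> ij; apply: l1_ext => w; rewrite emb_point_eval.
rewrite -[l1_fun _ w]/(trunc_fun (size i) (limit_fun s) w) /trunc_fun.
case: eqP => [->|/eqP wi]; first by rewrite leqnn (limit_fun_cell ij).
case: ifPn => wn; last first.
  by case: ifPn => // /size_prefix; rewrite (negbTE wn).
case: ifPn => [/prefixP[[|k v] e]|nwi].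
- by rewrite e cats0 eqxx in wi.
- rewrite e nth_cat ltnn subnn /=; apply: limit_fun_cell.
  apply: (@sub_cell_cat _ _ _ (rcons v j)).
  by rewrite cat_rcons -rcons_cons -rcons_cat -e.
- apply: limit_fun_eq0 => k wk.
  have [/prefixP[v]|/prefixP[v]] := orP (cell_chain ij wk).
    rewrite cat_rcons; case/lastP: v => [|v a].
      by rewrite cats1 => /rcons_inj[e _]; rewrite e eqxx in wi.
    rewrite -rcons_cons -rcons_cat => /rcons_inj[e _].
    by move: wn; rewrite e size_cat /= addnS leqNgt ltnS leq_addr.
  rewrite cat_rcons; case/lastP: v => [|v a].
    by rewrite cats1 => /rcons_inj[e _]; rewrite e eqxx in wi.
  rewrite -rcons_cons -rcons_cat => /rcons_inj[e _].
  by move: nwi; rewrite e prefix_prefix.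
Qed.

Lemma measurable_limit_fun u : measurable_fun setT (fun s => limit_fun s u).
Proof.
move=> _ B mB; rewrite setTI.
pose C := \bigcup_j cell x (rcons u j).
have mC : measurable C.
  by apply: bigcupT_measurable => j; exact: measurable_cell.
rewrite (_ : _ @^-1` _ = \bigcup_j (cell x (rcons u j) `&`
    [set _ | B (branch_pos beta x u j)]) `|` (~` C `&` [set _ | B 0])).
  have mconst (Q : Prop) : measurable [set _ : R | Q].
    have [q|q] := pselect Q.
      by rewrite (_ : [set _ | _] = setT)//; apply/seteqP; split.
    by rewrite (_ : [set _ | _] = set0)//; apply/seteqP; split.
  apply: measurableU; last by apply: measurableI => //; exact: measurableC.
  apply: bigcupT_measurable => j.
  by apply: measurableI => //; exact: measurable_cell.
apply/seteqP; split=> s /=.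
  have [[j uj]|nu] := pselect (exists j, cell x (rcons u j) s).
    by rewrite (limit_fun_cell uj) => Bj; left; exists j.
  rewrite limit_fun_eq0 => [B0|j uj]; last by apply: nu; exists j.
  by right; split=> // -[j _ uj]; apply: nu; exists j.
case=> [[j _ [uj Bj]]|[nC B0]]; first by rewrite /= (limit_fun_cell uj).
by rewrite /= limit_fun_eq0// => j uj; apply: nC; exists j.
Qed.

Lemma measurable_limit_point :
  measurable_fun setT (limit_point : R -> borel (l1U R)).
Proof. by apply: measurable_fun_l1 => u; exact: measurable_limit_fun. Qed.

Lemma measurable_trunc_limit_point n :
  measurable_fun setT (fun s => l1_trunc n (limit_point s) : borel (l1U R)).
Proof.
apply: measurable_fun_l1 => u /=; rewrite /trunc_fun.
have [un|un] := boolP (size u <= n)%N; last exact: measurable_cst.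
exact: measurable_limit_fun.
Qed.

Definition limit_measure : probability (borel (l1U R)) R :=
  law (unif01 : probability R R) (limit_point : R -> borel (l1U R)).

Lemma limit_measure_tree : limit_measure (limit_tree beta x setT) = 1%E.
Proof.
rewrite lawE; last exact: measurable_limit_point.
rewrite (_ : _ @^-1` _ = setT); first exact: unif01_setT.
by apply/seteqP; split=> // s _; exact: limit_point_tree.
Qed.

(** A finite sum of atoms is the length of a disjoint union of cells. One inequality for all Borel
    sets is enough: both measures have mass one, so complements give the converse. *)
Lemma emb_measure_le n A : borel_set A -> (emb_measure beta x n A <=
  unif01 ((fun s => l1_trunc n (limit_point s)) @^-1` A))%E.
Proof.
move=> bA; apply: ge_ereal_sup => _ [X [fX Xn] <-].
pose F (ij : seq nat * nat) : set R := cell x (rcons ij.1 ij.2) `&`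
  [set _ | A (emb_point beta (bead (x ij.1) ij.2))].
have mF ij : measurable (F ij).
  rewrite /F; have [q|q] := pselect (A (emb_point beta (bead (x ij.1) ij.2))).
    rewrite (_ : [set _ | _] = setT) ?setIT; first exact: measurable_cell.
    by apply/seteqP; split.
  rewrite (_ : [set _ | _] = set0) ?setI0//.
  by apply/seteqP; split.
have FE ij : ((checkP x (rcons ij.1 ij.2))%:E *
    \d_(emb_point beta (bead (x ij.1) ij.2) : borel (l1U R)) A)%E = unif01 (F ij).
  rewrite /F diracE; have [q|q] := pselect (A (emb_point beta (bead (x ij.1) ij.2))).
    rewrite mem_set// mule1 (_ : [set _ | _] = setT) ?setIT ?unif01_cell//.
    by apply/seteqP; split.
  rewrite memNset// mule0 (_ : [set _ | _] = set0) ?setI0 ?measure0//.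
  by apply/seteqP; split.
under eq_fsbigr do rewrite FE.
rewrite -measure_fin_bigcup//; last first.
  move=> [i j] [i' j'] /Xn /= ni /Xn /= ni' [s [[/= s1 _] [/= s2 _]]].
  have e : rcons i j = rcons i' j'.
    have sz : size (rcons i j) = size (rcons i' j') by rewrite !size_rcons ni ni'.
    have [h|h] := orP (cell_chain s1 s2); move: h; rewrite prefixE.
      by rewrite sz take_size => /eqP.
    by rewrite -sz take_size => /eqP.
  by have [-> ->] := rcons_inj e.
apply: le_measure; rewrite ?inE.
- by apply: fin_bigcup_measurable => // ij _; exact: mF.
- by have /(_ measurableT A bA) := measurable_trunc_limit_point n; rewrite setTI.
- move=> s [[i j] /Xn /= ni [/= sij Aij]].
  by rewrite /= -ni (trunc_limit_point sij).
Qed.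

Lemma emb_measureE n A : borel_set A -> emb_measure beta x n A =
  unif01 ((fun s => l1_trunc n (limit_point s)) @^-1` A).
Proof.
move=> bA; apply/eqP; rewrite eq_le emb_measure_le//=.
have mT : measurable ((fun s => l1_trunc n (limit_point s)) @^-1` A).
  by have /(_ measurableT A bA) := measurable_trunc_limit_point n; rewrite setTI.
have bAc : borel_set (~` A) by apply: (@measurableC _ (borel (l1U R))).
have h := emb_measure_le n bAc; rewrite preimage_setC in h.
pose nu : probability (borel (l1U R)) R := emb_measure beta x n.
set T := _ @^-1` A in mT h *.
have {h} : (1 - nu A <= 1 - unif01 T)%E.
  by rewrite -(probability_setC nu)// -(probability_setC (unif01 : probability R R)).
have fn : nu A \is a fin_num by exact: fin_num_measure.
have fu : unif01 T \is a fin_num.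
  exact: (@fin_num_measure _ _ _ (unif01 : probability R R)).
rewrite -[emb_measure _ _ _ _]/(nu A) -(fineK fn) -(fineK fu) -!EFinB !lee_fin.
by rewrite lerD2l lerN2.
Qed.

Lemma emb_measure_prokhorov (e : R) : 0 < e ->
  \forall n \near \oo,
   (prokhorov_dist (emb_measure beta x n)
     (limit_measure : set (l1U R) -> \bar R) < e%:E)%E.
Proof.
move=> e0; have e3 : 0 < e / 3 by lra.
have e2 : 0 < e / 2 by lra.
have [N hN] := tight_tail tx e3; exists N => // n /= Nn.
apply: (@le_lt_trans _ _ (e / 2)%:E); last by rewrite lte_fin; lra.
have := @prokhorov_dist_coupling R (l1U R) _ _ (unif01 : probability R R)
  (fun s => l1_trunc n (limit_point s)) limit_point set0 (e / 2) e2 measurable0.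
rewrite measure0 lee_fin ltW// => /(_ isT).
have mT A : borel_set A -> measurable ((fun s => l1_trunc n (limit_point s)) @^-1` A).
  by move=> bA; have /(_ measurableT A bA) := measurable_trunc_limit_point n; rewrite setTI.
have mL A : borel_set A -> measurable (limit_point @^-1` A).
  by move=> bA; have /(_ measurableT A bA) := measurable_limit_point; rewrite setTI.
move=> /(_ mT mL) h; apply: le_trans (h _); last first.
  move=> s _; rewrite metric_sym.
  have := hN n Nn (limit_point s) (limit_fun_tree s); lra.
rewrite /prokhorov_dist; apply: le_ereal_inf => _ [d [d0 hd] <-]; exists d => //.
split=> // A bA; rewrite !lawE; try exact: measurable_limit_point.
by rewrite !emb_measureE//; [exact: hd|exact: borel_thickening].
Qed.

End limit_points.

(** * Measurability of the random tree *)

Section beads_measurability.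
Context {R : realType}.

Lemma measurable_len : measurable_fun setT (@len R).
Proof.
move=> _ B mB; rewrite setTI; apply: sub_gen_smallest.
by exists B => //; constructor 1.
Qed.

Lemma measurable_loc j : measurable_fun setT (fun s : beads R => loc s j).
Proof.
move=> _ B mB; rewrite setTI; apply: sub_gen_smallest.
by exists B => //; constructor 2; exists j.
Qed.

Lemma measurable_mass j : measurable_fun setT (fun s : beads R => mass s j).
Proof.
move=> _ B mB; rewrite setTI; apply: sub_gen_smallest.
by exists B => //; constructor 3; exists j.
Qed.

End beads_measurability.

Section random_families.
Context {R : realType} (beta : R) d (Omega : measurableType d).
Variable xi : seq nat -> Omega -> beads R.
Hypothesis mxi : forall u, measurable_fun setT (xi u).
Implicit Types (u v : seq nat).

Lemma measurable_xi_len u : measurable_fun setT (fun w => len (xi u w)).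
Proof. exact: measurableT_comp measurable_len (mxi u). Qed.

Lemma measurable_xi_loc u j : measurable_fun setT (fun w => loc (xi u w) j).
Proof. exact: measurableT_comp (measurable_loc j) (mxi u). Qed.

Lemma measurable_xi_mass u j : measurable_fun setT (fun w => mass (xi u w) j).
Proof. exact: measurableT_comp (measurable_mass j) (mxi u). Qed.

Lemma measurable_checkP u : measurable_fun setT (fun w => checkP (xi^~ w) u).
Proof.
elim/last_ind: u => [|u j IH].
  by under eq_fun do rewrite checkP_nil; exact: measurable_cst.
under eq_fun do rewrite checkP_rcons.
by apply: measurable_funM => //; exact: measurable_xi_mass.
Qed.

Lemma measurable_checkP_powR u :
  measurable_fun setT (fun w => checkP (xi^~ w) u `^ beta).
Proof. exact: measurableT_comp (measurable_powR beta) (measurable_checkP u). Qed.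

Lemma measurable_branch_pos u j :
  measurable_fun setT (fun w => branch_pos beta (xi^~ w) u j).
Proof.
by apply: measurable_funM; [exact: measurable_checkP_powR|exact: measurable_xi_loc].
Qed.

Lemma measurable_seg_len u :
  measurable_fun setT (fun w => seg_len beta (xi^~ w) u).
Proof.
by apply: measurable_funM; [exact: measurable_checkP_powR|exact: measurable_xi_len].
Qed.

Lemma measurable_cumul u j : measurable_fun setT (fun w => cumul (xi u w) j).
Proof.
elim: j => [|j IH]; first by under eq_fun do rewrite cumul0; exact: measurable_cst.
under eq_fun do rewrite cumulS.
by apply: measurable_funD => //; exact: measurable_xi_mass.
Qed.

Lemma measurable_left_end u : measurable_fun setT (fun w => left_end (xi^~ w) u).
Proof.
elim/last_ind: u => [|u j IH].
  rewrite (_ : (fun w => _) = cst 0); first exact: measurable_cst.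
  by apply/funext => w; rewrite /left_end big_ord0.
under eq_fun do rewrite left_end_rcons.
apply: measurable_funD => //; apply: measurable_funM; first exact: measurable_checkP.
exact: measurable_cumul.
Qed.

Lemma measurable_cell_event u s : measurable [set w | cell (xi^~ w) u s].
Proof.
have m1 := measurable_left_end u.
have m2 : measurable_fun setT (fun w => left_end (xi^~ w) u + checkP (xi^~ w) u).
  by apply: measurable_funD => //; exact: measurable_checkP.
rewrite (_ : [set _ | _] =
  (setT `&` (fun w => left_end (xi^~ w) u) @^-1` `]-oo, s]%classic) `&`
  (setT `&` (fun w => left_end (xi^~ w) u + checkP (xi^~ w) u) @^-1` `]s, +oo[%classic)).
  by apply: measurableI; [exact: m1|exact: m2].
rewrite !setTI; apply/seteqP; split=> w /=; rewrite cellE !in_itv /= andbT.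
  by move=> /andP.
by move=> [-> ->].
Qed.

(** Here [s] is fixed and the family varies, while in [measurable_limit_fun] it is the converse.
    Joint measurability is avoided: at each stage only finitely many grid points [s] are sampled. *)
Lemma measurable_limit_fun_event u s :
  measurable_fun setT (fun w => limit_fun beta (xi^~ w) s u).
Proof.
move=> _ B mB; rewrite setTI.
pose C := \bigcup_j [set w | cell (xi^~ w) (rcons u j) s].
have mC : measurable C.
  by apply: bigcupT_measurable => j; exact: measurable_cell_event.
have mconst (Q : Prop) : measurable [set _ : Omega | Q].
  have [q|q] := pselect Q.
    by rewrite (_ : [set _ | _] = setT)//; apply/seteqP; split.
  by rewrite (_ : [set _ | _] = set0)//; apply/seteqP; split.
rewrite (_ : _ @^-1` _ = \bigcup_j ([set w | cell (xi^~ w) (rcons u j) s] `&`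
    (setT `&` (fun w => branch_pos beta (xi^~ w) u j) @^-1` B)) `|`
    (~` C `&` [set _ | B 0])).
  apply: measurableU; last by apply: measurableI => //; exact: measurableC.
  apply: bigcupT_measurable => j; apply: measurableI; first exact: measurable_cell_event.
  exact: measurable_branch_pos.
apply/seteqP; split=> w /=.
  have [[j uj]|nu] := pselect (exists j, cell (xi^~ w) (rcons u j) s).
    by rewrite (limit_fun_cell _ uj) => Bj; left; exists j.
  rewrite limit_fun_eq0 => [B0|j uj]; last by apply: nu; exists j.
  by right; split=> // -[j _ uj]; apply: nu; exists j.
case=> [[j _ [uj [_ Bj]]]|[nC B0]]; first by rewrite /= (limit_fun_cell _ uj).
by rewrite /= limit_fun_eq0// => j uj; apply: nC; exists j.
Qed.

End random_families.

(** * Finite approximations of the tree and of its measure *)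

Section dense_points.
Context {R : realType} (beta : R) (x : seq nat -> beads R).

Lemma frac_itv (s : beads R) a b :
  0 <= (minn a b.+1)%:R / b.+1%:R * len s <= len s.
Proof.
have l0 : 0 <= len s by exact/ltW/len_gt0.
rewrite mulr_ge0 ?divr_ge0//= ler_piMl// ler_pdivrMr// mul1r ler_nat.
exact: geq_minr.
Qed.

Definition frac_pt (s : beads R) a b : interval s :=
  exist (fun t : R => 0 <= t <= len s) _ (frac_itv s a b).

(** An index decodes to a word and a fraction of its segment, both chosen independently of the
    family, so [dense_pt k] depends measurably on the family. Undecodable indices give the root. *)
Definition dense_pt (k : nat) : l1U R :=
  let: (u, a, b) := odflt ([::], 0%N, 0%N) (unpickle k) in
  emb_point beta (frac_pt (x u) a b).

Lemma dense_pt_tree k : limit_tree beta x setT (dense_pt k).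
Proof.
rewrite /dense_pt; case: (odflt _ _) => [[u a] b]; split; last by move=> v [].
exact: emb_point_tree_fun.
Qed.

Lemma mdist_emb_point u (t t' : interval (x u)) :
  mdist (emb_point beta t) (emb_point beta t') =
  checkP x u `^ beta * `|sval t - sval t'|.
Proof.
apply: EFin_inj; rewrite l1_mdistE (esumID [set u]) ?setTI => [|v _]; last first.
  by rewrite lee_fin.
have z v : (~` [set u]) v -> `|emb_point beta t v - emb_point beta t' v|%:E = 0%E.
  by move/eqP => vu; rewrite !emb_point_eval (negbTE vu) subrr normr0.
rewrite esum_set1 ?lee_fin// (esum1 z) adde0.
by rewrite !emb_point_eval eqxx -mulrBr normrM ger0_norm ?powR_ge0.
Qed.

Lemma dense_pt_dense f (e : R) : tight_tree beta x -> 0 < e ->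
  limit_tree beta x setT f -> exists k, mdist (dense_pt k) f < e.
Proof.
move=> tx e0 [ft _]; have e2 : 0 < e / 2 by rewrite divr_gt0.
have e4 : 0 < e / 4 by rewrite divr_gt0.
have [n hn] := tight_tail tx e4; have {hn} := hn n (leqnn n) f ft.
have : emb_tree beta x n (l1_trunc n f).
  by rewrite emb_treeE; exact: l1_trunc_limit_tree.
move=> [u _ [t _ <-]] ft4.
have sl0 := seg_len_ge0 beta x u.
(* The segment may have length 0, hence the [+ 1] in the denominator. *)
have e1 : 0 < e / 4 / (seg_len beta x u + 1) by rewrite divr_gt0// ltr_wpDl.
have [b /= be] : exists b : nat, b.+1%:R^-1 < e / 4 / (seg_len beta x u + 1).
  by have /ltr_add_invr[b] := e1; rewrite add0r; exists b.
have l0 := len_gt0 (x u); have /andP[t0 t1] := svalP t.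
pose q := sval t / len (x u) * b.+1%:R.
have q0 : 0 <= q by rewrite mulr_ge0 ?divr_ge0// ltW.
have /andP[h1 h2] := truncn_itv q0.
have qb : q <= b.+1%:R by rewrite ler_piMl// ler_pdivrMr// mul1r.
have ab : (Num.truncn q <= b.+1)%N.
  by rewrite -(ler_nat R) (le_trans h1).
exists (pickle (u, Num.truncn q, b)); rewrite /dense_pt pickleK /=.
apply: (le_lt_trans (metric_triangle _ (emb_point beta t) _)).
suff h : mdist (emb_point beta (frac_pt (x u) (Num.truncn q) b)) (emb_point beta t) <= e / 4.
  have := ltr_leD (le_lt_trans h (_ : e / 4 < e / 2)) (le_trans ft4 (_ : e / 4 <= e / 2)).
  by rewrite (metric_sym f) -splitr; apply; clear -e0; lra.
rewrite mdist_emb_point /= (minn_idPl ab).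
have tq : sval t = q / b.+1%:R * len (x u).
  by rewrite /q mulfK// divfK// gt_eqF.
rewrite {}tq -mulrBl -mulrBl !normrM (ger0_norm (ltW l0)) (@ger0_norm _ b.+1%:R^-1) ?invr_ge0//.
rewrite mulrA mulrC mulrA -/(seg_len beta x u) [len _ * _]mulrC -/(seg_len beta x u).
apply: (@le_trans _ _ (seg_len beta x u * (1 * b.+1%:R^-1))).
  rewrite ler_wpM2l// ler_wpM2r ?invr_ge0//.
  rewrite ler0_norm ?subr_le0// opprB lerBlDl.
  by rewrite natr1 ltW.
rewrite mul1r; apply: (@le_trans _ _ ((seg_len beta x u + 1) * b.+1%:R^-1)).
  by rewrite ler_wpM2r ?invr_ge0// lerDl.
by rewrite mulrC -ler_pdivlMr ?ltW// ltr_wpDl.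
Qed.

Lemma dense_finite_net (e : R) : tight_tree beta x -> 0 < e ->
  \forall N \near \oo, limit_tree beta x setT `<=`
    thickening [set dense_pt k | k in [set k | (k < N)%N]] e.
Proof.
move=> tx e0; have e2 : 0 < e / 2 by rewrite divr_gt0.
have [D /finite_seqP[s ->] [DT TD]] := compact_net (compact_limit_tree (D := setT) tx) e2.
have /choice[k hk] : forall f : l1U R, exists k, limit_tree beta x setT f ->
    mdist (dense_pt k) f < e / 2.
  move=> f; have [Tf|nTf] := pselect (limit_tree beta x setT f); last by exists 0%N.
  by have [k hk] := dense_pt_dense tx e2 Tf; exists k.
exists (\max_(f <- s) (k f).+1)%N => // N /= hN f /TD[g gs gf].
exists (dense_pt (k g)).
  exists (k g) => //=; apply: leq_trans hN.
  by apply: (@leq_bigmax_seq _ s xpredT (fun f => (k f).+1)) gs _.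
apply: (le_lt_trans (metric_triangle _ g _)).
by rewrite (splitr e) ltrD// hk//; exact: DT.
Qed.

End dense_points.

Section grid.
Context {R : realType}.

(** The cut-off at [N] acts only outside [0, 1[; it keeps the grid finite for all real [s]. *)
Definition grid_index (N : nat) (s : R) : nat := minn N (Num.truncn (s * N.+1%:R)).

Definition grid (N : nat) (s : R) : R := (grid_index N s)%:R / N.+1%:R.

Lemma grid_bounds N s : 0 <= s < 1 -> grid N s <= s < grid N s + N.+1%:R^-1.
Proof.
move=> /andP[s0 s1]; have N0 : (0 : R) < N.+1%:R by [].
have sN : 0 <= s * N.+1%:R by rewrite mulr_ge0.
have /andP[h1 h2] := truncn_itv sN.
rewrite /grid /grid_index (minn_idPr _); last first.
  by rewrite -ltnS truncn_lt_nat// gtr_pMl.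
rewrite ler_pdivrMr// h1/= -[X in _ + X]mul1r -mulrDl ltr_pdivlMr//.
by rewrite natr1.
Qed.

Lemma measurable_grid_index N : measurable_code (grid_index N).
Proof.
move=> v; rewrite (_ : [set _ | _] =
    (fun s : R => Num.truncn (s * N.+1%:R)) @^-1` [set k | minn N k = v]); last first.
  by apply/seteqP; split.
apply: measurable_code_preimage; apply: measurable_code_truncn.
by apply: measurable_funM => //; exact: measurable_cst.
Qed.

End grid.

Section sampling.
Context {R : realType} (beta : R) (x : seq nat -> beads R).
Hypothesis tx : tight_tree beta x.
Local Notation Theta := (limit_point tx).

Lemma mdist_same_cell i j s t (n : nat) (e : R) : size i = n ->
  (forall f : l1U R, tree_fun beta x f -> mdist f (l1_trunc n f) <= e) ->
  cell x (rcons i j) s -> cell x (rcons i j) t -> mdist (Theta s) (Theta t) <= e + e.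
Proof.
move=> sn he cs ct; apply: (le_trans (metric_triangle _ (l1_trunc n (Theta s)) _)).
apply: lerD; first by apply: he; exact: limit_fun_tree.
rewrite -sn (trunc_limit_point tx cs) -(trunc_limit_point tx ct) sn metric_sym.
by apply: he; exact: limit_fun_tree.
Qed.

(** A point that is not a left end lies strictly to the right of the left end of its cell of level n
    + 1. Grid points just below it then share that cell, hence the truncation at depth [n]. The
    excluded points are countably many. *)
Lemma limit_point_grid s (e : R) : 0 <= s < 1 -> (forall u, s <> left_end x u) ->
  0 < e -> \forall N \near \oo, mdist (Theta (grid N s)) (Theta s) < e.
Proof.
move=> s01 sl e0; have e3 : 0 < e / 3 by rewrite divr_gt0.
have [n hn] := tight_tail tx e3; have {}hn := hn n (leqnn n).
have [u un us] := cell_level x n.+1 s01.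
case/lastP: u un us => // i j; rewrite size_rcons => -[i_n] us.
have lt : 0 < s - left_end x (rcons i j).
  move: (us); rewrite cellE => /andP[h _].
  by rewrite subr_gt0 lt_neqAle h andbT eq_sym; apply/eqP => h'; exact: sl h'.
have := near_infty_natSinv_lt (PosNum lt); apply: filterS => N /= hN.
have /andP[g1 g2] := grid_bounds N s01.
have gc : cell x (rcons i j) (grid N s).
  move: (us); rewrite !cellE => /andP[_ h2]; rewrite (le_lt_trans g1 h2) andbT.
  by move: g2 hN; move: (_^-1) => q; lra.
have := mdist_same_cell i_n hn gc us; lra.
Qed.

Definition sample (N : nat) (s : R) : l1U R := round_l1 N (Theta (grid N s)).

Lemma measurable_dist_grid N (e : R) :
  measurable [set s | e <= mdist (Theta (grid N s)) (Theta s)].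
Proof.
rewrite (_ : [set _ | _] = \bigcup_a ([set s | grid_index N s = a] `&`
   (setT `&` (Theta : R -> borel (l1U R)) @^-1`
      [set f | e <= mdist (Theta (a%:R / N.+1%:R)) f])%classic)).
  apply: bigcupT_measurable => a; apply: measurableI; first exact: measurable_grid_index.
  apply: (measurable_limit_point tx) => //.
  rewrite -[X in measurable X]setCK; apply: (@measurableC _ (borel (l1U R))).
  apply: borel_open; rewrite (_ : ~` _ = thickening [set Theta (a%:R / N.+1%:R)] e).
    exact: open_thickening.
  apply/seteqP; split=> f /=.
    by move/negP; rewrite -ltNge => h; exists (Theta (a%:R / N.+1%:R)).
  by move=> [_ -> h]; apply/negP; rewrite -ltNge.
apply/seteqP; split=> s /=; first by move=> h; exists (grid_index N s).
by move=> [a _ [<- [_ h]]].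
Qed.

(** Convergence almost everywhere gives convergence in measure: the events of being far at some
    stage after [n] decrease to a set contained in the left ends and the complement of [0, 1[, which
    is null. *)
Lemma sample_far_cvg (e : R) : 0 < e -> forall r : R, 0 < r ->
  \forall N \near \oo,
    (unif01 [set s | (e <= mdist (Theta (grid N s)) (Theta s))%R] < r%:E)%E.
Proof.
move=> e0 r r0.
pose B N := [set s | e <= mdist (Theta (grid N s)) (Theta s)].
pose D n := \bigcup_(N in [set N | (n <= N)%N]) B N.
have mB N : measurable (B N) by exact: measurable_dist_grid.
have mD n : measurable (D n) by apply: bigcup_measurable => N _; exact: mB.
have mI : measurable (\bigcap_n D n) by exact: bigcapT_measurable.
have D0 : unif01 (\bigcap_n D n) = 0%E.
  pose Q := \bigcup_u [set left_end x u].
  have mQ : measurable Q.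
    apply: countable_bigcupT_measurable; first exact: countableP.
    by move=> u; exact: measurable_set1.
  have Q0 : unif01 Q = 0%E.
    have cQ : (unif01 : probability R R).-negligible Q.
      pose L (o : option (seq nat)) : set R :=
        if o is Some u then [set left_end x u] else set0.
      have nL o : (unif01 : probability R R).-negligible (L o).
        case: o => [u|]; last exact: negligible_set0.
        by exists [set left_end x u]; split=> //; exact: unif01_set1.
      rewrite /Q (_ : \bigcup_u _ = \bigcup_k (L (unpickle k))).
        exact: negligible_bigcup.
      apply/seteqP; split=> [s [u _ ->]|s [k _]].
        by exists (pickle u) => //; rewrite pickleK.
      by rewrite /L; move: (unpickle _) => [u ->|//]; exists u.
    exact/(negligibleP _ mQ).
  have O0 : unif01 (~` `[0 : R, 1[%classic) = 0%E.
    by rewrite /unif01 /mrestr setICl measure0.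
  have mO : measurable (~` `[0 : R, 1[%classic) by apply: measurableC; exact: measurable_itv.
  apply: (@subset_measure0 _ _ _ (unif01 : probability R R) _ (Q `|` ~` `[0, 1[%classic)) => //.
  - exact: measurableU.
  - move=> s sD; apply: contrapT => /not_orP[nQ /contrapT]; rewrite /= in_itv/= => s01.
    have sl u : s <> left_end x u by move=> su; apply: nQ; exists u.
    have [n _ hn] := limit_point_grid s01 sl e0.
    have [N /= nN BN] := sD n Logic.I.
    by have := hn N nN; rewrite ltNge BN.
  - exact: etrans (@measureU0 _ _ _ (unif01 : probability R R) _ _ mQ mO O0) Q0.
have Dcvg : unif01 (D n) @[n --> \oo] --> (0%E : \bar R).
  rewrite -D0; apply: (@nonincreasing_cvg_mu _ _ _ (unif01 : probability R R)) => //.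
    by rewrite ltey_eq fin_num_measure.
  move=> m n mn; apply/subsetPset => s [N /= nN BN].
  by exists N => //=; exact: leq_trans nN.
have ge0 n : (0 <= unif01 (D n))%E by exact: measure_ge0.
have := (ereal_cvg0P ge0).1 Dcvg _ r0; apply: filterS => N.
apply: le_lt_trans; apply: le_measure; rewrite ?inE//.
  exact: mB.
by move=> s Bs; exists N => /=.
Qed.

Lemma measurable_sample N : measurable_fun setT (sample N : R -> borel (l1U R)).
Proof.
apply: measurable_fun_borel => O oO.
apply: (@measurable_code_preimage _ _ _ (grid_index N)
  [set a | O (round_l1 N (Theta (a%:R / N.+1%:R)))]).
exact: measurable_grid_index.
Qed.

Lemma tight_round (e : R) : 0 < e ->
  \forall N \near \oo, forall f : l1U R, tree_fun beta x f ->
    mdist f (round_l1 N f) < e.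
Proof.
move=> e0; have e2 : 0 < e / 2 by rewrite divr_gt0.
have [W hW] := tx e2; have := round_l1_near W e2; apply: filterS => N h f ft.
by have := h f (hW f ft); rewrite mulrC divfK.
Qed.

Lemma sample_prokhorov (e : R) : 0 < e -> \forall N \near \oo,
  (prokhorov_dist (law (unif01 : probability R R) (sample N : R -> borel (l1U R))
       : set (l1U R) -> \bar R)
     (limit_measure tx : set (l1U R) -> \bar R) < e%:E)%E.
Proof.
move=> e0; have e4 : 0 < e / 4 by rewrite divr_gt0.
have e2 : 0 < e / 2 by rewrite divr_gt0.
apply: filterS (filterI (tight_round e4) (sample_far_cvg e4 e2)) => N [h1 h2].
apply: (@le_lt_trans _ _ (e / 2)%:E); last by rewrite lte_fin; lra.
have mS A : borel_set A -> measurable (sample N @^-1` A).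
  by move=> bA; have /(_ measurableT A bA) := measurable_sample N; rewrite setTI.
have mL A : borel_set A -> measurable (Theta @^-1` A).
  by move=> bA; have /(_ measurableT A bA) := measurable_limit_point tx; rewrite setTI.
have := @prokhorov_dist_coupling R (l1U R) _ _ (unif01 : probability R R)
  (sample N) Theta _ (e / 2) e2 (measurable_dist_grid N (e / 4)) (ltW h2) mS mL.
move=> h; apply: le_trans (h _); last first.
  move=> s /= /negP; rewrite -ltNge => hs.
  have := h1 (Theta (grid N s)) (limit_fun_tree _ _ _).
  have := metric_triangle (sample N s) (Theta (grid N s)) (Theta s).
  rewrite (metric_sym (sample N s) (Theta (grid N s))) /sample; lra.
rewrite /prokhorov_dist; apply: le_ereal_inf => _ [r [r0 hr] <-]; exists r => //.
split=> // A bA; rewrite !lawE; first exact: hr.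
all: by [exact: measurable_limit_point|exact: measurable_sample].
Qed.

Lemma dense_round_hausdorff (e : R) : 0 < e -> \forall N \near \oo,
  (hausdorff_dist [set round_l1 N (dense_pt beta x k) | k in [set k | (k < N)%N]]
     (limit_tree beta x setT) < e%:E)%E.
Proof.
move=> e0; have e4 : 0 < e / 4 by rewrite divr_gt0.
have e2 : 0 < e / 2 by rewrite divr_gt0.
apply: filterS (filterI (tight_round e4) (dense_finite_net tx e4)) => N [h1 h2].
apply: (@le_lt_trans _ _ (e / 2)%:E); last by rewrite lte_fin; lra.
have dk k := (dense_pt_tree beta x k).
apply: hausdorff_dist_le => // [_ [k kN <-]|f /h2[_ [k kN <-] kf]].
  exists (dense_pt beta x k) => //.
  by have [dt _] := dk k; have := h1 _ dt; lra.
exists (round_l1 N (dense_pt beta x k)); first by exists k.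
apply: (le_lt_trans (metric_triangle _ (dense_pt beta x k) _)).
have [dt _] := dk k; have := h1 _ dt; rewrite metric_sym; move: kf; lra.
Qed.

End sampling.

Section random_trees.
Context {R : realType} (beta : R) d (Omega : measurableType d).
Variable xi : seq nat -> Omega -> beads R.
Hypothesis mxi : forall u, measurable_fun setT (xi u).
Hypothesis txi : forall w, tight_tree beta (xi^~ w).

Let X : Type := (set (l1U R) * probability (borel (l1U R)) R)%type.

(** What stage [N] retains of the tree and of its measure: rounded dense points and rounded images
    of the grid points. Since [decode] sees nothing else, the approximating pair takes countably
    many values. *)
Let code N (w : Omega) : seq (seq nat) * seq (seq nat) :=
  (mkseq (fun k => round_code N (dense_pt beta (xi^~ w) k)) N,
   mkseq (fun a => round_code N (limit_point (txi w) (a%:R / N.+1%:R))) N.+1).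

Let decode N (c : seq (seq nat) * seq (seq nat)) : X :=
  ([set round_pt N (nth [::] c.1 k) | k in [set k | (k < N)%N]],
   law (unif01 : probability R R)
     (fun s => round_pt N (nth [::] c.2 (grid_index N s)) : borel (l1U R))).

Let decode_code N w : decode N (code N w) =
  ([set round_l1 N (dense_pt beta (xi^~ w) k) | k in [set k | (k < N)%N]],
   law (unif01 : probability R R) (sample (txi w) N : R -> borel (l1U R))).
Proof.
rewrite /decode; congr (_, _).
  by apply/seteqP; split=> _ [k /= kN <-]; exists k => //=; rewrite nth_mkseq.
congr (law _ _); apply/funext => s; rewrite /sample /grid /= nth_mkseq//.
by rewrite ltnS /grid_index geq_minl.
Qed.

Let measurable_code_code N : measurable_code (code N).
Proof.
move=> [v v']; rewrite (_ : [set _ | _] =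
  [set w | mkseq (fun k => round_code N (dense_pt beta (xi^~ w) k)) N = v] `&`
  [set w | mkseq (fun a => round_code N (limit_point (txi w) (a%:R / N.+1%:R))) N.+1
           = v']); last first.
  by apply/seteqP; split=> w /=; [case=> -> ->|case=> <- <-].
apply: measurableI.
  apply: (measurable_code_mkseq (c := fun k w => round_code N (dense_pt beta (xi^~ w) k))).
  move=> k; apply: measurable_round_code => v1; rewrite /dense_pt.
  case: (odflt _ _) => [[u a] b].
  under eq_fun do rewrite emb_point_eval.
  case: eqP => _.
    apply: measurable_funM; first exact: measurable_checkP_powR.
    by apply: measurable_funM; [exact: measurable_cst|exact: measurable_xi_len].
  case: (prefix v1 u); last exact: measurable_cst.
  exact: measurable_branch_pos.
apply: (measurable_code_mkseq
  (c := fun a w => round_code N (limit_point (txi w) (a%:R / N.+1%:R)))) => a.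
by apply: measurable_round_code => u /=; exact: measurable_limit_fun_event.
Qed.

Lemma limit_tree_random : random_weighted_tree
  (fun w => limit_tree beta (xi^~ w) setT) (fun w => limit_measure (txi w)).
Proof.
have wt w : is_weighted_tree (limit_tree beta (xi^~ w) setT) (limit_measure (txi w)).
  split; [exact: limit_tree_rtree|exact: limit_tree_point|exact: limit_measure_tree].
split=> // O oO.
(* The approximations are finite sets, in general not trees, whereas [hp_open] only speaks of
   weighted trees. [O'] is open among all pairs and has the same trace as [O] on weighted trees. *)
pose O' := [set a : X | exists2 e : R, 0 < e & forall b,
  is_weighted_tree b.1 b.2 -> (hp_dist a b < e%:E)%E -> O b].
rewrite (_ : [set _ | _] =
   (fun w => (limit_tree beta (xi^~ w) setT, limit_measure (txi w)) : X) @^-1` O').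
  apply: (@measurable_dist_limit R X (@hp_dist R (l1U R)) _ _ _ _
    (fun N w => decode N (code N w))).
  - exact: hp_distC.
  - exact: hp_dist_triangle.
  - move=> N V _; apply: (measurable_code_preimage (c := code N) (decode N @^-1` V)).
    exact: measurable_code_code.
  - move=> w e e0.
    apply: filterS (filterI (dense_round_hausdorff (txi w) e0)
      (sample_prokhorov (txi w) e0)) => N [h1 h2].
    by rewrite decode_code hp_distC /hp_dist gt_max h1.
  - move=> a [e e0 he]; have e2 : 0 < e / 2 by rewrite divr_gt0.
    exists (e / 2) => // b ab; exists (e / 2) => // c ct bc; apply: he => //.
    apply: (le_lt_trans (hp_dist_triangle b a c)).
    by rewrite (splitr e) EFinD lteD.
apply/seteqP; split=> w /=.
  by move/oO => [_ [e e0 he]]; exists e.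
by move=> [e e0]; apply; [exact: wt|rewrite hp_distxx lte_fin].
Qed.

End random_trees.

(** * Moments of strings of beads *)

Section beads_measure_facts.
Context {R : realType}.
Implicit Type s : beads R.

Lemma beads_term_ge0 s A i : (0 <= (mass s i)%:E * \d_(loc s i) A)%E.
Proof. by rewrite mule_ge0// ?lee_fin ?mass_ge0// diracE lee_fin. Qed.

Lemma mass_le0 s j : mass s j <= mass s 0%N.
Proof. by elim: j => // j; apply: le_trans; exact: mass_dec. Qed.

Lemma mass_le_measure s j : ((mass s j)%:E <= beads_measure s [set loc s j])%E.
Proof.
apply: (@le_trans _ _ (\sum_(0 <= i < j.+1)
    (mass s i)%:E * \d_(loc s i) [set loc s j])%E); last first.
  by apply: nneseries_lim_ge => i _ _; exact: beads_term_ge0.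
rewrite big_nat_recr//=.
by rewrite diracE mem_set// mule1 leeDr// sume_ge0// => i _; exact: beads_term_ge0.
Qed.

Lemma beads_measure_set1 s y : (beads_measure s [set y] <= (mass s 0%N)%:E)%E.
Proof.
have t0 i : (0 <= (mass s i)%:E * \d_(loc s i) [set y])%E by exact: beads_term_ge0.
have [[j jy]|nj] := pselect (exists j, loc s j = y); last first.
  rewrite /beads_measure eseries0 ?lee_fin ?mass_ge0// => i _ _.
  rewrite diracE memNset ?mule0// => /= iy; by apply: nj; exists i.
rewrite /beads_measure (@nneseriesD1 _ _ j)// eseries0 ?adde0.
  by rewrite diracE mem_set// mule1 lee_fin mass_le0.
move=> i _ ij; rewrite diracE memNset ?mule0// => /= iy.
by move/eqP: ij; apply; apply: (@loc_inj _ s); rewrite iy.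
Qed.

Lemma beads_measure_le1 s A : (beads_measure s A <= 1)%E.
Proof.
rewrite -(mass_sum s); apply: lee_nneseries => i.
  by move=> _ _; exact: beads_term_ge0.
move=> _; rewrite -[leRHS]mule1; apply: lee_wpmul2l; first by rewrite lee_fin mass_ge0.
by rewrite diracE lee_fin lern1 leq_b1.
Qed.

Lemma mass0_le1 s : mass s 0%N <= 1.
Proof. by rewrite -lee_fin; apply: le_trans (mass_le_measure s 0) (beads_measure_le1 _ _). Qed.

End beads_measure_facts.

(** * Length and heaviest bead along one path of the subordinator *)

Section string_paths.
Context {R : realType} (alpha : R) (S : R -> R) (s : beads R).
Local Notation lbg := (@lebesgue_measure R).
Hypothesis alpha_gt0 : 0 < alpha.
Hypothesis S0 : S 0 = 0.
Hypothesis S_homo : forall t t', 0 <= t -> t <= t' -> S t <= S t'.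
Hypothesis hs : string_of_path alpha S s.

(** [S] is only controlled at nonnegative times; with the maximum, [g] is nonincreasing on the whole
    line, hence measurable. *)
Let g (u : R) : R := expR (- (alpha * S (Num.max 0 u))).

Let max0 (u : R) : 0 <= Num.max 0 u. Proof. by rewrite le_max lexx. Qed.

Let S_ge0 t : 0 <= t -> 0 <= S t.
Proof. by move=> t0; have := S_homo (lexx 0) t0; rewrite S0. Qed.

Let g_nincr u v : u <= v -> g v <= g u.
Proof.
move=> uv; rewrite /g ler_expR lerN2 ler_pM2l// S_homo//.
by rewrite ge_max max0/= le_max uv orbT.
Qed.

Let mg : measurable_fun setT (EFin \o g).
Proof.
apply/measurable_EFinP; apply: nonincreasing_measurable; last by move=> u v; exact: g_nincr.
exact: measurableT.
Qed.

Let mgD (D : set R) : measurable_fun D (EFin \o g).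
Proof. exact: measurable_funTS. Qed.

Let g_ge0 u : (0 <= (g u)%:E)%E.
Proof. by rewrite lee_fin expR_ge0. Qed.

Let gE (u : R) : 0 <= u -> g u = expR (- (alpha * S u)).
Proof. by move=> u0; rewrite /g (max_idPr _). Qed.

Let g_le1 u : g u <= 1.
Proof.
rewrite /g -expR0 ler_expR oppr_le0 mulr_ge0 ?(ltW alpha_gt0)//.
exact: S_ge0.
Qed.

Let integral_g (D : set R) : (forall u, D u -> 0 <= u) ->
  (\int[lbg]_(u in D) (expR (- (alpha * S u)))%:E = \int[lbg]_(u in D) (g u)%:E)%E.
Proof. by move=> D0; apply: eq_integral => u /set_mem /D0 u0; rewrite gE. Qed.

Lemma len_stringE : ((len s)%:E = (Gamma (1 - alpha))%:E *
  \int[lbg]_(u in `[0%R, +oo[) (g u)%:E)%E.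
Proof.
have [-> _] := hs; rewrite integral_g// => u /=.
by rewrite in_itv/= andbT.
Qed.

Lemma Gamma_ge0 (t : R) : 0 <= Gamma t.
Proof. by apply: Rintegral_ge0 => u _; rewrite mulr_ge0 ?powR_ge0 ?expR_ge0. Qed.

(** Read off from the string: a vanishing factor would give it length 0. *)
Lemma Gamma_string_gt0 : 0 < Gamma (1 - alpha).
Proof.
rewrite lt_neqAle Gamma_ge0 andbT; apply/eqP => e.
have := len_gt0 s; rewrite -lte_fin len_stringE -e mul0e.
by rewrite ltxx.
Qed.

Let unit_itv n : set R := `[n%:R, n.+1%:R[%classic.

Let unit_itv_cover : `[0%R, +oo[%classic = \bigcup_n unit_itv n.
Proof.
apply/seteqP; split=> u /=; rewrite in_itv/= ?andbT.
  by move=> /truncn_itv h; exists (Num.truncn u) => //; rewrite /unit_itv /= in_itv.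
by move=> [n _]; rewrite /unit_itv /= in_itv/= => /andP[h _]; rewrite (le_trans _ h).
Qed.

Let unit_itv_triv : trivIset setT unit_itv.
Proof.
apply/trivIsetP => i j _ _ ij; apply/seteqP; split=> // u [].
rewrite /unit_itv /= !in_itv/= => hi hj; move/eqP: ij; apply.
by rewrite -(truncn_def hi) (truncn_def hj).
Qed.

Let integral_g_sum : (\int[lbg]_(u in `[0%R, +oo[) (g u)%:E =
  \sum_(0 <= n <oo) \int[lbg]_(u in unit_itv n) (g u)%:E)%E.
Proof.
rewrite unit_itv_cover ge0_integral_bigcup//.
- by move=> n; exact: measurable_itv.
exact: mgD.
Qed.

Let lbg_unit n : lbg (unit_itv n) = 1%E.
Proof.
rewrite /unit_itv lebesgue_measure_itv/= lte_fin ltr_nat ltnSn -EFinB.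
by rewrite -natr1 addrAC subrr add0r.
Qed.

(** An upper Riemann sum with step 1. It brings the length down to the values of [S] at integer
    times, so that moments lead to a series of Laplace transforms. *)
Lemma len_string_le : ((len s)%:E <= (Gamma (1 - alpha))%:E *
  \sum_(0 <= n <oo) (expR (- (alpha * S n%:R)))%:E)%E.
Proof.
rewrite len_stringE; apply: lee_wpmul2l; first by rewrite lee_fin Gamma_ge0.
rewrite integral_g_sum; apply: lee_nneseries => n; first by move=> _ _; apply: integral_ge0.
move=> _; apply: (@le_trans _ _ (\int[lbg]_(u in unit_itv n) (cst (g n%:R)%:E) u)%E).
  apply: ge0_le_integral => //; first exact: measurable_itv.
  - exact: mgD.
  - move=> u; rewrite /unit_itv /= in_itv/= => /andP[h _].
    by rewrite lee_fin; exact: g_nincr.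
rewrite integral_cst; last exact: measurable_itv.
by rewrite [X in (_ * X)%E]lbg_unit mule1 gE.
Qed.

(* The string would otherwise be infinitely long. *)
Lemma path_not_zero : ~ forall n : nat, S n%:R = 0.
Proof.
move=> Sz; have g1 u : g u = 1.
  apply/eqP; rewrite eq_le g_le1/= /g -[leLHS]expR0 ler_expR oppr_ge0.
  rewrite pmulr_rle0//; have /truncn_itv/andP[_ h] := max0 u.
  by apply: le_trans (S_homo (max0 u) (ltW h)) _; rewrite Sz.
have := len_stringE; rewrite (eq_integral (cst 1%E)); last by move=> u _; rewrite g1.
rewrite integral_cst; last exact: measurable_itv.
have mI : lbg `[0%R, +oo[%classic = +oo%E by rewrite lebesgue_measure_itv/= ltry.
by rewrite [X in (_ * (_ * X))%E]mI mul1e gt0_muley// lte_fin Gamma_string_gt0.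
Qed.

Let ell t := Gamma (1 - alpha) * \int[lbg]_(u in `[0%R, t]) expR (- (alpha * S u)).

Let integral_itv_fin (t : R) : (\int[lbg]_(u in `[0%R, t]) (g u)%:E)%E \is a fin_num.
Proof.
rewrite ge0_fin_numE; last by apply: integral_ge0.
apply: (@le_lt_trans _ _ (\int[lbg]_(u in `[0%R, t]) (cst 1%E) u)%E).
  apply: ge0_le_integral => //; first exact: mgD.
  by move=> u _; rewrite lee_fin.
rewrite integral_cst; last exact: measurable_itv.
have mI : (lbg `[0%R, t]%classic < +oo)%E.
  by rewrite lebesgue_measure_itv/=; case: ifP; rewrite -?EFinB ltry.
by rewrite mul1e.
Qed.

(** Distinct jump times thus produce distinct atoms, so the mass at one place comes from at most one
    jump. *)
Let ell_strict t t' : 0 <= t -> t < t' -> ell t < ell t'.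
Proof.
move=> t0 tt'; rewrite ltr_pM2l ?Gamma_string_gt0// /Rintegral.
have D0 (b : R) u : `[0, b]%classic u -> 0 <= u by rewrite /= in_itv/= => /andP[].
rewrite !integral_g; [|exact: D0|exact: D0].
rewrite fine_lt ?integral_itv_fin//.
have -> : `[0, t']%classic = `[0, t] `|` `]t, t'].
  by rewrite -itv_bndbnd_setU// bnd_simp ltW.
have dis : [disjoint `[0, t]%classic & `]t, t']%classic].
  rewrite disj_set2E; apply/eqP/seteqP; split=> // u [] /=; rewrite !in_itv/=.
  by move=> /andP[_ h1] /andP[h2 _]; have := lt_le_trans h2 h1; rewrite ltxx.
rewrite ge0_integral_setU//; last exact: mgD.
rewrite lteDl ?integral_itv_fin//.
have gt' : 0 < g t' by exact: expR_gt0.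
apply: (@lt_le_trans _ _ (\int[lbg]_(u in `]t, t']) (cst (g t')%:E) u)%E).
  rewrite integral_cst; last exact: measurable_itv.
  have mI : (0 < lbg `]t, t']%classic)%E.
    by rewrite lebesgue_measure_itv/= lte_fin tt' -EFinB lte_fin subr_gt0.
  by rewrite mule_gt0 ?lte_fin.
apply: ge0_le_integral => //; first by move=> u _; rewrite lee_fin ltW.
  exact: mgD.
by move=> u /=; rewrite in_itv/= => /andP[_ h]; rewrite lee_fin; exact: g_nincr.
Qed.

Let Sminus (t : R) := lim (S u @[u --> t^'-]).

Let Sminus_ge (a t : R) : 0 <= a -> a < t -> S a <= Sminus t.
Proof.
move=> a0 at_; apply: limr_ge.
  apply: nondecreasing_at_left_is_cvgr.
    near=> b => x y; rewrite !in_itv/= => /andP[bx _] _ xy.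
    apply: S_homo => //; apply: le_trans a0 _; apply: le_trans (ltW bx).
    by near: b; exact: nbhs_left_ge.
  near=> b; exists (S t) => _ [y /= + <-]; rewrite in_itv/= => /andP[yb yt].
  apply: S_homo; last exact: ltW.
  apply: le_trans a0 _; apply: le_trans (ltW yb).
  by near: b; exact: nbhs_left_ge.
near=> b; apply: S_homo => //.
by near: b; exact: nbhs_left_ge.
Unshelve. all: by end_near. Qed.

(** With Y = exp(- S 1), a jump up to time 1 contributes at most 1 - Y, a later one at most Y. The
    polynomial 1 - Y (1 - Y) dominates both on [0, 1], and its mean involves the Laplace transform
    at 1 and 2 only. *)
Lemma mass_string_le :
  mass s 0%N <= 1 - expR (- S 1) * (1 - expR (- S 1)).
Proof.
set Y := expR (- S 1).
have Y0 : 0 < Y := expR_gt0 _.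
have Y1 : Y <= 1 by rewrite /Y -expR0 ler_expR oppr_le0 S_ge0.
have jump t : 0 < t -> expR (- Sminus t) - expR (- S t) <= 1 - Y * (1 - Y).
  move=> t0; have e0 := expR_ge0 (- S t).
  have [t1|t1] := leP t 1.
    have m1 : expR (- Sminus t) <= 1.
      by rewrite -expR0 ler_expR oppr_le0 (le_trans _ (Sminus_ge (lexx 0) t0)) ?S0.
    have m2 : Y <= expR (- S t) by rewrite /Y ler_expR lerN2 S_homo// ltW.
    have : 0 <= Y * Y by rewrite mulr_ge0// ltW.
    by move: m1 m2; rewrite mulrBr mulr1; lra.
  have m1 : expR (- Sminus t) <= Y by rewrite /Y ler_expR lerN2 Sminus_ge.
  have : 0 <= (1 - Y) * (1 - Y) by rewrite mulr_ge0// subr_ge0.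
  by rewrite mulrBr mulr1 mulrBl mul1r; move: m1 e0; rewrite !mulrBr mulr1; lra.
rewrite -lee_fin; apply: le_trans (mass_le_measure s 0) _.
have [_ ->] := hs; last exact: measurable_set1.
set J := [set t | _].
have bnd0 : 0 <= 1 - Y * (1 - Y).
  have : Y * (1 - Y) <= 1 * 1 by apply: ler_pM; rewrite ?subr_ge0// ?ltW//; lra.
  lra.
have [[t [Jt et]]|nt] := pselect (exists t, J t /\ ell t = loc s 0%N); last first.
  rewrite esum1 ?lee_fin// => t Jt; rewrite diracE memNset ?mule0// => /= e.
  by apply: nt; exists t.
have term_ge0 t' : J t' ->
    (0 <= (expR (- Sminus t') - expR (- S t'))%:E * \d_(ell t') [set loc s 0%N])%E.
  move=> [_ h]; apply: mule_ge0; last by rewrite diracE lee_fin.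
  by rewrite lee_fin subr_ge0 ler_expR lerN2 ltW.
rewrite (esumID [set t]) => [|t' /term_ge0//].
rewrite [X in (_ + X)%E]esum1 ?adde0; last first.
  move=> t' [[t'0 _] /= tt']; rewrite diracE memNset ?mule0// => /= e.
  have [lt|lt|e'] := ltgtP t t'; last by apply: tt'; rewrite e'.
    by have := ell_strict (ltW Jt.1) lt; rewrite [ell t]et [ell t']e ltxx.
  by have := ell_strict (ltW t'0) lt; rewrite [ell t]et [ell t']e ltxx.
rewrite (_ : J `&` [set t] = [set t]); last first.
  by apply/seteqP; split=> [u []//|u ->].
rewrite esum_set1; last exact: term_ge0.
apply: (@le_trans _ _ ((expR (- Sminus t) - expR (- S t))%:E * 1)%E).
  apply: lee_wpmul2l; last by rewrite diracE lee_fin lern1 leq_b1.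
  by rewrite lee_fin subr_ge0 ler_expR lerN2 ltW//; case: Jt.
by rewrite mule1 lee_fin jump//; case: Jt.
Qed.

End string_paths.

Section probability_facts.
Context d (Omega : measurableType d) {R : realType} (P : probability Omega R).

Lemma ae_exists (Q : Omega -> Prop) : {ae P, forall w, Q w} -> exists w, Q w.
Proof.
move=> h; have PF : ProperFilter (almost_everywhere P).
  apply: ae_properfilter_algebraOfSetsType.
  by have := @lte01 R; rewrite -{1}(@probability_setT _ _ _ P).
exact: filter_ex h.
Qed.

Lemma integral_one : (\int[P]_w 1 = 1)%E.
Proof. by rewrite (integral_cst P measurableT 1%E) mul1e; exact: probability_setT. Qed.

Lemma ae_eq1 (f : Omega -> R) : measurable_fun setT f ->
  (forall w, 0 <= f w <= 1) -> (1 <= \int[P]_w (f w)%:E)%E ->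
  {ae P, forall w, f w = 1}.
Proof.
move=> mf f01 f1.
have mf1 : measurable_fun setT (fun w => (1 - f w)%:E).
  by apply/measurable_EFinP; apply: measurable_funB => //; exact: measurable_cst.
have f10 w : (0 <= (1 - f w)%:E)%E by rewrite lee_fin subr_ge0; case/andP: (f01 w).
have f0 w : (0 <= (f w)%:E)%E by rewrite lee_fin; case/andP: (f01 w).
have E : (\int[P]_w (1 - f w)%:E + \int[P]_w (f w)%:E = 1)%E.
  rewrite -ge0_integralD//; last exact/measurable_EFinP.
  under eq_integral do rewrite -EFinD subrK.
  exact: integral_one.
have z : (\int[P]_w `|(1 - f w)%:E| = 0)%E.
  under eq_integral do rewrite gee0_abs//.
  apply/eqP; rewrite eq_le integral_ge0// andbT.
  rewrite leNgt; apply/negP => pos.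
  have : (1 < \int[P]_w (1 - f w)%:E + \int[P]_w (f w)%:E)%E.
    rewrite -[X in (X < _)%E]add0e; apply: lte_leD => //.
  by rewrite E ltxx.
have /(ae_eq_integral_abs P measurableT mf1) := z.
apply: filterS => w /(_ Logic.I)[]/eqP.
by rewrite subr_eq0 => /eqP.
Qed.

End probability_facts.

Section same_laws.
Context {R : realType}.

Lemma same_law_integral d d' d'' (Omega : measurableType d)
    (Omega' : measurableType d') (E : measurableType d'')
    (P : probability Omega R) (X : Omega -> E)
    (P' : probability Omega' R) (X' : Omega' -> E) (f : E -> \bar R) :
  measurable_fun setT X -> measurable_fun setT X' -> same_law P X P' X' ->
  measurable_fun setT f -> (forall e, (0 <= f e)%E) ->
  (\int[P]_w f (X w) = \int[P']_w f (X' w))%E.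
Proof.
move=> mX mX' XX' mf f0.
have := @ge0_integral_pushforward _ _ _ _ R X mX P setT f measurableT mf (fun y _ => f0 y).
have := @ge0_integral_pushforward _ _ _ _ R X' mX' P' setT f measurableT mf (fun y _ => f0 y).
rewrite !preimage_setT => <- <-.
by apply: eq_measure_integral => A mA _; exact: XX'.
Qed.

Lemma geometric_nneseries_le (k : R) : 0 <= k -> k < 1 ->
  (\sum_(0 <= n <oo) (k ^+ n)%:E <= ((1 - k)^-1)%:E)%E.
Proof.
move=> k0 k1; have k1' : 0 < 1 - k by rewrite subr_gt0.
apply: lime_le; first by apply: is_cvg_nneseries => n _ _; rewrite lee_fin exprn_ge0.
apply: nearW => n; rewrite sumEFin lee_fin big_mkord.
rewrite -[leRHS]mul1r ler_pdivlMr// mulrC.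
have := subrX1 k n; rewrite -[k - 1]opprB mulNr => /eqP.
rewrite -subr_eq0 opprK => /eqP h.
have : 0 <= k ^+ n by rewrite exprn_ge0.
by move: h; move: (\sum_(i < n) _) (k ^+ n) => a b; lra.
Qed.

(* Each [a n] is at most [r ^+ n] times the l^p norm of the [a m / r ^+ m]. *)
Lemma nneseries_pow_le (p : nat) (r G l : R) (a : nat -> R) :
  (0 < p)%N -> 0 < r -> r < 1 -> 0 < G -> 0 <= l -> (forall n, 0 <= a n) ->
  (l%:E <= G%:E * \sum_(0 <= n <oo) (a n)%:E)%E ->
  ((l ^+ p)%:E <= ((G / (1 - r)) ^+ p)%:E *
     \sum_(0 <= n <oo) ((a n / r ^+ n) ^+ p)%:E)%E.
Proof.
move=> p0 r0 r1 G0 l0 a0 la.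
have r1' : 0 < 1 - r by rewrite subr_gt0.
have rn0 n : 0 < r ^+ n by exact: exprn_gt0.
have C0 : 0 < G / (1 - r) by exact: divr_gt0.
have b0 n : (0 <= ((a n / r ^+ n) ^+ p)%:E)%E.
  by rewrite lee_fin exprn_ge0// divr_ge0// ltW.
set B := (\sum_(0 <= n <oo) ((a n / r ^+ n) ^+ p)%:E)%E.
have B0 : (0 <= B)%E by exact: nneseries_ge0.
have [->|Bfin] := eqVneq B +oo%E; first by rewrite gt0_muley ?leey// lte_fin exprn_gt0.
have {Bfin}Bfin : B \is a fin_num by rewrite ge0_fin_numE// ltey.
set M := fine B; have M0 : 0 <= M by exact: fine_ge0.
set m := M `^ p%:R^-1; have m0 : 0 <= m := powR_ge0 _ _.
have mp : m ^+ p = M.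
  by rewrite -powR_mulrn// -powRrM mulVf ?powRr1// pnatr_eq0 -lt0n.
have am n : a n <= m * r ^+ n.
  rewrite -ler_pdivrMr// leNgt; apply/negP => h.
  have : m ^+ p < (a n / r ^+ n) ^+ p.
    by rewrite ltr_pXn2r// nnegrE// divr_ge0// ltW.
  rewrite mp ltNge => /negP; apply; rewrite -lee_fin fineK//.
  apply: (@le_trans _ _ (\sum_(0 <= i < n.+1) ((a i / r ^+ i) ^+ p)%:E)%E).
    by rewrite big_nat_recr//= leeDr// sume_ge0.
  by apply: nneseries_lim_ge => i _ _.
have lm : l <= G / (1 - r) * m.
  rewrite -lee_fin; apply: (le_trans la).
  apply: (@le_trans _ _ (G%:E * \sum_(0 <= n <oo) (m%:E * (r ^+ n)%:E))%E).
    rewrite lee_pmul2l ?lte_fin//; apply: lee_nneseries => n.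
      by move=> _ _; rewrite lee_fin.
    by move=> _; rewrite -EFinM lee_fin.
  rewrite nneseriesZl => [|n _]; last by rewrite lee_fin ltW.
  rewrite -mulrA [_^-1 * _]mulrC EFinM lee_pmul2l ?lte_fin//.
  rewrite EFinM; apply: lee_wpmul2l; first by rewrite lee_fin.
  by apply: geometric_nneseries_le => //; exact: ltW.
rewrite -(fineK Bfin) -/M -mp -EFinM lee_fin -exprMn lerXn2r// ?nnegrE//.
by rewrite mulr_ge0// ltW.
Qed.

End same_laws.

Section subordinator_moments.
Context {R : realType} d (Omega : measurableType d) (P : probability Omega R).
Variables (S : R -> Omega -> R) (Phi : R -> R).
Hypothesis subS : is_subordinator P S Phi.

Lemma subordinator_homo w t t' : 0 <= t -> t <= t' -> S t w <= S t' w.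
Proof. by case: subS => _ /(_ w)[_ + _] _ _ _; exact. Qed.

Lemma subordinator0 w : S 0 w = 0.
Proof. by case: subS => _ /(_ w)[+ _ _] _ _ _. Qed.

Lemma subordinator_ge0 w t : 0 <= t -> 0 <= S t w.
Proof. by move=> t0; rewrite -(subordinator0 w); exact: subordinator_homo. Qed.

Lemma measurable_subordinator t : 0 <= t -> measurable_fun setT (S t).
Proof. by case: subS => + _ _ _ _; exact. Qed.

Lemma measurable_exp_subordinator s t : 0 <= t ->
  measurable_fun setT (fun w => expR (- (s * S t w))).
Proof.
move=> t0; apply: (measurableT_comp (@measurable_expR R)).
apply: measurable_funN; apply: measurable_funM; first exact: measurable_cst.
exact: measurable_subordinator.
Qed.

Lemma subordinator_laplace t s : 0 <= t -> 0 <= s ->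
  (\int[P]_w (expR (- (s * S t w)))%:E = (expR (- (t * Phi s)))%:E)%E.
Proof. by case: subS => _ _ _ _; exact. Qed.

Lemma exp_subordinator_itv s t w : 0 <= s -> 0 <= t ->
  0 <= expR (- (s * S t w)) <= 1.
Proof.
move=> s0 t0; rewrite expR_ge0/= -expR0 ler_expR oppr_le0 mulr_ge0//.
exact: subordinator_ge0.
Qed.

Variables (alpha : R) (zeta : Omega -> beads R).
Hypothesis alpha_gt0 : 0 < alpha.
Hypothesis hz : {ae P, forall w, string_of_path alpha (S ^~ w) (zeta w)}.

(** A nonpositive exponent would give exp(- s S_n) a mean of at least 1, hence S_n = 0 almost surely
    for all n, which [path_not_zero] excludes. *)
Lemma subordinator_exponent_gt0 s : 0 < s -> 0 < Phi s.
Proof.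
move=> s0; rewrite ltNge; apply/negP => Ps.
have z (n : nat) : {ae P, forall w, S n%:R w = 0}.
  have n0 : (0 : R) <= n%:R by [].
  have : {ae P, forall w, expR (- (s * S n%:R w)) = 1}.
    apply: ae_eq1.
    - exact: measurable_exp_subordinator.
    - by move=> w; apply: exp_subordinator_itv => //; exact: ltW.
    - rewrite (subordinator_laplace n0 (ltW s0)) lee_fin -[leLHS]expR0 ler_expR oppr_ge0.
      by rewrite mulr_ge0_le0.
  apply: filterS => w; rewrite -[RHS]expR0 => /expR_inj/eqP.
  by rewrite oppr_eq0 mulf_eq0 gt_eqF//= => /eqP.
have /ae_foralln h := z.
have [w [w1 w2]] := ae_exists (filterI hz h).
apply: (path_not_zero alpha_gt0 (subordinator0 w) _ w1 w2).
exact: subordinator_homo.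
Qed.

Lemma len_moment (p : nat) : (0 < p)%N -> measurable_fun setT zeta ->
  (\int[P]_w (len (zeta w) ^+ p)%:E <=
   ((Gamma (1 - alpha) / (1 - expR (- (Phi (p%:R * alpha) / (2 * p%:R))))) ^+ p /
    (1 - expR (- (Phi (p%:R * alpha) / 2))))%:E)%E.
Proof.
move=> p0 mz; set F := Phi (p%:R * alpha).
have pR : (0 : R) < p%:R by rewrite ltr0n.
have pa0 : 0 < p%:R * alpha by exact: mulr_gt0.
have F0 : 0 < F by exact: subordinator_exponent_gt0.
(* The Laplace transform at time n is exp(- n F). Half of this rate is spent on the weights
   [r ^+ n], whose p-th power is exp(- n F / 2); the other half, [k], sums the series. *)
set r := expR (- (F / (2 * p%:R))); set k := expR (- (F / 2)).
have r0 : 0 < r := expR_gt0 _.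
have r1 : r < 1.
  by rewrite /r -[ltRHS]expR0 ltr_expR oppr_lt0; apply: divr_gt0 => //; exact: mulr_gt0.
have k0 : 0 < k := expR_gt0 _.
have k1 : k < 1 by rewrite /k -[ltRHS]expR0 ltr_expR oppr_lt0 divr_gt0.
have [w0 hw0] := ae_exists hz.
have G0 : 0 < Gamma (1 - alpha) := Gamma_string_gt0 hw0.
set G := Gamma _ in G0 *.
pose b (n : nat) w := expR (- ((p%:R * alpha) * S n%:R w)) * expR (n%:R * (F / 2)).
have b0 n w : 0 <= b n w by rewrite mulr_ge0 ?expR_ge0.
have mb n : measurable_fun setT (fun w => (b n w)%:E).
  apply/measurable_EFinP; apply: measurable_funM; last exact: measurable_cst.
  exact: measurable_exp_subordinator.
have c0 : (0 <= ((G / (1 - r)) ^+ p)%:E)%E.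
  by rewrite lee_fin exprn_ge0// divr_ge0 ?(ltW G0)// subr_ge0 ltW.
have msum : measurable_fun setT (fun w => \sum_(0 <= n <oo) (b n w)%:E)%E.
  by apply: ge0_emeasurable_sum => // n w _ _; rewrite lee_fin.
have sum0 w : (0 <= \sum_(0 <= n <oo) (b n w)%:E)%E.
  by apply: nneseries_ge0 => n _ _; rewrite lee_fin.
apply: (@le_trans _ _ (\int[P]_w (((G / (1 - r)) ^+ p)%:E *
    \sum_(0 <= n <oo) (b n w)%:E))%E).
  apply: ae_ge0_le_integral => //.
  - by move=> w _; rewrite lee_fin exprn_ge0// ltW// len_gt0.
  - apply/measurable_EFinP; apply: measurable_funX.
    exact: measurableT_comp measurable_len mz.
  - by move=> w _; exact: mule_ge0.
  - exact: measurable_funeM.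
  apply: filterS hz => w hw _.
  have := @nneseries_pow_le R p r G (len (zeta w))
    (fun n => expR (- (alpha * S n%:R w))) p0 r0 r1 G0 (ltW (len_gt0 _))
    (fun n => expR_ge0 _).
  have hS : forall t t', 0 <= t -> t <= t' -> S t w <= S t' w.
    by move=> t t'; exact: subordinator_homo.
  move=> /(_ (len_string_le alpha_gt0 hS hw)).
  rewrite (_ : (\sum_(0 <= n <oo) _)%E = (\sum_(0 <= n <oo) (b n w)%:E)%E)//.
  apply: eq_eseriesr => n _; congr EFin; rewrite /b /r.
  rewrite -expRM_natl -expRN -expRD -expRM_natl -expRD; congr expR.
  by field; rewrite gt_eqF.
rewrite ge0_integralZl// integral_nneseries//; last by move=> n w _; rewrite lee_fin.
rewrite EFinM; apply: lee_wpmul2l => //.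
rewrite (_ : (\sum_(0 <= n <oo) _)%E = (\sum_(0 <= n <oo) (k ^+ n)%:E)%E).
  by apply: geometric_nneseries_le => //; exact: ltW.
apply: eq_eseriesr => n _.
under eq_integral do rewrite EFinM.
rewrite ge0_integralZr//; last first.
  by apply/measurable_EFinP; exact: measurable_exp_subordinator.
rewrite (subordinator_laplace _ (ltW pa0))// -EFinM; congr EFin.
by rewrite /k -expRM_natl -expRD; congr expR; rewrite -/F; field.
Qed.

Let Y w := expR (- S 1 w).

Let YE (s : R) w : expR (- (s * S 1 w)) = Y w `^ s.
Proof. by rewrite /Y mulrC -mulNr expRM. Qed.

Let Y01 w : 0 <= Y w <= 1.
Proof. by have := @exp_subordinator_itv 1 1 w; rewrite mul1r; exact. Qed.

Let mY : measurable_fun setT Y.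
Proof.
have := @measurable_exp_subordinator 1 1 ler01.
by under eq_fun do rewrite mul1r.
Qed.

Let g w := 1 - Y w * (1 - Y w).

Let g01 w : 0 <= g w <= 1.
Proof.
have /andP[y0 y1] := Y01 w; rewrite /g lerBlDr lerDl subr_ge0.
by rewrite mulr_ile1 ?subr_ge0 ?mulr_ge0 ?subr_ge0// gerBl.
Qed.

Let mg : measurable_fun setT g.
Proof.
apply: measurable_funB; first exact: measurable_cst.
by apply: measurable_funM => //; apply: measurable_funB => //; exact: measurable_cst.
Qed.

Lemma integral_jump : (\int[P]_w (1 - expR (- S 1 w) * (1 - expR (- S 1 w)))%:E =
  (1 - (expR (- Phi 1) - expR (- Phi 2)))%:E)%E.
Proof.
have e1 : (\int[P]_w (Y w)%:E = (expR (- Phi 1))%:E)%E.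
  have := subordinator_laplace (t := 1) (s := 1) ler01 ler01.
  by rewrite mul1r => <-; apply: eq_integral => w _; rewrite mul1r.
have e2 : (\int[P]_w (Y w ^+ 2)%:E = (expR (- Phi 2))%:E)%E.
  have := subordinator_laplace (t := 1) (s := 2) ler01 (ler0n _ 2).
  by rewrite mul1r => <-; apply: eq_integral => w _; rewrite YE powR_mulrn ?expR_ge0.
have mYE : measurable_fun setT (fun w => (Y w)%:E) by exact/measurable_EFinP.
have mY2 : measurable_fun setT (fun w => (Y w ^+ 2)%:E).
  by apply/measurable_EFinP; exact: measurable_funX.
have mgE : measurable_fun setT (fun w => (g w)%:E) by exact/measurable_EFinP.
have Y0 w : (0 <= (Y w)%:E)%E by rewrite lee_fin; case/andP: (Y01 w).
have Y20 w : (0 <= (Y w ^+ 2)%:E)%E by rewrite lee_fin sqr_ge0.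
have g0 w : (0 <= (g w)%:E)%E by rewrite lee_fin; case/andP: (g01 w).
have : (\int[P]_w (g w)%:E + \int[P]_w (Y w)%:E = 1 + \int[P]_w (Y w ^+ 2)%:E)%E.
  rewrite -[X in _ = (X + _)%E](integral_one P) -!ge0_integralD//.
  apply: eq_integral => w _; rewrite -!EFinD; congr EFin; rewrite /g; ring.
rewrite e1 e2 -/g => /(congr1 (fun x => (x - (expR (- Phi 1))%:E)%E)).
rewrite addeK// => ->; rewrite -!EFinD; congr EFin.
by move: (expR (- Phi 1)) (expR (- Phi 2)) => a b; ring.
Qed.

(** Otherwise the mean of 1 - Y (1 - Y) reaches its upper bound 1, so Y (1 - Y) = 0 and Y = 1 almost
    surely, against the positivity of the exponent at 1. *)
Lemma exponent12 : expR (- Phi 2) < expR (- Phi 1).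
Proof.
rewrite ltNge; apply/negP => h.
have z : {ae P, forall w, g w = 1}.
  apply: ae_eq1 => //; rewrite /g integral_jump lee_fin.
  by move: h; move: (expR (- Phi 1)) (expR (- Phi 2)) => a b; lra.
have : (1 <= \int[P]_w (Y w)%:E)%E.
  rewrite -(integral_one P); apply: ae_ge0_le_integral => //.
  - by move=> w _; rewrite lee_fin; case/andP: (Y01 w).
  - exact/measurable_EFinP.
  apply: filterS z => w + _; rewrite lee_fin /g => e.
  have : 0 < Y w := expR_gt0 _.
  move=> y0; have /eqP : Y w * (1 - Y w) = 0 by move: e; lra.
  by rewrite mulf_eq0 gt_eqF//= subr_eq0 => /eqP <-.
have -> : (\int[P]_w (Y w)%:E = (expR (- Phi 1))%:E)%E.
  have := subordinator_laplace (t := 1) (s := 1) ler01 ler01.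
  by rewrite mul1r => <-; apply: eq_integral => w _; rewrite mul1r.
rewrite lee_fin -[leLHS]expR0 ler_expR oppr_ge0 leNgt.
by rewrite subordinator_exponent_gt0.
Qed.

Lemma mass_mean : measurable_fun setT zeta ->
  (\int[P]_w (mass (zeta w) 0%N)%:E <=
   (1 - (expR (- Phi 1) - expR (- Phi 2)))%:E)%E.
Proof.
move=> mz; rewrite -integral_jump; apply: ae_ge0_le_integral => //.
- by move=> w _; rewrite lee_fin mass_ge0.
- apply/measurable_EFinP; exact: measurableT_comp (measurable_mass 0%N) mz.
- by move=> w _; rewrite lee_fin; case/andP: (g01 w).
- exact/measurable_EFinP.
apply: filterS hz => w hw _; rewrite lee_fin.
apply: (mass_string_le alpha_gt0 (subordinator0 w) _ hw).
by move=> t t'; exact: subordinator_homo.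
Qed.

End subordinator_moments.

Section string_moments.
Context {R : realType} (alpha theta : R).
Hypothesis alpha_gt0 : 0 < alpha.
Local Notation Phi := (@laplace_exponent R alpha theta).

(* The bound only depends on the law of the string: [C] is chosen before the
   probability space. *)
Lemma string_len_moment (p : nat) : (0 < p)%N -> exists C : R,
  forall d (Omega : measurableType d) (P : probability Omega R) xi,
  is_string P alpha theta xi -> (\int[P]_w (len (xi w) ^+ p)%:E <= C%:E)%E.
Proof.
move=> p0; eexists => d Omega P xi [mxi [d' [V [P' [S [zeta [subS mz hz sl]]]]]]].
rewrite (same_law_integral mxi mz sl (f := fun s => (len s ^+ p)%:E)).
- exact: (len_moment subS alpha_gt0 hz p0 mz).
- by apply/measurable_EFinP; apply: measurable_funX; exact: measurable_len.
- by move=> s; rewrite lee_fin exprn_ge0// ltW// len_gt0.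
Qed.

Lemma string_mass_mean : exists2 rho : R, 0 < rho < 1 &
  forall d (Omega : measurableType d) (P : probability Omega R) xi,
  is_string P alpha theta xi -> (\int[P]_w (mass (xi w) 0%N)%:E <= rho%:E)%E.
Proof.
set rho := 1 - (expR (- Phi 1) - expR (- Phi 2)).
have H d (Omega : measurableType d) (P : probability Omega R) xi :
    is_string P alpha theta xi -> (\int[P]_w (mass (xi w) 0%N)%:E <= rho%:E)%E /\ rho < 1.
  move=> [mxi [d' [V [P' [S [zeta [subS mz hz sl]]]]]]]; split.
    rewrite (same_law_integral mxi mz sl (f := fun s => (mass s 0%N)%:E)).
    - exact: (mass_mean subS alpha_gt0 hz mz).
    - by apply/measurable_EFinP; exact: measurable_mass.
    - by move=> s; rewrite lee_fin mass_ge0.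
  have := exponent12 subS alpha_gt0 hz; rewrite /rho.
  by move: (expR (- Phi 1)) (expR (- Phi 2)) => a b; lra.
(* [rho] is determined by the parameters alone. If it is not below 1, [H] shows that no string with
   these parameters exists and any constant will do; otherwise the maximum with 1/2 makes it
   positive. *)
have [r1|r1] := ltP rho 1; last first.
  exists 2^-1 => [|d O P xi /H[_]]; first by apply/andP; split; lra.
  by rewrite ltNge r1.
exists (Num.max rho 2^-1) => [|d O P xi /H[h _]].
  by rewrite lt_max gt_max r1/=; apply/andP; split; [apply/orP; right|]; lra.
by apply: le_trans h _; rewrite lee_fin le_max lexx.
Qed.

End string_moments.

Section mean_bounds.
Context d (Omega : measurableType d) {R : realType} (P : probability Omega R).

(** Markov's inequality, with the lower bound on [A] assumed almost everywhere. *)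
Lemma le_mean (f : Omega -> R) (A : set Omega) (c : R) : 0 <= c ->
  measurable A -> measurable_fun setT f -> (forall w, 0 <= f w) ->
  {ae P, forall w, A w -> c <= f w} -> (c%:E * P A <= \int[P]_w (f w)%:E)%E.
Proof.
move=> c0 mA mf f0 cf.
rewrite -[A in P A]setIT -integral_indic// -ge0_integralZl//; last first.
  by apply/measurable_EFinP; exact: measurable_indic.
apply: ae_ge0_le_integral => //.
- by move=> w _; rewrite mule_ge0// lee_fin.
- by apply: measurable_funeM; apply/measurable_EFinP; exact: measurable_indic.
- by move=> w _; rewrite lee_fin.
- exact/measurable_EFinP.
apply: filterS cf => w h _; rewrite -EFinM lee_fin indicE.
by have [/set_mem/h|_] := boolP (w \in A); rewrite ?mulr1// mulr0.
Qed.

Lemma mean_onem (f : Omega -> R) : measurable_fun setT f ->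
  (forall w, 0 <= f w <= 1) ->
  (\int[P]_w (1 - f w)%:E + \int[P]_w (f w)%:E = 1)%E.
Proof.
move=> mf f01.
have mf1 : measurable_fun setT (fun w => (1 - f w)%:E).
  by apply/measurable_EFinP; apply: measurable_funB => //; exact: measurable_cst.
rewrite -ge0_integralD//.
- under eq_integral do rewrite -EFinD subrK.
  exact: integral_one.
- by move=> w _; rewrite lee_fin subr_ge0; case/andP: (f01 w).
- by move=> w _; rewrite lee_fin; case/andP: (f01 w).
- exact/measurable_EFinP.
Qed.

End mean_bounds.

(** * Mixed strings *)

Section mixtures.
Context {R : realType}.
Implicit Type s : beads R.

Lemma len_mixture_le (beta b : R) s1 s2 s : 0 < b < 1 -> 0 < beta ->
  mixture_of beta b s1 s2 s -> len s <= len s1 + len s2.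
Proof.
move=> /andP[b0 b1] beta0 [-> _].
have pow1 (c : R) : 0 < c -> c < 1 -> c `^ beta <= 1.
  move=> c0 c1; rewrite -[leRHS](powRr0 c); by apply: ger_powR; rewrite ?(ltW beta0)// c0 ltW.
apply: lerD; rewrite -[leRHS]mul1r ler_wpM2r ?(ltW (len_gt0 _))// pow1//; lra.
Qed.

(** Atoms of both strings may meet at one place. There the first string contributes at most [b]
    times its heaviest bead, the second at most its whole share [1 - b]. *)
Lemma mass_mixture_le (beta b : R) s1 s2 s : 0 < b < 1 ->
  mixture_of beta b s1 s2 s -> mass s 0%N <= 1 - b * (1 - mass s1 0%N).
Proof.
move=> /andP[b0 b1] [_ /(_ [set loc s 0%N])].
move=> /(_ (measurable_set1 _)) e; rewrite -lee_fin.
apply: (le_trans (mass_le_measure s 0%N)); rewrite e.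
have -> : (fun x : R => b `^ beta * x) @^-1` [set loc s 0%N] =
    [set loc s 0%N / b `^ beta].
  have pb : b `^ beta != 0 by rewrite gt_eqF// powR_gt0.
  apply/seteqP; split=> x /=; first by move=> <-; rewrite mulrC mulKf.
  by move=> ->; rewrite mulrC divfK.
apply: (@le_trans _ _ (b%:E * (mass s1 0%N)%:E + (1 - b)%:E * 1)%E).
  apply: leeD; apply: lee_wpmul2l.
  - by rewrite lee_fin ltW.
  - exact: beads_measure_set1.
  - by rewrite lee_fin subr_ge0 ltW.
  - exact: beads_measure_le1.
by rewrite mule1 -EFinM -EFinD lee_fin; lra.
Qed.

Lemma powD_le (p : nat) (a b : R) : 0 <= a -> 0 <= b ->
  (a + b) ^+ p <= 2 ^+ p * (a ^+ p + b ^+ p).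
Proof.
move=> a0 b0.
wlog ab : a b a0 b0 / a <= b.
  move=> h; have [/h|/ltW/h] := leP a b; first exact.
  by rewrite addrC [b ^+ p + _]addrC; exact.
apply: (@le_trans _ _ ((2 * b) ^+ p)).
  by rewrite lerXn2r ?nnegrE ?addr_ge0 ?mulr_ge0//; lra.
by rewrite exprMn ler_wpM2l ?exprn_ge0// lerDr exprn_ge0.
Qed.

End mixtures.

Section beta_law.
Context {R : realType}.

(** The right-hand side of [has_beta_law] as a set function. It refers to no probability space, so
    constants drawn from it are common to all mixed strings. *)
Definition beta_measure (a b : R) (A : set R) : \bar R :=
  ((Gamma (a + b) / (Gamma a * Gamma b))%:E *
   \int[@lebesgue_measure R]_(x in A `&` `]0%R, 1%R[)
     (x `^ (a - 1) * (1 - x) `^ (b - 1))%R%:E)%E.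

Context d (Omega : measurableType d) (P : probability Omega R).
Variables (B : Omega -> R) (a b : R).
Hypothesis hB : has_beta_law P B a b.

Lemma beta_law_itv : {ae P, forall w, 0 < B w < 1}.
Proof.
have [mB PB] := hB.
exists (B @^-1` (~` `]0, 1[)); split.
- by rewrite -[X in measurable X]setTI; apply: mB => //; exact: measurableC.
- rewrite PB; last exact: measurableC.
  by rewrite setICl integral_set0 mule0.
- by move=> w /= h; rewrite in_itv.
Qed.

(** [B] is positive almost surely, so it cannot stay below 1/(n+1) for every n. *)
Lemma beta_law_ge : exists n : nat, (0 < beta_measure a b `[n.+1%:R^-1%R, +oo[%classic)%E.
Proof.
have [mB PB] := hB; apply: contrapT => h.
have z n : P (B @^-1` `[n.+1%:R^-1, +oo[) = 0%E :> \bar R.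
  rewrite PB//; apply/eqP; rewrite eq_le; apply/andP; split.
    by rewrite leNgt; apply/negP => h'; apply: h; exists n.
  by rewrite -PB.
have /ae_foralln : forall n, {ae P, forall w, B w < n.+1%:R^-1}.
  move=> n; exists (B @^-1` `[n.+1%:R^-1, +oo[); split => //.
    by rewrite -[X in measurable X]setTI; apply: mB.
  by move=> w /= /negP; rewrite -leNgt in_itv/= andbT.
move=> /(filterI beta_law_itv)/ae_exists[w [/andP[Bw _] small]].
have [n] := ltr_add_invr Bw; rewrite add0r => /(lt_trans (small n)).
by rewrite ltxx.
Qed.

End beta_law.

Section mixed_moments.
Context {R : realType} (beta : R).
Hypotheses (beta_gt0 : 0 < beta).

Lemma mixed_len_moment (p : nat) : (0 < p)%N -> exists C : R,
  forall d (Omega : measurableType d) (P : probability Omega R) xi,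
  is_mixed_string P beta xi -> (\int[P]_w (len (xi w) ^+ p)%:E <= C%:E)%E.
Proof.
move=> p0; rewrite /is_mixed_string; case: eqP => [_|_].
  by apply: string_len_moment => //; rewrite invr_gt0.
have [C1 h1] := string_len_moment (1 - 2 * beta) beta_gt0 p0.
have [C2 h2] := string_len_moment beta beta_gt0 p0.
exists (2 ^+ p * (C1 + C2)) => d Omega P xi [mxi].
move=> [d' [V [P' [z1 [z2 [B [z [[sz1 sz2] hB _ [mz hz] sl]]]]]]]].
have ml (x : V -> beads R) : measurable_fun setT x ->
    measurable_fun setT (fun w => (len (x w) ^+ p)%:E).
  move=> mx; apply/measurable_EFinP; apply: measurable_funX.
  exact: measurableT_comp measurable_len mx.
have l0 (x : V -> beads R) w : (0 <= (len (x w) ^+ p)%:E)%E.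
  by rewrite lee_fin exprn_ge0// ltW// len_gt0.
rewrite (same_law_integral mxi mz sl (f := fun s => (len s ^+ p)%:E)); last 2 first.
- by apply/measurable_EFinP; apply: measurable_funX; exact: measurable_len.
- by move=> s; rewrite lee_fin exprn_ge0// ltW// len_gt0.
apply: (@le_trans _ _ (\int[P']_w ((2 ^+ p)%:E *
    ((len (z1 w) ^+ p)%:E + (len (z2 w) ^+ p)%:E)))%E).
  apply: ae_ge0_le_integral => //.
  - exact: ml.
  - by move=> w _; rewrite mule_ge0 ?adde_ge0// lee_fin exprn_ge0.
  - by apply: measurable_funeM; apply: emeasurable_funD; apply: ml; [case: sz1|case: sz2].
  apply: filterS (filterI (beta_law_itv hB) hz) => w [b01 hw] _.
  have le12 := len_mixture_le b01 beta_gt0 hw.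
  rewrite -EFinD -EFinM lee_fin; apply: le_trans (powD_le _ _ _); rewrite ?(ltW (len_gt0 _))//.
  by rewrite lerXn2r// nnegrE ?addr_ge0// ltW// len_gt0.
rewrite ge0_integralZl//; last 2 first.
- by apply: emeasurable_funD; apply: ml; [case: sz1|case: sz2].
- by move=> w _; rewrite adde_ge0.
rewrite ge0_integralD//; last 2 first.
- by apply: ml; case: sz1.
- by apply: ml; case: sz2.
rewrite EFinM EFinD; apply: lee_wpmul2l; first by rewrite lee_fin exprn_ge0.
by apply: leeD; [exact: h1|exact: h2].
Qed.

(** The gain in [mass_mixture_le] carries the factor [B], which may be arbitrarily small. The mean
    is therefore estimated on an event where [B] and the gain of the first string are both bounded
    below; independence gives this event positive probability. *)
Lemma mixed_mass_mean : exists2 rho : R, 0 < rho < 1 &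
  forall d (Omega : measurableType d) (P : probability Omega R) xi,
  is_mixed_string P beta xi -> (\int[P]_w (mass (xi w) 0%N)%:E <= rho%:E)%E.
Proof.
have [b2|b2] := eqVneq beta 2^-1.
  by rewrite /is_mixed_string b2 eqxx; apply: string_mass_mean; rewrite invr_gt0.
have [r /andP[r0 r1] hr] := string_mass_mean (1 - 2 * beta) beta_gt0.
(* The threshold on [B] has to be chosen before the probability space. If none works, no mixed
   string exists and the bound is vacuous. *)
have [[n Fn]|noF] := pselect (exists n : nat,
    (0 < beta_measure (1 - 2 * beta)%R beta `[n.+1%:R^-1%R, +oo[%classic)%E); last first.
  exists 2^-1 => [|d Omega P xi]; first by apply/andP; split; lra.
  rewrite /is_mixed_string (negbTE b2) => -[_].
  move=> [d' [V [P' [z1 [z2 [B [z [_ hB]]]]]]]].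
  by exfalso; apply: noF; exact: beta_law_ge hB.
set F := beta_measure _ _ _ in Fn.
(* The cut [1 - e] lies midway between [r] and 1, so that by Markov's inequality the heaviest bead
   of the first string stays below it with probability at least [k > 0]. *)
set q := fine F; set e := (1 - r) / 2; set dl : R := n.+1%:R^-1.
have dl0 : 0 < dl by rewrite invr_gt0.
have dl1 : dl <= 1 by rewrite invf_le1 ?ler1n.
have e0 : 0 < e by rewrite /e; lra.
have e1 : 1 - e = (1 + r) / 2 by rewrite /e; field.
have e1' : 0 < 1 - e by rewrite e1; lra.
set k := 1 - r / (1 - e).
have k0 : 0 < k by rewrite subr_gt0 ltr_pdivrMr// mul1r e1; lra.
have k1 : k < 1 by rewrite /k ltrBlDr ltrDl divr_gt0.
(* With probability at least [k * q], [B] is at least [dl] and, independently,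
   no bead of the first string is heavier than [1 - e]. *)
have main d (Omega : measurableType d) (P : probability Omega R) xi :
  is_mixed_string P beta xi ->
  0 < q <= 1 /\ (\int[P]_w (mass (xi w) 0%N)%:E <= (1 - dl * e * (k * q))%:E)%E.
  rewrite /is_mixed_string (negbTE b2).
  move=> [mxi [d' [V [P' [z1 [z2 [B [z [[sz1 sz2] hB ind [mz hz] sl]]]]]]]]].
  have [mB PB] := hB; have mz1 : measurable_fun setT z1 by case: sz1.
  have FE : P' (B @^-1` `[dl, +oo[) = F by rewrite PB.
  have mBd : measurable (B @^-1` `[dl, +oo[).
    by rewrite -[X in measurable X]setTI; exact: mB.
  have qE : F = q%:E by rewrite /q fineK// -FE; apply: fin_num_measure.
  have q0 : 0 < q by rewrite -lte_fin -qE.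
  have q1 : q <= 1 by rewrite -lee_fin -qE -FE probability_le1.
  split; first by rewrite q0.
  rewrite (same_law_integral mxi mz sl (f := fun s => (mass s 0%N)%:E)); last 2 first.
  - by apply/measurable_EFinP; exact: measurable_mass.
  - by move=> s; rewrite lee_fin mass_ge0.
  pose A1 : set (beads R) := [set s | mass s 0%N <= 1 - e].
  have mA1 : measurable A1.
    have := @measurable_mass R 0%N measurableT _ (measurable_itv `]-oo, 1 - e]).
    by rewrite setTI (_ : _ @^-1` _ = A1)//; apply/seteqP; split=> s; rewrite /A1/= in_itv.
  have mA1' : measurable (z1 @^-1` A1).
    by rewrite -[X in measurable X]setTI; exact: mz1.
  have kP : (k%:E <= P' (z1 @^-1` A1))%E.
    have mC : measurable (~` (z1 @^-1` A1)) by exact: measurableC.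
    have : ((1 - e)%:E * P' (~` (z1 @^-1` A1)) <= r%:E)%E.
      apply: le_trans (hr _ _ _ _ sz1); apply: le_mean => //.
      - exact: ltW.
      - exact: measurableT_comp (measurable_mass 0%N) mz1.
      - by move=> w; exact: mass_ge0.
      - by apply: nearW => w /= /negP; rewrite -ltNge => /ltW.
    have -> : P' (~` (z1 @^-1` A1)) = (1 - P' (z1 @^-1` A1))%E by exact: probability_setC.
    have /fineK <- : P' (z1 @^-1` A1) \is a fin_num by exact: fin_num_measure.
    rewrite -EFinB -EFinM !lee_fin mulrC -ler_pdivlMr// /k.
    by move: (fine _) (r / (1 - e)) => x y; lra.
  pose A := z1 @^-1` A1 `&` z2 @^-1` setT `&` B @^-1` `[dl, +oo[.
  have mA : measurable A.
    by apply: measurableI => //; rewrite preimage_setT setIT.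
  have PA : ((k * q)%:E <= P' A)%E.
    rewrite /A ind// preimage_setT probability_setT mule1 FE qE EFinM.
    by apply: lee_wpmul2r => //; rewrite lee_fin ltW.
  have mz0 : measurable_fun setT (fun w => mass (z w) 0%N).
    exact: measurableT_comp (measurable_mass 0%N) mz.
  have z01 w : 0 <= mass (z w) 0%N <= 1 by rewrite mass_ge0 mass0_le1.
  have de0 : 0 <= dl * e by rewrite mulr_ge0// ltW.
  have : ((dl * e * (k * q))%:E + \int[P']_w (mass (z w) 0%N)%:E <= 1)%E.
    rewrite -(mean_onem P' mz0 z01); apply: leeD => //.
    rewrite EFinM; apply: (@le_trans _ _ ((dl * e)%:E * P' A)%E).
      by apply: lee_wpmul2l; rewrite ?lee_fin.
    apply: le_mean => //.
    - by apply: measurable_funB => //; exact: measurable_cst.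
    - by move=> w; rewrite subr_ge0 mass0_le1.
    apply: filterS (filterI (beta_law_itv hB) hz) => w [b01 hw].
    rewrite /A /A1 /= in_itv/= andbT => -[[m1 _] dB].
    have := mass_mixture_le b01 hw.
    have : dl * e <= B w * (1 - mass (z1 w) 0%N).
      by rewrite ler_pM ?(ltW dl0) ?(ltW e0)//; lra.
    by move=> h1 h2; lra.
  by rewrite EFinB leeBrDl.
have [q01|nq] := pselect (0 < q <= 1).
  have /andP[q0 q1] := q01.
  exists (1 - dl * e * (k * q)) => [|d Omega P xi /main[]//].
  have x0 : 0 < dl * e * (k * q) by apply: mulr_gt0; apply: mulr_gt0.
  rewrite gtrBl x0 andbT subr_gt0.
  have de1 : dl * e < 1.
    have e12 : e < 1 by rewrite /e; lra.
    by rewrite (le_lt_trans (ler_piMl (ltW e0) dl1)).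
  have kq1 : k * q <= 1 by rewrite mulr_ile1// ltW.
  by rewrite (le_lt_trans _ de1)// ler_piMr// mulr_ge0// ltW.
exists 2^-1 => [|d Omega P xi /main[]//]; apply/andP; split; lra.
Qed.

End mixed_moments.

(** * Independence and tightness *)

Section independence.
Context d (Omega : measurableType d) {R : realType} (P : probability Omega R).
Context d' (E : measurableType d').
Local Open Scope ereal_scope.
Import HBNNSimple.

(** Simple functions and monotone convergence extend the factorisation from indicators to
    nonnegative functions of [X], with the other factor [g] kept fixed. *)
Lemma mean_factor (X : Omega -> E) (g : Omega -> R) (c : \bar R)
    (f : E -> R) :
  measurable_fun setT X -> measurable_fun setT g -> (forall w, 0 <= g w)%R ->
  c \is a fin_num -> measurable_fun setT f -> (forall x, 0 <= f x)%R ->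
  (forall A, measurable A ->
    \int[P]_w ((g w)%:E * (\1_A (X w))%:E) = c * P (X @^-1` A)) ->
  \int[P]_w ((g w)%:E * (f (X w))%:E) = c * \int[P]_w (f (X w))%:E.
Proof.
move=> mX mg g0 cfin mf f0 gX.
have mfE : measurable_fun setT (EFin \o f) by exact/measurable_EFinP.
have mgE : measurable_fun setT (EFin \o g) by exact/measurable_EFinP.
pose h := nnsfun_approx measurableT mfE.
have h0 n x : (0 <= h n x)%R by exact: fun_ge0.
have mh n : measurable_fun setT (fun w => (h n (X w))%:E).
  by apply/measurable_EFinP; exact: measurableT_comp mX.
have nd_h w : {homo (fun n => (h n (X w))%:E) : n m / (n <= m)%N >-> n <= m}.
  by move=> n m nm; rewrite lee_fin; have /lefP := nd_nnsfun_approx measurableT mfE nm; exact.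
have cvg_h w : (h n (X w))%:E @[n --> \oo] --> (f (X w))%:E.
  by apply: (cvg_nnsfun_approx measurableT mfE) => // x _; rewrite lee_fin.
have cvgf : \int[P]_w (h n (X w))%:E @[n --> \oo] --> \int[P]_w (f (X w))%:E.
  rewrite -(eq_integral _ _ (fun w _ => cvg_lim _ (cvg_h w)))//.
  by apply: cvg_monotone_convergence => // n w _; rewrite lee_fin.
have cvggf : \int[P]_w ((g w)%:E * (h n (X w))%:E) @[n --> \oo] -->
    \int[P]_w ((g w)%:E * (f (X w))%:E).
  have cvg_gh w : (g w)%:E * (h n (X w))%:E @[n --> \oo] --> (g w)%:E * (f (X w))%:E.
    by apply: cvgeZl.
  rewrite -(eq_integral _ _ (fun w _ => cvg_lim _ (cvg_gh w)))//.
  apply: cvg_monotone_convergence => //.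
  - by move=> n; apply: emeasurable_funM.
  - by move=> n w _; apply: mule_ge0 => //; rewrite lee_fin.
  - by move=> w _ n m nm; apply: lee_wpmul2l; [rewrite lee_fin|exact: nd_h].
apply: (cvg_unique _ cvggf) => //.
suff -> : (fun n => \int[P]_w ((g w)%:E * (h n (X w))%:E)) =
    (fun n => c * \int[P]_w (h n (X w))%:E) by exact: cvgeZl.
apply/funext => n.
pose s : seq R := finmap.enum_fset (fset_set (range (h n))).
(* The maximum makes the coefficients nonnegative for every real [y]; on the range of [h n] it
   changes nothing. *)
have hE w : (h n (X w))%:E = \sum_(y <- s)
    (Num.max 0 y)%:E * (\1_(h n @^-1` [set y]) (X w))%:E.
  rewrite {1}fimfunE fsbig_finite//= -sumEFin; apply: eq_big_seq => y.
  rewrite in_fset_set// inE => -[x _ <-]; rewrite -EFinM.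
  by congr (_ * _)%:E; apply/esym/max_idPr.
have mi y : measurable_fun setT (fun w => (\1_(h n @^-1` [set y]) (X w))%:E : \bar R).
  by apply/measurable_EFinP; exact: measurableT_comp mX.
have max0 (y : R) : (0 <= Num.max 0 y)%R by rewrite le_max lexx.
transitivity (\int[P]_w \sum_(y <- s)
    (Num.max 0 y)%:E * ((g w)%:E * (\1_(h n @^-1` [set y]) (X w))%:E)).
  apply: eq_integral => w _; rewrite hE ge0_sume_distrr; last first.
    by move=> y _; rewrite mule_ge0// lee_fin.
  by apply: eq_bigr => y _; rewrite muleCA.
rewrite ge0_integral_sum//; last 2 first.
- by move=> y; apply: measurable_funeM; exact: emeasurable_funM.
- by move=> y w _; rewrite !mule_ge0// lee_fin.
under [in RHS]eq_integral do rewrite hE.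
rewrite ge0_integral_sum//; last 2 first.
- by move=> y; exact: measurable_funeM.
- by move=> y w _; rewrite mule_ge0// lee_fin.
rewrite ge0_sume_distrr; last first.
  by move=> y _; apply: integral_ge0 => w _; rewrite mule_ge0// lee_fin.
apply: eq_bigr => y _.
have mgi : measurable_fun setT (fun w => (g w)%:E * (\1_(h n @^-1` [set y]) (X w))%:E).
  exact: emeasurable_funM.
rewrite (ge0_integralZl P measurableT mgi) ?lee_fin//; last first.
  by move=> w _; rewrite mule_ge0// lee_fin.
rewrite (ge0_integralZl P measurableT (mi y)) ?lee_fin//.
rewrite gX// muleCA; congr (_ * (_ * _)).
rewrite (_ : (fun w => _) = (fun w => (\1_(X @^-1` (h n @^-1` [set y])) w)%:E))//.
rewrite integral_indic ?setIT//.
by rewrite -[X in measurable X]setTI; apply: mX.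
Qed.

Context (I : eqType) (X : I -> Omega -> E) (f : I -> E -> R).
Hypothesis indX : mutually_independent P X.
Hypothesis mX : forall i, measurable_fun setT (X i).
Hypothesis mf : forall i, measurable_fun setT (f i).
Hypothesis f0 : forall i x, (0 <= f i x)%R.

(* The factors are replaced by indicators one at a time. *)
Let independent_mean_indic (J K : seq I) (A : I -> set E) : uniq (J ++ K) ->
  {in J, forall i, \int[P]_w (f i (X i w))%:E \is a fin_num} ->
  (forall i, measurable (A i)) ->
  \int[P]_w ((\prod_(i <- J) f i (X i w)) * (\prod_(i <- K) \1_(A i) (X i w)))%R%:E =
  (\prod_(i <- J) \int[P]_w (f i (X i w))%:E) * (\prod_(i <- K) P (X i @^-1` A i)).
Proof.
elim: J K A => [|j J IH] K A /= uJK finJ mA.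
  rewrite big_nil mul1e -indX//.
  under eq_integral do rewrite big_nil mul1r.
  transitivity (\int[P]_w (\1_(\big[setI/setT]_(i <- K) (X i @^-1` A i)) w)%:E).
    apply: eq_integral => w _; congr EFin; elim: {uJK} K => [|k K IHK].
      by rewrite !big_nil indicT.
    by rewrite !big_cons IHK indicI.
  rewrite integral_indic ?setIT//.
  apply: bigsetI_measurable => i _.
  by rewrite -[X in measurable X]setTI; exact: mX.
rewrite big_cons -muleA.
pose g w := ((\prod_(i <- J) f i (X i w)) * (\prod_(i <- K) \1_(A i) (X i w)))%R.
pose c := (\prod_(i <- J) \int[P]_w (f i (X i w))%:E) * (\prod_(i <- K) P (X i @^-1` A i)).
have -> : \int[P]_w ((\prod_(i <- j :: J) f i (X i w)) *
    (\prod_(i <- K) \1_(A i) (X i w)))%R%:E = \int[P]_w ((g w)%:E * (f j (X j w))%:E).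
  by apply: eq_integral => w _; rewrite big_cons -EFinM /g; congr EFin; ring.
rewrite (@mean_factor (X j) g c (f j))//.
- by rewrite muleC.
- by apply: measurable_funM; apply: measurable_prod => i _;
    apply: measurableT_comp (mX i) => //; exact: measurable_indic.
- by move=> w; rewrite /g mulr_ge0// prodr_ge0.
- rewrite fin_numM//.
    by rewrite big_seq; apply: prode_fin_num => i iJ; apply: finJ; rewrite inE iJ orbT.
  apply: prode_fin_num => i _; apply: fin_num_measure.
  by rewrite -[X in measurable X]setTI; exact: mX.
move=> B mB; have /andP[jJK uJK'] := uJK.
(* The factor at [j] has become an indicator, so [j] moves from [J] to [K] and the induction
   hypothesis applies. *)
pose A' i := if i == j then B else A i.
have notj i : i \in J ++ K -> (i == j) = false.
  by move=> iJK; apply: contraNF jJK => /eqP <-.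
have := IH (j :: K) A'; rewrite !big_cons /A' eqxx.
have -> : \prod_(i <- K) P (X i @^-1` (if i == j then B else A i)) =
    \prod_(i <- K) P (X i @^-1` A i).
  by apply: eq_big_seq => i iK; rewrite notj// mem_cat iK orbT.
move=> h; rewrite /c -muleA [X in _ = _ * X]muleC -h.
- apply: eq_integral => w _; rewrite -EFinM /g big_cons eqxx; congr EFin.
  rewrite -mulrA [X in _ = (_ * X)%R]mulrC; congr (_ * (_ * _))%R.
  by apply: eq_big_seq => i iK; rewrite notj// mem_cat iK orbT.
- by rewrite (perm_uniq (permEl (perm_catCA J [:: j] K))).
- by move=> i iJ; apply: finJ; rewrite inE iJ orbT.
- by move=> i; case: ifP.
Qed.

Lemma independent_mean (J : seq I) : uniq J ->
  {in J, forall i, \int[P]_w (f i (X i w))%:E \is a fin_num} ->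
  \int[P]_w (\prod_(i <- J) f i (X i w))%R%:E = \prod_(i <- J) \int[P]_w (f i (X i w))%:E.
Proof.
move=> uJ finJ; have := @independent_mean_indic J [::] (fun=> setT).
rewrite cats0 big_nil mule1 => <- //.
by under [in RHS]eq_integral do rewrite big_nil mulr1.
Qed.

End independence.

Section countable_sums.
Context {R : realType}.
Local Open Scope ereal_scope.

Lemma esum_pickle (T : countType) (a : T -> \bar R) : (forall t, 0 <= a t) ->
  \esum_(t in [set: T]) a t = \sum_(0 <= k <oo) oapp a 0 (pickle_inv k).
Proof.
move=> a0; have b0 k : 0 <= oapp a 0 (@pickle_inv T k) by case: pickle_inv => /=.
rewrite nneseries_esumT//.
rewrite (esumID (range (@pickle T)))//.
rewrite [X in _ + X]esum1 => [|k [_ nk]]; last first.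
  case e : (pickle_inv k) => [t|]//=; exfalso; apply: nk; exists t => //.
  by have := @pickle_invK T k; rewrite e.
rewrite adde0 setTI (@reindex_esum _ _ _ setT _ (@pickle T)); last first.
  split=> [t _|t t' _ _|k [t _ <-]]; [by exists t|exact: (pcan_inj pickleK)|by exists t].
by apply: eq_esum => t _; rewrite pickleK_inv.
Qed.

Lemma measurable_esum d (Omega : measurableType d) (T : countType)
    (a : T -> Omega -> \bar R) :
  (forall t, measurable_fun setT (a t)) -> (forall t w, 0 <= a t w) ->
  measurable_fun setT (fun w => \esum_(t in [set: T]) a t w).
Proof.
move=> ma a0; under eq_fun do rewrite esum_pickle//.
apply: ge0_emeasurable_sum => k; first by case: pickle_inv => /=.
by move=> _; case: pickle_inv => [t|]/=; [exact: ma|exact: measurable_cst].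
Qed.

Lemma integral_esum d (Omega : measurableType d) (P : probability Omega R)
    (T : countType) (a : T -> Omega -> \bar R) :
  (forall t, measurable_fun setT (a t)) -> (forall t w, 0 <= a t w) ->
  \int[P]_w (\esum_(t in [set: T]) a t w) = \esum_(t in [set: T]) \int[P]_w a t w.
Proof.
move=> ma a0; rewrite esum_pickle; last by move=> t; exact: integral_ge0.
under eq_integral do rewrite esum_pickle//.
rewrite integral_nneseries//.
- by apply: eq_eseriesr => k _; case: pickle_inv => //=; rewrite integral0.
- by move=> k; case: pickle_inv => [t|]/=; [exact: ma|exact: measurable_cst].
- by move=> k w _; case: pickle_inv => /=.
Qed.

Lemma esum_finite_off (T : choiceType) (a : T -> R) (e : R) :
  (forall t, 0 <= a t)%R -> (0 < e)%R ->
  \esum_(t in [set: T]) (a t)%:E < +oo ->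
  exists W : seq T, forall t, t \notin W -> (a t <= e)%R.
Proof.
move=> a0 e0 fin; have aE t : 0 <= (a t)%:E by rewrite lee_fin.
have Sfin : \esum_(t in [set: T]) (a t)%:E \is a fin_num.
  by rewrite ge0_fin_numE ?esum_ge0.
have [_ [X [Xfin _] <-]] := ub_ereal_sup_adherent e0 Sfin.
rewrite -esum_fset// -[ereal_sup _]/(\esum_(t in [set: T]) (a t)%:E) => h.
exists (finmap.enum_fset (fset_set X)) => t tX.
have Xt : ~ X t by move=> Xt; move: tX; rewrite in_fset_set// mem_set.
rewrite -lee_fin leNgt; apply/negP => et; move: h; apply/negP; rewrite -leNgt.
rewrite leeBrDr// [leRHS](esumID X)// setTI leeD2l//; apply: (le_trans (ltW et)).
rewrite -(esum_set1 (a := fun t => (a t)%:E))//.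
by apply: le_esum_set => // _ ->.
Qed.

Lemma esum_words_rcons n (a : seq nat -> \bar R) : (forall u, 0 <= a u) ->
  \esum_(u in [set u | size u = n.+1]) a u =
  \esum_(u in [set u | size u = n]) \esum_(j in [set: nat]) a (rcons u j).
Proof.
move=> a0; rewrite (@esum_esum _ _ _ _ (fun=> setT) (fun i j => a (rcons i j)))//.
rewrite (@reindex_esum _ _ _ ([set i | size i = n] `*`` fun=> setT) _
  (fun k => rcons k.1 k.2))//.
split=> [[u j] [/= <- _]|[u j] [v k] _ _ /= /rcons_inj[-> ->]//|u /=].
  by rewrite size_rcons.
case/lastP: u => // u j; rewrite size_rcons => -[un].
by exists (u, j).
Qed.

Lemma esum_words (a : seq nat -> \bar R) : (forall u, 0 <= a u) ->
  \esum_(u in [set: seq nat]) a u =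
  \sum_(0 <= n <oo) \esum_(u in [set u | size u = n]) a u.
Proof.
move=> a0; rewrite nneseries_esumT => [|n]; last exact: esum_ge0.
rewrite -(esum_bigcupT (K := setT) (fun n => [set u | size u = n]))//.
- by congr esum; apply/seteqP; split=> // u _; exists (size u).
- by move=> i j _ _ [u [/= <- <-]].
Qed.

End countable_sums.

(** * From moments to tightness *)

Section tightness.
Context {R : realType} (beta : R) (x : seq nat -> beads R).

(** Off a finite set of words, segments at depth n are at most e (1 - r) r^n. A tree function is
    supported by a chain, with a single word per depth, so a geometric series bounds the rest by [e]
    however many words there are. *)
Lemma tight_tree_of_moment (p : nat) (r : R) : (0 < p)%N -> 0 < r -> r < 1 ->
  (\esum_(u in [set: seq nat]) ((seg_len beta x u / r ^+ size u) ^+ p)%:E < +oo)%E ->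
  tight_tree beta x.
Proof.
move=> p0 r0 r1 fin e e0.
have rn0 n : 0 < r ^+ n by exact: exprn_gt0.
have d0 : 0 < e * (1 - r) by rewrite mulr_gt0// subr_gt0.
have a0 u : 0 <= seg_len beta x u / r ^+ size u.
  by rewrite divr_ge0 ?seg_len_ge0// ltW.
have [W hW] := esum_finite_off (fun u => exprn_ge0 p (a0 u)) (exprn_gt0 p d0) fin.
exists W => f ft; rewrite esum_mkcond.
pose G u := if u \in W then 0 else f u.
have f0 u : 0 <= f u by exact: tree_fun_ge0 ft.
have small u : G u <= e * (1 - r) * r ^+ size u.
  rewrite /G; case: ifPn => [_|/hW]; first by rewrite mulr_ge0// ltW.
  rewrite ler_pXn2r ?nnegrE ?(ltW d0)// ler_pdivrMr//.
  by apply: le_trans; case/andP: (ft.1 u).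
rewrite (eq_esum (b := fun u => (G u)%:E)) => [|u _]; last first.
  rewrite /G; case: ifPn => [/set_mem/= /negbTE ->|/negP nu]//.
  by case: ifPn => // uW; case: nu; rewrite inE.
apply: (@chain_esum_le _ f G e) => //.
- exact: ltW.
- by move=> u v; exact: tree_fun_chain ft.
- by move=> u; rewrite /G; case: ifP.
- by move=> u; rewrite /G; case: ifP; rewrite ?ltxx.
move=> v _; apply: (@le_trans _ _ (\sum_(i < (size v).+1) e * (1 - r) * r ^+ i)).
  apply: ler_sum => i _; apply: le_trans (small _) _.
  by rewrite size_takel// -ltnS.
rewrite -mulr_sumr -mulrA ler_piMr ?(ltW e0)//.
have := subrX1 r (size v).+1; have := rn0 (size v).+1.
by move: (_ ^+ _) (\sum_(i < _) _) => a b ? ?; lra.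
Qed.

End tightness.

Section tight_families.
Context d (Omega : measurableType d) {R : realType} (P : probability Omega R).
Variables (beta : R) (xi : seq nat -> Omega -> beads R).
Hypothesis beta_gt0 : 0 < beta.
Hypothesis mxi : forall u, measurable_fun setT (xi u).
Hypothesis ind : mutually_independent P xi.
Variables (p : nat) (C rho : R).
Hypothesis p_beta : 2 <= p%:R * beta.
Hypothesis rho01 : 0 < rho < 1.
Hypothesis len_C : forall u, (\int[P]_w (len (xi u w) ^+ p)%:E <= C%:E)%E.
Hypothesis mass_rho : forall u, (\int[P]_w (mass (xi u w) 0%N)%:E <= rho%:E)%E.

Let p_gt0 : (0 < p)%N.
Proof.
by rewrite lt0n; apply: contraTneq p_beta => ->; rewrite mul0r -ltNge.
Qed.

Let prefixes (u : seq nat) := [seq take i u | i <- iota 0 (size u).+1].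

Let prefixes_uniq u : uniq (prefixes u).
Proof.
rewrite map_inj_in_uniq ?iota_uniq// => i j.
rewrite !mem_iota !add0n !ltnS /= => iu ju /(congr1 size).
by rewrite !size_takel.
Qed.

(** The factor by which the string at the prefix [v] enters the bound for the p-th power of the
    segment length of [u]. Distinct prefixes carry independent strings, so the mean of the product
    factorises. *)
Let f (u v : seq nat) (s : beads R) : R :=
  if (size v < size u)%N then mass s (nth 0%N u (size v)) ^+ 2 else len s ^+ p.

Let f_ge0 u v s : 0 <= f u v s.
Proof. by rewrite /f; case: ifP => _; rewrite exprn_ge0 ?mass_ge0// ltW// len_gt0. Qed.

Let mf u v : measurable_fun setT (f u v).
Proof.
rewrite /f; case: (size v < size u)%N; apply: measurable_funX.
  exact: measurable_mass.
exact: measurable_len.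
Qed.

Let mass_le1 (s : beads R) j : mass s j <= 1.
Proof. exact: le_trans (mass_le0 s j) (mass0_le1 s). Qed.

Let a v j : \bar R := (\int[P]_w (mass (xi v w) j ^+ 2)%:E)%E.
Let M u : \bar R := (\prod_(i < size u) a (take i u) (nth 0%N u i))%E.

Let a_ge0 v j : (0 <= a v j)%E.
Proof. by apply: integral_ge0 => w _; rewrite lee_fin sqr_ge0. Qed.

Let M_ge0 u : (0 <= M u)%E.
Proof. by apply: prode_ge0 => i _. Qed.

Let a_fin v j : a v j \is a fin_num.
Proof.
rewrite ge0_fin_numE//; apply: (@le_lt_trans _ _ 1%E); last exact: ltry.
rewrite -(integral_one P); apply: ge0_le_integral => //.
- by move=> w _; rewrite lee_fin sqr_ge0.
- by apply/measurable_EFinP; apply: measurable_funX; exact: measurable_xi_mass.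
- by move=> w _; rewrite lee_fin exprn_ile1 ?mass_ge0.
Qed.

Let len_fin v : (\int[P]_w (len (xi v w) ^+ p)%:E)%E \is a fin_num.
Proof.
rewrite ge0_fin_numE; first exact: le_lt_trans (len_C v) (ltry _).
by apply: integral_ge0 => w _; rewrite lee_fin exprn_ge0// ltW// len_gt0.
Qed.

Let seg_len_moment u :
  (\int[P]_w (seg_len beta (xi^~ w) u ^+ p)%:E <= C%:E * M u)%E.
Proof.
apply: (@le_trans _ _ (\int[P]_w (\prod_(v <- prefixes u) f u v (xi v w))%:E)%E).
  apply: ge0_le_integral => //.
  - by move=> w _; rewrite lee_fin exprn_ge0// seg_len_ge0.
  - apply/measurable_EFinP; apply: measurable_funX; exact: measurable_seg_len.
  - apply/measurable_EFinP; apply: measurable_prod => v _.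
    exact: measurableT_comp (mf u v) (mxi v).
  move=> w _; rewrite lee_fin big_map -[iota _ _]/(index_iota 0 (size u).+1) big_mkord.
  rewrite big_ord_recr/= take_size /f ltnn /seg_len exprMn ler_wpM2r//.
    by rewrite exprn_ge0// ltW// len_gt0.
  (* The exponent [p%:R * beta] is at least 2 and the product of masses at most 1, so the power is
     dominated by the square; a vanishing product is treated apart. *)
  apply: (@le_trans _ _ (checkP (xi^~ w) u ^+ 2)).
    rewrite -!powR_mulrn ?powR_ge0 ?checkP_ge0// -powRrM.
    have [->|c0] := eqVneq (checkP (xi^~ w) u) 0.
      by rewrite !powR0// gt_eqF// mulr_gt0// ltr0n.
    apply: ger_powR; last by rewrite mulrC.
    rewrite lt_neqAle eq_sym c0 checkP_ge0/= /checkP.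
    by apply: prodr_ile1 => i _; rewrite mass_ge0 mass_le1.
  rewrite /checkP -prodrXl; apply: ler_prod => i _.
  by rewrite sqr_ge0 /= size_takel ?ltn_ord// ltnW.
rewrite independent_mean//; last first.
  by move=> v _; rewrite /f; case: (size v < size u)%N; [exact: a_fin|exact: len_fin].
rewrite big_map -[iota _ _]/(index_iota 0 (size u).+1) big_mkord.
rewrite big_ord_recr/= take_size /f ltnn muleC.
apply: lee_pmul.
- by apply: integral_ge0 => w _; rewrite lee_fin exprn_ge0// ltW// len_gt0.
- apply: prode_ge0 => i _; apply: integral_ge0 => w _; rewrite lee_fin.
  by case: ifP => _; rewrite exprn_ge0 ?mass_ge0// ltW// len_gt0.
- exact: len_C.
rewrite le_eqVlt; apply/orP; left; apply/eqP; apply: eq_bigr => i _.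
by rewrite size_takel ?ltn_ord// ltnW.
Qed.

Let M_rcons v j : (M (rcons v j) = M v * a v j)%E.
Proof.
rewrite /M size_rcons big_ord_recr /=; congr (_ * _)%E.
  apply: eq_bigr => k _; rewrite nth_rcons ltn_ord -cats1 takel_cat//.
  exact/ltnW/ltn_ord.
by rewrite nth_rcons ltnn eqxx -cats1 take_size_cat.
Qed.

Let a_sum v : (\esum_(j in [set: nat]) a v j <= rho%:E)%E.
Proof.
rewrite -nneseries_esumT// -integral_nneseries//; last 2 first.
- move=> j; apply/measurable_EFinP; apply: measurable_funX; exact: measurable_xi_mass.
- by move=> j w _; rewrite lee_fin sqr_ge0.
apply: le_trans (mass_rho v); apply: ge0_le_integral => //.
- by move=> w _; apply: nneseries_ge0 => j _ _; rewrite lee_fin sqr_ge0.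
- apply: ge0_emeasurable_sum => j; first by move=> w _; rewrite lee_fin sqr_ge0.
  by move=> _; apply/measurable_EFinP; apply: measurable_funX; exact: measurable_xi_mass.
- by apply/measurable_EFinP; exact: measurable_xi_mass.
move=> w _; apply: (@le_trans _ _ (\sum_(0 <= j <oo)
    (mass (xi v w) 0%N)%:E * (mass (xi v w) j)%:E)%E).
  apply: lee_nneseries => j; first by move=> _ _; rewrite lee_fin sqr_ge0.
  by move=> _; rewrite -EFinM lee_fin expr2 ler_wpM2r ?mass_ge0// mass_le0.
rewrite nneseriesZl; last by move=> j _; rewrite lee_fin mass_ge0.
by rewrite mass_sum mule1.
Qed.

Let M_fin u : M u \is a fin_num.
Proof. exact: prode_fin_num. Qed.

Let rho0 : 0 < rho. Proof. by case/andP: rho01. Qed.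

Let rho1 : rho < 1. Proof. by case/andP: rho01. Qed.

Let M_level n : (\esum_(u in [set u | size u = n]) M u <= (rho ^+ n)%:E)%E.
Proof.
elim: n => [|n IH].
  rewrite (_ : [set u | _] = [set [::]]).
    by rewrite esum_set1// /M big_ord0.
  by apply/seteqP; split=> [i /= /size0nil//|i ->].
rewrite esum_words_rcons//.
apply: (@le_trans _ _ (\esum_(u in [set u | size u = n]) (rho%:E * M u))%E).
  apply: le_esum => u _; under eq_esum do rewrite M_rcons.
  rewrite (eq_esum (b := fun j => ((fine (M u))%:E * (fine (a u j))%:E)%E)) => [|j _].
    rewrite esumZ ?fine_ge0// => [|j]; last by rewrite fine_ge0.
    rewrite fineK ?M_fin// muleC; apply: lee_wpmul2r => //.
    by under eq_esum do rewrite fineK//.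
  by rewrite !fineK ?M_fin.
rewrite (eq_esum (b := fun u => (rho%:E * (fine (M u))%:E)%E)) => [|u _]; last first.
  by rewrite fineK ?M_fin.
rewrite esumZ ?(ltW rho0)// => [|u]; last by rewrite fine_ge0.
rewrite exprS EFinM; apply: lee_wpmul2l; first by rewrite lee_fin ltW.
by under eq_esum do rewrite fineK ?M_fin//.
Qed.

Let C0 : 0 <= C.
Proof.
rewrite -lee_fin; apply: le_trans (len_C [::]).
by apply: integral_ge0 => w _; rewrite lee_fin exprn_ge0// ltW// len_gt0.
Qed.

Lemma ae_tight_tree : {ae P, forall w, tight_tree beta (xi^~ w)}.
Proof.
(* With t^2 = rho and r^p = t, dividing the p-th moments at depth n by r^(pn) = t^n turns the bound
   rho^n into t^n, which is still summable. *)
set t := Num.sqrt rho.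
have tt : t ^+ 2 = rho by rewrite sqr_sqrtr// ltW.
have t0 : 0 < t by rewrite sqrtr_gt0.
have t1 : t < 1.
  by rewrite -(@ltr_pXn2r _ 2)// ?nnegrE ?(ltW t0)// tt expr1n.
set r := t `^ p%:R^-1.
have rp : r ^+ p = t.
  by rewrite -powR_mulrn ?powR_ge0// -powRrM mulVf ?powRr1// ?(ltW t0)// pnatr_eq0 -lt0n.
have r0 : 0 < r by exact: powR_gt0.
have r1 : r < 1.
  rewrite ltNge; apply/negP => r1; move: t1; apply/negP; rewrite -leNgt -rp.
  exact: exprn_ege1.
have rn0 n : 0 < r ^+ n by exact: exprn_gt0.
pose b u w := ((seg_len beta (xi^~ w) u / r ^+ size u) ^+ p)%:E.
have b0 u w : (0 <= b u w)%E.
  by rewrite lee_fin exprn_ge0// divr_ge0 ?seg_len_ge0// ltW.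
have mb u : measurable_fun setT (b u).
  apply/measurable_EFinP; apply: measurable_funX; apply: measurable_funM.
    exact: measurable_seg_len.
  exact: measurable_cst.
have bE u : (\int[P]_w b u w <= (C * t^-1 ^+ size u)%:E * M u)%E.
  have k0 : 0 <= t^-1 ^+ size u by rewrite exprn_ge0// invr_ge0 ltW.
  rewrite [C * _]mulrC EFinM -muleA.
  apply: le_trans (lee_wpmul2l _ (seg_len_moment u)); last by rewrite lee_fin.
  rewrite -ge0_integralZl//.
  - rewrite le_eqVlt; apply/orP; left; apply/eqP; apply: eq_integral => w _.
    have rpn : (r ^+ size u)^-1 ^+ p = t^-1 ^+ size u.
      by rewrite exprVn -exprM mulnC exprM rp exprVn.
    by rewrite /b -EFinM exprMn mulrC rpn.
  - by apply/measurable_EFinP; apply: measurable_funX; exact: measurable_seg_len.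
  - by move=> w _; rewrite lee_fin exprn_ge0// seg_len_ge0.
have fin : (\int[P]_w (\esum_(u in [set: seq nat]) b u w) < +oo)%E.
  rewrite integral_esum//.
  apply: (@le_lt_trans _ _ (C%:E * (1 - t)^-1%:E)%E); last by rewrite -EFinM ltry.
  apply: (le_trans (le_esum (fun u _ => bE u))).
  rewrite esum_words => [|u]; last first.
    by rewrite mule_ge0// lee_fin mulr_ge0// exprn_ge0// invr_ge0 ltW.
  apply: (@le_trans _ _ (\sum_(0 <= n <oo) (C%:E * (t ^+ n)%:E))%E); last first.
    rewrite nneseriesZl; last by move=> n _; rewrite lee_fin exprn_ge0// ltW.
    by apply: lee_wpmul2l; rewrite ?lee_fin// geometric_nneseries_le// ltW.
  apply: lee_nneseries => n.
    move=> _ _; apply: esum_ge0 => u _.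
    by rewrite mule_ge0// lee_fin mulr_ge0// exprn_ge0// invr_ge0 ltW.
  move=> _; have k0 : 0 <= C * t^-1 ^+ n by rewrite mulr_ge0// exprn_ge0// invr_ge0 ltW.
  rewrite (eq_esum (b := fun u => ((C * t^-1 ^+ n)%:E * (fine (M u))%:E)%E)); last first.
    by move=> u /= <-; rewrite fineK ?M_fin.
  rewrite esumZ// => [|u]; last by rewrite fine_ge0.
  under eq_esum do rewrite fineK ?M_fin//.
  apply: (le_trans (lee_wpmul2l _ (M_level n))); first by rewrite lee_fin.
  rewrite -!EFinM lee_fin -mulrA ler_wpM2l// -exprMn -tt.
  by rewrite expr2 mulrA mulVf ?mul1r// gt_eqF.
have := @integrable_ae _ _ _ P setT measurableT (fun w => \esum_(u in [set: seq nat]) b u w)%E.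
have ib : P.-integrable setT (fun w => \esum_(u in [set: seq nat]) b u w)%E.
  apply/integrableP; split; first exact: measurable_esum.
  by under eq_integral do rewrite gee0_abs ?esum_ge0//.
move=> /(_ ib); apply: filterS => w /(_ Logic.I) bfin.
apply: (@tight_tree_of_moment _ _ _ p r) => //.
by rewrite -ge0_fin_numE//; apply: esum_ge0 => u _; exact: b0.
Qed.

End tight_families.

(** * Almost sure convergence *)

Section deterministic_limit.
Context {R : realType} (beta : R).
Hypothesis beta_gt0 : 0 < beta.

Lemma emb_measure_tree (x : seq nat -> beads R) n : tight_tree beta x ->
  emb_measure beta x n (emb_tree beta x n) = 1%E.
Proof.
move=> tx; rewrite emb_treeE (emb_measureE tx); last first.
  by apply: borel_closed; exact: closed_limit_tree.
rewrite (_ : _ @^-1` _ = setT); first exact: unif01_setT.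
by apply/seteqP; split=> // s _; apply: l1_trunc_limit_tree; exact: limit_fun_tree.
Qed.

(** The limit measure is built from the tightness proof of [y]. In the application [y] is a family
    modified on a null event, which agrees with [x] off that event by a provable equation only. *)
Lemma emb_limit (x y : seq nat -> beads R) (ty : tight_tree beta y) : y = x ->
  (forall i, tight_tree beta (subfamily x i)) ->
  let K := limit_tree beta y setT in let mu := limit_measure ty in
  [/\ hp_dist (emb_tree beta x n, emb_measure beta x n : probability (borel (l1U R)) R)
              (K, mu) @[n --> \oo] --> 0%E,
      embeds_onto (Tstar beta x [::]) K &
      exists mustar : probability (borel (Tstar beta x [::])) R,
        weighted_isometric (WeightedSpace setT mustar) (WeightedSpace K mu) /\
        ghp_dist (WeightedSpace (emb_tree beta x n) (emb_measure beta x n))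
                 (WeightedSpace setT mustar) @[n --> \oo] --> 0%E].
Proof.
move=> yx; subst y => tx K mu.
have hp0 : hp_dist (emb_tree beta x n, emb_measure beta x n : probability (borel (l1U R)) R)
    (K, mu) @[n --> \oo] --> 0%E.
  apply/ereal_cvg0P => [n|e e0]; first exact: hp_dist_ge0.
  have e2 : 0 < e / 2 by rewrite divr_gt0.
  near=> n; apply: (@le_lt_trans _ _ (e / 2)%:E); last by rewrite lte_fin; lra.
  apply: hp_dist_le => /=; apply: ltW.
    by rewrite emb_treeE; near: n; exact: limit_tree_hausdorff.
  by near: n; exact: emb_measure_prokhorov.
have emb : embeds_onto (Tstar beta x [::]) K.
  have := Tstar_embeds beta_gt0 tx [::].
  by rewrite (_ : subfamily x [::] = x).
split=> //; have [f [fI f0 fr]] := emb.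
have cK : closed K by exact: closed_limit_tree.
have muK : mu K = 1%E by exact: limit_measure_tree.
exists (pullback_measure f mu); split; first exact: pullback_weighted_isometric.
apply/ereal_cvg0P => [n|e e0]; first exact: ghp_dist_ge0.
have /ereal_cvg0P h := hp0.
apply: filterS (h (fun n => hp_dist_ge0 _ _) _ e0) => n; apply: le_lt_trans.
apply: ghp_dist_pullback => //.
- by rewrite emb_treeE; exact: closed_limit_tree.
- exact: emb_measure_tree.
Unshelve. all: by end_near. Qed.

End deterministic_limit.

Section almost_sure_tightness.
Context d (Omega : measurableType d) {R : realType} (P : probability Omega R).
Variables (beta : R) (xi : seq nat -> Omega -> beads R).
Hypotheses (beta_gt0 : 0 < beta).
Hypothesis xi_root : is_string P beta beta (xi [::]).
Hypothesis xi_mixed : forall i : seq nat, i <> [::] -> is_mixed_string P beta (xi i).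
Hypothesis xi_indep : mutually_independent P xi.

Lemma measurable_string u : measurable_fun setT (xi u).
Proof.
have [->|/eqP/xi_mixed] := eqVneq u [::]; first by case: xi_root.
by rewrite /is_mixed_string; case: ifP => _ [].
Qed.

Lemma mutually_independent_subfamily i :
  mutually_independent P (fun v => xi (i ++ v)).
Proof.
move=> J A uJ mA.
(* Dropping the prefix [i] recovers [v] from [i ++ v], which extends the events to all words as
   indices. *)
have := xi_indep (J := map (cat i) J) (A := fun v => A (drop (size i) v)).
rewrite !big_map map_inj_uniq; last first.
  by move=> u v /eqP; rewrite eqseq_cat// => /andP[_ /eqP].
move=> /(_ uJ (fun v => mA _)).
by under eq_bigr do rewrite drop_size_cat//;
  under [in RHS]eq_bigr do rewrite drop_size_cat//.
Qed.

Lemma ae_tight_subfamilies :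
  {ae P, forall w, forall i, tight_tree beta (subfamily (xi^~ w) i)}.
Proof.
(* This [p] exceeds 2 / [beta]. Root string and mixed strings have their own moment and mass bounds,
   hence the maxima of constants. *)
pose p := (Num.truncn (2 / beta)).+1.
have p_beta : 2 <= p%:R * beta.
  by rewrite -ler_pdivrMr//; apply: ltW; exact: truncnS_gt.
have [C1 hC1] := @string_len_moment R beta beta beta_gt0 p (ltn0Sn _).
have [C2 hC2] := mixed_len_moment beta_gt0 (p := p) (ltn0Sn _).
have [r1 /andP[r10 r11] hr1] := @string_mass_mean R beta beta beta_gt0.
have [r2 /andP[r20 r21] hr2] := mixed_mass_mean beta_gt0.
have hC u : (\int[P]_w (len (xi u w) ^+ p)%:E <= (Num.max C1 C2)%:E)%E.
  have [->|/eqP nu] := eqVneq u [::].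
    by apply: (le_trans (hC1 _ _ _ _ xi_root)); rewrite lee_fin le_max lexx.
  by apply: (le_trans (hC2 _ _ _ _ (xi_mixed nu))); rewrite lee_fin le_max lexx orbT.
have hr u : (\int[P]_w (mass (xi u w) 0%N)%:E <= (Num.max r1 r2)%:E)%E.
  have [->|/eqP nu] := eqVneq u [::].
    by apply: (le_trans (hr1 _ _ _ _ xi_root)); rewrite lee_fin le_max lexx.
  by apply: (le_trans (hr2 _ _ _ _ (xi_mixed nu))); rewrite lee_fin le_max lexx orbT.
have r01 : 0 < Num.max r1 r2 < 1 by rewrite lt_max r10 gt_max r11 r21.
have tight i : {ae P, forall w, tight_tree beta (subfamily (xi^~ w) i)}.
  apply: (ae_tight_tree (xi := fun v => xi (i ++ v)) beta_gt0 _ _ p_beta r01).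
  - by move=> u; exact: measurable_string.
  - exact: mutually_independent_subfamily.
  - by move=> u; exact: hC.
  - by move=> u; exact: hr.
(* Tightness is wanted for all subfamilies on one event: words are countable, and [pickle_inv] lets
   integers index them. *)
have /ae_foralln : forall k, {ae P, forall w,
    forall i, pickle_inv k = Some i -> tight_tree beta (subfamily (xi^~ w) i)}.
  move=> k; case: pickle_inv => [i|]; last exact: aeW.
  by apply: filterS (tight i) => w ti _ [<-].
by apply: filterS => w h i; apply: (h (pickle i)); rewrite pickleK_inv.
Qed.

End almost_sure_tightness.

Theorem proposition4p12 (R : realType) (d : measure_display)
    (Omega : measurableType d) (P : probability Omega R)
    (beta : R) (xi : seq nat -> Omega -> beads R)
    (beta_gt0 : 0 < beta) (beta_le : beta <= 2^-1)
    (xi_root : is_string P beta beta (xi [::]))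
    (xi_mixed : forall i : seq nat, i <> [::] -> is_mixed_string P beta (xi i))
    (xi_indep : mutually_independent P xi) :
  {ae P, forall w, forall i : seq nat,
     rooted_isometric (Tstar beta (xi^~ w) i)
       (phi beta (xi i w) (fun j => Tstar beta (xi^~ w) (rcons i j)))} /\
  exists (T : Omega -> set (l1U R)) (mu : Omega -> probability (borel (l1U R)) R),
    random_weighted_tree T mu /\
    {ae P, forall w,
      [/\ hp_dist (emb_tree beta (xi^~ w) n,
                   emb_measure beta (xi^~ w) n : probability (borel (l1U R)) R)
                  (T w, mu w) @[n --> \oo] --> 0%E,
          (exists f : Tstar beta (xi^~ w) [::] -> l1U R,
             [/\ isometric_on setT f, f point = point & range f = T w]) &
          exists mustar : probability (borel (Tstar beta (xi^~ w) [::])) R,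
            weighted_isometric (WeightedSpace setT mustar)
                               (WeightedSpace (T w) (mu w)) /\
            ghp_dist (WeightedSpace (emb_tree beta (xi^~ w) n)
                                    (emb_measure beta (xi^~ w) n))
                     (WeightedSpace setT mustar) @[n --> \oo] --> 0%E]}.
Proof.
have tight := ae_tight_subfamilies beta_gt0 xi_root xi_mixed xi_indep.
split; first by apply: filterS tight => w tx i; exact: Tstar_recursive.
(* [random_weighted_tree] asks for a weighted tree at every outcome, not only almost surely; hence a
   default outcome [w0]. *)
have [w0 tw0] := ae_exists tight.
have [N [mN N0 sN]] := tight.
(* Off a null event, where the families may fail to be tight, the family is
   replaced by a fixed tight one. *)
pose xi' u w := if pselect (N w) then xi u w0 else xi u w.
have xiE w : ~ N w -> xi'^~ w = xi^~ w.
  by move=> Nw; apply/funext => u; rewrite /xi'; case: pselect.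
have tN w : ~ N w -> forall i, tight_tree beta (subfamily (xi^~ w) i).
  by move=> Nw; apply: contrapT => h; apply: Nw; exact: sN.
have nil x : subfamily x [::] = x :> (seq nat -> beads R) by [].
have txi' w : tight_tree beta (xi'^~ w).
  have [Nw|Nw] := pselect (N w); last by rewrite xiE//; exact: (tN w Nw [::]).
  have -> : xi'^~ w = xi^~ w0 by apply/funext => u; rewrite /xi'; case: pselect.
  exact: (tw0 [::]).
have mxi' u : measurable_fun setT (xi' u).
  have mu : measurable_fun setT (xi u) by exact: measurable_string xi_root xi_mixed u.
  move=> _ A mA; rewrite setTI.
  have -> : xi' u @^-1` A = (N `&` [set _ | A (xi u w0)]) `|` (~` N `&` xi u @^-1` A).
    apply/seteqP; split=> w /=; rewrite /xi'; case: pselect => Nw.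
    - by left.
    - by right.
    - by case=> -[].
    - by case=> -[].
  apply: measurableU.
    have [Au|nAu] := pselect (A (xi u w0)).
      by rewrite (_ : [set _ | _] = setT) ?setIT//; apply/seteqP; split.
    by rewrite (_ : [set _ | _] = set0) ?setI0//; apply/seteqP; split.
  apply: measurableI; first exact: measurableC.
  by rewrite -[X in measurable X]setTI; exact: mu.
exists (fun w => limit_tree beta (xi'^~ w) setT), (fun w => limit_measure (txi' w)).
split; first exact: limit_tree_random.
exists N; split=> // w /=; apply: contra_notP => Nw.
exact: (emb_limit beta_gt0 (txi' w) (xiE w Nw) (tN w Nw)).
Qed.
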